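(* Let $U,X$ be complex Hilbert spaces and let $S=\begin{bmatrix}A\&B\\ C\&D\end{bmatrix}$ be an impedance passive system node on $(U,X,U)$ whose transfer function $P$ satisfies $P(\lambda)+P(\lambda)^*\ge c_\lambda I$ for some $\lambda,c_\lambda>0$ and whose output operator $C$ is such that $\mathrm{Ker}(C)$ is dense in $X$. Let $\phi:U\to U$ be a locally Lipschitz continuous monotone function such that $\phi(0)=0$, $\mathrm{Re}\,\langle\phi(u_2)-\phi(u_1),u_2-u_1\rangle>0$ whenever $\phi(u_1)\ne\phi(u_2)$, and there exist $\alpha,\beta,\delta>0$ such that $$\mathrm{Re}\,\langle\phi(u),u\rangle\ge\alpha\|u\|^2\ \text{ when }\|u\|<\delta,\qquad \mathrm{Re}\,\langle\phi(u),u\rangle\ge\beta\ \text{ when }\|u\|\ge\delta .$$ Assume further that the semigroup associated with the original system under linear negative feedback $u(t)=-y(t)$, i.e. the semigroup generated by $A^K$ (defined in the context), is strongly stable. Then the origin is a globally asymptotically stable equilibrium point of $$\begin{bmatrix}\dot x(t)\\ y(t)\end{bmatrix}=\begin{bmatrix}A\&B\\ C\&D\end{bmatrix}\begin{bmatrix}x(t)\\ \phi(-y(t))\end{bmatrix},\qquad t\ge 0,$$ i.e., for every initial state $x_0\in X$ this system has a well-defined generalised solution $x\in C([0,\infty);X)$ with $x(0)=x_0$, and $\|x(t)\|\to0$ as $t\to\infty$.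
   Context: For a generator $A$ of a strongly continuous semigroup on $X$, $X_{-1}$ is the completion of $X$ in the norm $\|(\lambda_0-A)^{-1}\cdot\|_X$ ($\lambda_0\in\rho(A)$ fixed), and $A$ also denotes its extension in $\mathcal{L}(X,X_{-1})$. A system node on Hilbert spaces $(U,X,Y)$ is a closed operator $S=\begin{bmatrix}A\&B\\ C\&D\end{bmatrix}:D(S)\subset X\times U\to X\times Y$ such that: (i) $Ax=A\&B\begin{bmatrix}x\\ 0\end{bmatrix}$, $D(A)=\{x\in X:(x,0)^\top\in D(S)\}$, generates a strongly continuous semigroup on $X$; (ii) $A\&B$ extends to an operator $[A,\ B]\in\mathcal{L}(X\times U,X_{-1})$; (iii) $D(S)=\{(x,u)^\top\in X\times U: Ax+Bu\in X\}$. Its output operator is $Cx=C\&D\begin{bmatrix}x\\ 0\end{bmatrix}$, $x\in D(A)$, and its transfer function is $P(\lambda)u=C\&D\begin{bmatrix}(\lambda-A)^{-1}Bu\\ u\end{bmatrix}$, $u\in U$, $\lambda\in\rho(A)$. $S$ is impedance passive if $Y=U$ and $\mathrm{Re}\,\langle A\&B\begin{bmatrix}x\\ u\end{bmatrix},x\rangle_X\le\mathrm{Re}\,\langle C\&D\begin{bmatrix}x\\ u\end{bmatrix},u\rangle_U$ for all $(x,u)^\top\in D(S)$. $\phi$ is monotone if $\mathrm{Re}\,\langle\phi(u_2)-\phi(u_1),u_2-u_1\rangle\ge0$ for all $u_1,u_2\in U$. A strongly continuous semigroup $\mathbb{T}$ is strongly stable if $\mathbb{T}_tx_0\to0$ as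 $t\to\infty$ for all $x_0\in X$. The operator $A^K$ has domain $D(A^K)$ consisting of those $x\in X$ for which there exists $v\in U$ with $Ax-Bv\in X$ and $v=C\&D\begin{bmatrix}x\\ -v\end{bmatrix}$ (such $v=v(x)$ is unique), and $A^Kx=Ax-Bv(x)$; for an impedance passive $S$ it generates a contraction semigroup. The operator $A_\phi$ has domain $D(A_\phi)$ consisting of those $x\in X$ for which there exists $v\in U$ with $Ax+B\phi(-v)\in X$ and $v=C\&D\begin{bmatrix}x\\ \phi(-v)\end{bmatrix}$ (unique under the stated assumptions), and $A_\phi x=Ax+B\phi(-v(x))$. A strong solution is a function $x\in H^1_{\mathrm{loc}}(0,\infty;X)$ (i.e. in $H^1(0,\tau;X)$ for all $\tau>0$) with $x(t)\in D(A_\phi)$ for all $t\ge0$ and $\dot x(t)=A_\phi(x(t))$ for a.e. $t\ge0$. A generalised solution is a function $x\in C([0,\infty);X)$ for which there is a sequence $(x^k)$ of strong solutions with $\sup_{t\in[0,\tau]}\|x^k(t)-x(t)\|\to0$ as $k\to\infty$ for all $\tau>0$. *)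

(* Defs.v *)
From HB Require Import structures.
From mathcomp Require Import all_boot all_order all_algebra.
From mathcomp Require Import complex sesquilinear.
From mathcomp Require Import all_classical all_reals all_analysis.
Set Implicit Arguments.
Unset Strict Implicit.
Unset Printing Implicit Defensive.
Import Order.TTheory GRing.Theory Num.Theory Num.Def.
Import numFieldNormedType.Exports.

Local Open Scope classical_set_scope.
Local Open Scope ring_scope.
Local Open Scope complex_scope.

(* A complex Hilbert space: the scalars are R[i] for the field R of real
   numbers, and the norm of X is the one induced by an inner product, which is
   linear in its first argument. *)
HB.mixin Record CompleteNormedModule_isHilbert (R : realType) X
    of CompleteNormedModule R[i] X := {
  hdot : {dot X for @Num.conj R[i]} ;
  hdotE : forall x : X, `|x| ^+ 2 = hdot x x
}.

#[short(type="hilbertType")]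
HB.structure Definition Hilbert (R : realType) :=
  {X of CompleteNormedModule R[i] X & CompleteNormedModule_isHilbert R X}.

Definition inner (R : realType) (X : hilbertType R) (x y : X) : R[i] :=
  (hdot : {dot X for @Num.conj R[i]}) x y.

(* The norm of an R[i]-normed module is R[i]-valued; hnorm is the same norm
   seen as an element of R. *)
Definition hnorm (R : realType) (X : normedModType R[i]) (x : X) : R :=
  complex.Re `|x|.

(* An operator A : D(A) `<=` V -> W; the values of app outside dom are
   irrelevant. *)
Record partial_op (V W : Type) := PartialOp {
  dom : set V ;
  app :> V -> W
}.

Definition graph (V W : Type) (A : partial_op V W) : set (V * W) :=
  [set p | dom A p.1 /\ p.2 = A p.1].

Definition linear_op (K : pzRingType) (V W : lmodType K)
    (A : partial_op V W) : Prop :=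
  dom A 0 /\
  forall (a : K) (x y : V), dom A x -> dom A y ->
    dom A (a *: x + y) /\ A (a *: x + y) = a *: A x + A y.

Section Semigroup.
Context (R : realType) (X : hilbertType R).
Implicit Types (T : R -> {linear X -> X}) (A : partial_op X X).

(* Only the values T t with 0 <= t are constrained. *)
Record C0_semigroup T : Prop := {
  C0_bounded : forall t, 0 <= t -> continuous (T t) ;
  C0_id : forall x, T 0 x = x ;
  C0_add : forall s t, 0 <= s -> 0 <= t -> forall x, T (s + t) x = T s (T t x) ;
  C0_strong : forall x, T t x @[t --> 0^'+] --> x
}.

Definition generates A T : Prop :=
  forall x y, (dom A x /\ A x = y) <->
    (h^-1)%:C *: (T h x - x) @[h --> 0^'+] --> y.

Definition strongly_stable T : Prop :=
  forall x, T t x @[t --> +oo] --> (0 : X).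

Definition is_resolvent A (l : R[i]) (Rl : {linear X -> X}) : Prop :=
  [/\ continuous Rl,
      forall x, dom A (Rl x) /\ l *: Rl x - A (Rl x) = x &
      forall x, dom A x -> Rl (l *: x - A x) = x].

Definition resolvent_set A : set R[i] :=
  [set l | exists Rl, is_resolvent A l Rl].

End Semigroup.

Section SystemNode.
Context (R : realType) (U X Y : hilbertType R).

Definition main_op (S : partial_op (X * U) (X * Y)) : partial_op X X :=
  PartialOp [set x | dom S (x, 0)] (fun x => (S (x, 0)).1).

Definition output_op (S : partial_op (X * U) (X * Y)) : partial_op X Y :=
  PartialOp [set x | dom S (x, 0)] (fun x => (S (x, 0)).2).

(* A system node, together with its extrapolation space.  A&B and C&D are the
   first and second components of the operator node.  The space Xm1, with the
   embedding emb of X into it, is the completion of X for the norm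
   |(lam0 - A)^-1 x|; it is determined by A up to isomorphism.  The extension
   [A, B] of A&B is given by its two components Aext and Bop. *)
Record system_node := SystemNode {
  node :> partial_op (X * U) (X * Y) ;
  node_linear : linear_op node ;
  node_closed : closed (graph node) ;
  node_generator : exists T : R -> {linear X -> X},
    C0_semigroup T /\ generates (main_op node) T ;
  Xm1 : completeNormedModType R[i] ;
  emb : {linear X -> Xm1} ;
  lam0 : R[i] ;
  res0 : {linear X -> X} ;
  res0P : is_resolvent (main_op node) lam0 res0 ;
  emb_norm : forall x, `|emb x| = `|res0 x| ;
  emb_dense : dense (range emb) ;
  Aext : {linear X -> Xm1} ;
  Aext_continuous : continuous Aext ;
  AextE : forall x, dom (main_op node) x -> Aext x = emb (main_op node x) ;
  Bop : {linear U -> Xm1} ;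
  Bop_continuous : continuous Bop ;
  ABE : forall x u, dom node (x, u) -> emb (node (x, u)).1 = Aext x + Bop u ;
  node_domE : forall x u, dom node (x, u) <-> range emb (Aext x + Bop u)
}.

Definition kerC (S : system_node) : set X :=
  [set x | dom (output_op S) x /\ output_op S x = 0].

(* (l - A)^-1 on the extrapolation space. *)
Definition res_ext (S : system_node) (l : R[i]) (z : Xm1 S) : X :=
  get [set x | l *: emb S x - Aext S x = z].

Definition transfer (S : system_node) (l : R[i]) (u : U) : Y :=
  (S (res_ext l (Bop S u), u)).2.

(* The element of X identified with z. *)
Definition unemb (S : system_node) (z : Xm1 S) : X :=
  get [set x | emb S x = z].

End SystemNode.

Definition adjoint_of (R : realType) (U : hilbertType R) (P Q : U -> U) : Prop :=
  forall u v, inner (P u) v = inner u (Q v).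

Section Feedback.
Context (R : realType) (U X : hilbertType R) (S : system_node U X U).

Definition impedance_passive : Prop :=
  forall x u, dom S (x, u) ->
    complex.Re (inner (S (x, u)).1 x) <= complex.Re (inner (S (x, u)).2 u).

(* v is an output at the state x under the feedback u = phi (- y). *)
Definition feedback_output (phi : U -> U) (x : X) : set U :=
  [set v | range (emb S) (Aext S x + Bop S (phi (- v))) /\
           v = (S (x, phi (- v))).2].

(* The operator A_phi; get selects the output v(x). *)
Definition feedback_op (phi : U -> U) : partial_op X X :=
  PartialOp [set x | feedback_output phi x !=set0]
    (fun x => unemb (Aext S x + Bop S (phi (- get (feedback_output phi x))))).

(* A^K is the case phi = id, where Ax + B phi(-v) = Ax - Bv. *)
Definition feedback_K : partial_op X X := feedback_op id.

End Feedback.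

Definition locally_lipschitz (K : numFieldType) (V W : normedModType K)
    (f : V -> W) : Prop :=
  forall x : V, exists2 N, nbhs x N & [lipschitz f z | z in N].

Definition monotone_fun (R : realType) (U : hilbertType R) (phi : U -> U) : Prop :=
  forall u1 u2, 0 <= complex.Re (inner (phi u2 - phi u1) (u2 - u1)).

Section Bochner.
Context (R : realType) (X : hilbertType R).
Implicit Types (D : set R) (s g x : R -> X).

Let mu : set R -> \bar R := @lebesgue_measure R.

Definition simple_fun s : Prop :=
  finite_set (range s) /\ forall v, measurable (s @^-1` [set v]).

(* Used on sets D of finite measure only. *)
Definition simple_integral D s : X :=
  \sum_(v \in range s) (fine (mu (D `&` s @^-1` [set v])))%:C *: v.

Definition strongly_measurable D g : Prop :=
  exists2 s_ : nat -> R -> X, forall n, simple_fun (s_ n) &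
    forall t, D t -> s_ n t @[n --> \oo] --> g t.

Definition is_bochner_integral D g (I : X) : Prop :=
  strongly_measurable D g /\
  exists s_ : nat -> R -> X,
    [/\ forall n, simple_fun (s_ n),
        (\int[@lebesgue_measure R]_(t in D) (hnorm (s_ n t - g t))%:E)%E
          @[n --> \oo] --> 0%E &
        simple_integral D (s_ n) @[n --> \oo] --> I].

Definition L2_on D g : Prop :=
  strongly_measurable D g /\
  (\int[@lebesgue_measure R]_(t in D) ((hnorm (g t)) ^+ 2)%:E < +oo)%E.

(* x is in H^1(0, tau; X), represented by its continuous version on [0, tau],
   and its weak derivative is g. *)
Definition H1_with_derivative (tau : R) x g : Prop :=
  L2_on `[0, tau] g /\
  forall t, 0 <= t <= tau -> is_bochner_integral `[0, t] g (x t - x 0).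

Definition H1loc_with_derivative x g : Prop :=
  forall tau, 0 < tau -> H1_with_derivative tau x g.

End Bochner.

Section Solutions.
Context (R : realType) (U X : hilbertType R) (S : system_node U X U).
Context (phi : U -> U).
Implicit Types x : R -> X.

Definition strong_solution x : Prop :=
  (forall t, 0 <= t -> dom (feedback_op S phi) (x t)) /\
  exists2 dx : R -> X, H1loc_with_derivative x dx &
    {ae @lebesgue_measure R, forall t, 0 <= t -> dx t = feedback_op S phi (x t)}.

Definition generalised_solution x : Prop :=
  {within `[0, +oo[, continuous x} /\
  exists2 x_ : nat -> R -> X, forall k, strong_solution (x_ k) &
    forall tau, 0 < tau -> {uniform `[0, tau], x_ @ \oo --> x}.

End Solutions.

(* Main.v *)
From HB Require Import structures.
Require Import Defs.
From mathcomp Require Import all_boot all_order all_algebra.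
From mathcomp Require Import complex sesquilinear zify ring lra.
From mathcomp Require Import all_classical all_reals all_analysis.
From mathcomp Require Import measurable_realfun.
Set Implicit Arguments.
Unset Strict Implicit.
Unset Printing Implicit Defensive.
Import Order.TTheory GRing.Theory Num.Theory Num.Def.
Import numFieldNormedType.Exports.
Local Open Scope classical_set_scope.
Local Open Scope ring_scope.
Local Open Scope complex_scope.

(** Let A_phi be the operator of the closed loop and P the transfer function at
    lam. Passivity applied to differences of trajectories, and monotonicity of
    phi, make A_phi dissipative ([feedback_dissipative]). Its domain contains
    Ker C because phi 0 = 0, hence is dense. The equation x - h A_phi x = f is
    solvable for all h > 0 ([feedback_solvable]): it suffices to treat h = 1 /
    lam, where splitting the state into (lam - A)^-1 (lam f) and a part driven
    by the input leaves the equation w + P (phi w) = g for w = - y. Since P has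
    an adjoint it is bounded; since it is coercive it is strongly monotone,
    hence invertible. So the equation reads P^-1 w + phi w = P^-1 g, and a
    strongly monotone, locally Lipschitz map is onto
    ([strongly_monotone_onto]).

    A densely defined m-dissipative operator generates a semigroup of
    contractions ([nl_semigroup]): the norm of A decreases along implicit Euler
    schemes while the squares of its increments are summable, so that schemes
    of dyadic step size form a Cauchy sequence ([euler_cauchy]). Orbits that
    start in the domain are Lipschitz and have A as a right-continuous right
    derivative ([nl_semigroup_increment], [nl_semigroup_op_right_cont]).
    Pairing with vectors reduces the fundamental theorem for them to the scalar
    one, so they are strong solutions ([right_derivative_H1loc]), and density
    makes every orbit a generalised solution. Conversely, any two strong
    solutions do not move apart ([weak_contraction]), which gives uniqueness.

    For the decay, the closed loop is compared with linear feedback, from which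
    its input differs by w = phi (- y) + y. Along an orbit x that starts in the
    domain, y and phi (- y) stay bounded by coercivity of P
    ([node_input_output_bounded]), and on bounded sets |w|^2 is at most a
    constant K times the power that phi dissipates ([deviation_le_power]). If z
    is an orbit of the linear loop, completing the square bounds the derivative
    of |x - z|^2 by |w|^2 / 2, so that |x - z|^2 + (K / 4) |x|^2 does not
    increase ([energy_comparison], [closed_loop_comparison]). Start z close to
    x at a time when |x| is close to its infimum: from then on |x| can hardly
    decrease, so x stays close to z, which tends to 0 by strong stability
    ([closed_loop_decay_dom]). Contractivity extends the decay to all orbits. *)

(** * Real Hilbert spaces *)

(** Passivity, monotonicity and dissipativity only involve the real part of
    the inner product, so most of the argument takes place in real Hilbert
    spaces. *)
HB.mixin Record CompleteNormedModule_isRealHilbert (R : realType) V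
    of CompleteNormedModule R V := {
  rdot : V -> V -> R ;
  rdotC : forall x y, rdot x y = rdot y x ;
  rdotDl : forall x y z, rdot (x + y) z = rdot x z + rdot y z ;
  rdotZl : forall a x z, rdot (a *: x) z = a * rdot x z ;
  rdotxx : forall x, rdot x x = `|x| ^+ 2
}.

#[short(type="realHilbertType")]
HB.structure Definition RealHilbert (R : realType) :=
  {V of CompleteNormedModule R V & CompleteNormedModule_isRealHilbert R V}.

Section RealHilbertTheory.
Context (R : realType) (V : realHilbertType R).
Implicit Types x y z : V.

Lemma rdotDr x y z : rdot x (y + z) = rdot x y + rdot x z.
Proof. by rewrite rdotC rdotDl !(rdotC x). Qed.

Lemma rdotZr a x y : rdot x (a *: y) = a * rdot x y.
Proof. by rewrite rdotC rdotZl (rdotC x). Qed.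

Lemma rdotNl x y : rdot (- x) y = - rdot x y.
Proof. by rewrite -scaleN1r rdotZl mulN1r. Qed.

Lemma rdotNr x y : rdot x (- y) = - rdot x y.
Proof. by rewrite rdotC rdotNl rdotC. Qed.

Lemma rdot0l x : rdot 0 x = 0.
Proof. by rewrite -(scale0r x) rdotZl mul0r. Qed.

Lemma rdot0r x : rdot x 0 = 0.
Proof. by rewrite rdotC rdot0l. Qed.

Definition rdotE :=
  (@rdotDl R V, rdotDr, rdotNl, rdotNr, @rdotZl R V, rdotZr).

Lemma normD2 x y : `|x + y| ^+ 2 = `|x| ^+ 2 + 2 * rdot x y + `|y| ^+ 2.
Proof. by rewrite -!rdotxx !rdotE (rdotC y x); ring. Qed.

Lemma normB2 x y : `|x - y| ^+ 2 = `|x| ^+ 2 - 2 * rdot x y + `|y| ^+ 2.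
Proof. by rewrite normD2 rdotNr normrN; ring. Qed.

Lemma rdot_le x y : rdot x y <= `|x| * `|y|.
Proof.
have [->|x0] := eqVneq x 0; first by rewrite rdot0l normr0 mul0r.
have [->|y0] := eqVneq y 0; first by rewrite rdot0r normr0 mulr0.
rewrite -normr_gt0 in x0; rewrite -normr_gt0 in y0.
have := sqr_ge0 (normr (normr y *: x - normr x *: y)).
rewrite normB2 rdotZl rdotZr !normrZ !normr_id => H.
have xy0 : 0 < `|x| * `|y| by rewrite mulr_gt0.
by rewrite -(ler_pM2l xy0); nra.
Qed.

Lemma rdot_ge x y : - (`|x| * `|y|) <= rdot x y.
Proof. by rewrite lerNl -rdotNl (le_trans (rdot_le _ _))// normrN. Qed.

Lemma rdot_norm_le x y : `|rdot x y| <= `|x| * `|y|.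
Proof. by rewrite ler_norml rdot_ge rdot_le. Qed.

Lemma rdot_cvg (T : Type) (F : set_system T) (FF : Filter F) (f : T -> V) x y :
  f t @[t --> F] --> x -> rdot (f t) y @[t --> F] --> rdot x y.
Proof.
move=> fx; apply/cvgrPdist_lt => e e0.
have e1 : 0 < e / (`|y| + 1) by rewrite divr_gt0 ?ltr_wpDl.
move/cvgrPdist_lt: fx => /(_ _ e1); apply: filterS => t.
rewrite ltr_pdivlMr ?ltr_wpDl// => ft.
have -> : rdot x y - rdot (f t) y = rdot (x - f t) y by rewrite !rdotE.
rewrite ltr_norml (lt_le_trans _ (rdot_ge _ _)) ?(le_lt_trans (rdot_le _ _))//.
  by apply: le_lt_trans ft; rewrite ler_wpM2l// lerDl.
by rewrite ltrNl opprK; apply: le_lt_trans ft; rewrite ler_wpM2l// lerDl.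
Qed.

Lemma rdot_continuous y : continuous (fun x : V => rdot x y).
Proof. by move=> x; apply: rdot_cvg; exact: cvg_id. Qed.

Lemma rdot_inj x y : (forall z, rdot x z = rdot y z) -> x = y.
Proof.
move=> xy; apply/eqP; rewrite -subr_eq0 -normr_eq0 -sqrf_eq0 -rdotxx.
by rewrite rdotDl rdotNl xy subrr.
Qed.

End RealHilbertTheory.

(** Pairing with an arbitrary vector turns an identity between linear
    combinations of vectors into a scalar one. *)
Ltac vector_field := apply: rdot_inj => ?; rewrite !rdotE; field.

(** * A complex Hilbert space as a real one *)

Lemma real_complexD (R : rcfType) (a b : R) : (a + b)%:C = a%:C + b%:C.
Proof. exact: rmorphD. Qed.

Lemma real_complexM (R : rcfType) (a b : R) : (a * b)%:C = a%:C * b%:C.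
Proof. exact: rmorphM. Qed.

Section Realify.
Context (R : realType) (X : hilbertType R).

(** An alias, since X itself is already a normed module over the complex
    numbers. *)
Definition realify : Type := X.

HB.instance Definition _ := GRing.Zmodule.on realify.

Let rscale (a : R) (x : realify) : realify := a%:C *: (x : X).

Fact rscaleA a b x : rscale a (rscale b x) = rscale (a * b) x.
Proof. by rewrite /rscale scalerA rmorphM. Qed.
Fact rscale1 : left_id 1 rscale.
Proof. by move=> x; exact: (scale1r (x : X)). Qed.
Fact rscaleDr : right_distributive rscale +%R.
Proof. by move=> a x y; exact: scalerDr. Qed.
Fact rscaleDl x : {morph rscale^~ x : a b / a + b}.
Proof. by move=> a b; rewrite /rscale rmorphD; exact: (scalerDl (x : X)). Qed.

HB.instance Definition _ := GRing.Zmodule_isLmodule.Build R realify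
  rscaleA rscale1 rscaleDr rscaleDl.

Lemma hnormC (x : X) : (hnorm x)%:C = `|x|.
Proof. by rewrite /hnorm RRe_real// normr_real. Qed.

Fact hnormD (x y : realify) : hnorm (x + y : X) <= hnorm (x : X) + hnorm (y : X).
Proof. by rewrite -lecR real_complexD !hnormC; exact: (@ler_normD _ X). Qed.
Fact hnormZ a (x : realify) : hnorm (a *: x : X) = `|a| * hnorm (x : X).
Proof.
apply: complexI; rewrite real_complexM !hnormC [a *: x]/(a%:C *: (x : X)) normrZ.
by congr (_ * _); rewrite normc_def /= expr0n addr0 sqrtr_sqr.
Qed.
Fact hnorm_eq0 (x : realify) : hnorm (x : X) = 0 -> x = 0.
Proof. by move=> h; apply: (@normr0_eq0 _ X); rewrite -hnormC h. Qed.

HB.instance Definition _ := @Lmodule_isNormed.Build R realify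
  (fun x => hnorm (x : X)) hnormD hnormZ hnorm_eq0.

Lemma realify_normE (x : realify) : `|x| = hnorm (x : X). Proof. by []. Qed.

Lemma cvg_realify (T : Type) (F : set_system T) (FF : Filter F) (f : T -> X)
   (x : X) :
  f t @[t --> F] --> x <-> (f t : realify) @[t --> F] --> (x : realify).
Proof.
split=> /cvgrPdist_lt h; apply/cvgrPdist_lt => e e0.
  have eC : 0 < e%:C :> R[i] by rewrite ltcR.
  by apply: filterS (h _ eC) => t; rewrite -hnormC ltcR.
have eR : e = (complex.Re e)%:C by rewrite RRe_real// gtr0_real.
have e1 : 0 < complex.Re e by rewrite -ltcR -eR.
by apply: filterS (h _ e1) => t; rewrite -hnormC eR ltcR.
Qed.

Fact realify_complete (F : set_system realify) :
  ProperFilter F -> cauchy F -> cvg F.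
Proof.
move=> FF /cauchyP Fc.
have : cvg (F : set_system X).
  apply: cauchy_cvg; apply/cauchyP => e e0.
  have eR : e = (complex.Re e)%:C by rewrite RRe_real// gtr0_real.
  have e1 : 0 < complex.Re e by rewrite -ltcR -eR.
  have [x Fx] := Fc _ e1; exists x.
  apply: filterS Fx => y /=; rewrite -!ball_normE/=.
  by rewrite eR -hnormC ltcR.
move=> /cvg_ex[x Fx]; apply/cvg_ex; exists x.
by have /cvg_realify := Fx.
Qed.

HB.instance Definition _ := Uniform_isComplete.Build realify realify_complete.

Let rinner (x y : realify) : R := complex.Re (inner (x : X) y).

Fact rinnerC x y : rinner x y = rinner y x.
Proof.
rewrite /rinner /inner hermC /= expr0 mul1r.
by case: (hdot _ _).
Qed.
Fact rinnerD x y z : rinner (x + y) z = rinner x z + rinner y z.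
Proof. by rewrite /rinner /inner linearDl /= raddfD. Qed.
Fact rinnerZ a x z : rinner (a *: x) z = a * rinner x z.
Proof.
rewrite /rinner /inner [a *: x]/(a%:C *: (x : X)) linearZl_LR /=.
by case: (hdot _ _) => u v /=; rewrite mul0r subr0.
Qed.
Fact rinnerxx x : rinner x x = `|x| ^+ 2.
Proof.
by rewrite /rinner /inner -hdotE realify_normE -hnormC -rmorphXn.
Qed.

HB.instance Definition _ := CompleteNormedModule_isRealHilbert.Build R realify
  rinnerC rinnerD rinnerZ rinnerxx.

Lemma realify_rdotE (x y : realify) :
  rdot x y = complex.Re (inner (x : X) y).
Proof. by []. Qed.

End Realify.

(** * Two principles of real analysis *)

(** The supremum of the times up to which F stays below F a is itself such a
    time by left continuity, and the condition on the right pushes it beyond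
    any point before b. *)
Lemma right_nonincreasing (R : realType) (F : R -> R) (a b : R) :
  a <= b ->
  (forall t, a < t <= b -> F s @[s --> t^'-] --> F t) ->
  (forall t, a <= t < b -> \forall h \near 0^'+, F (t + h) <= F t) ->
  F b <= F a.
Proof.
move=> ab Fl Fr.
pose E := [set t | a <= t <= b /\ forall s, a <= s <= t -> F s <= F a].
have Ea : E a.
  split=> [|s]; first by rewrite lexx.
  by move=> sa; rewrite (le_anti sa).
have supE : has_sup E by split; [exists a|exists b => t [/andP[]]].
set c := sup E.
have ac : a <= c by exact: ub_le_sup supE.2 _ Ea.
have cb : c <= b by apply: ge_sup; [exists a|move=> t [/andP[]]].
have lt_c s : a <= s < c -> F s <= F a.
  move=> /andP[as_ sc]; have sc0 : 0 < c - s by rewrite subr_gt0.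
  have [t [_ Et]] := sup_adherent sc0 supE; rewrite subKr => st.
  by apply: Et; rewrite as_ ltW.
have le_c : F c <= F a.
  have [->//|ca] := eqVneq c a.
  have {}ac : a < c by rewrite lt_def ca.
  rewrite leNgt; apply/negP => ac'.
  have acb : a < c <= b by rewrite ac.
  have H := cvgr_gt _ (Fl _ acb) _ ac'.
  near (c^'-) => s.
  suff : F s <= F a by rewrite leNgt => /negP; apply; near: s; exact: H.
  apply: lt_c; apply/andP; split; near: s; last exact: nbhs_left_lt.
  exact: nbhs_left_ge.
have [<-//|bc] := eqVneq c b.
have {bc}cb' : c < b by rewrite lt_def eq_sym bc.
have acb : a <= c < b by rewrite ac.
have [e e0 He] := Fr _ acb.
have ec : 0 < Num.min (e / 2) (b - c).
  by rewrite lt_min divr_gt0//= subr_gt0.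
set d := Num.min _ _ in ec.
have db : d <= b - c by rewrite ge_min lexx orbT.
have de : d < e by rewrite gt_min ltr_pdivrMr// ltr_pMr// ltr1n.
suff : E (c + d).
  by move/(ub_le_sup supE.2); rewrite -/c gerDl leNgt ec.
split; first by apply/andP; split; lra.
move=> s /andP[as_ sd]; have [sc|cs] := ltP s c; first by apply: lt_c; lra.
have [->//|sc] := eqVneq s c.
apply: le_trans le_c; rewrite -(subrK c s) addrC; apply: He => /=.
  by rewrite sub0r normrN ger0_norm ?subr_ge0//; lra.
by rewrite subr_gt0 lt_def sc.
Unshelve. all: by end_near. Qed.

Lemma cauchy_seq_cvg (R : realType) (V : completeNormedModType R)
    (u : nat -> V) :
  (forall e, 0 < e -> exists N, forall i j, (N <= i)%N -> (N <= j)%N ->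
     `|u i - u j| < e) ->
  cvgn u.
Proof.
move=> uc; apply/cauchy_cvgP/cauchy_exP => e e0.
have [N HN] := uc _ e0; exists (u N); exists N => // i Ni.
by rewrite -ball_normE; exact: HN.
Qed.

Section FixedPoint.
Context (R : realType) (V : completeNormedModType R).

Lemma contraction_on_closed (D : set V) (f : V -> V) (q : R) :
  closed D -> D !=set0 -> 0 <= q < 1 -> (forall x, D x -> D (f x)) ->
  (forall x y, D x -> D y -> `|f x - f y| <= q * `|x - y|) ->
  exists2 p, D p & f p = p.
Proof.
move=> Dc D0 /andP[q0 q1] fD fq.
pose F : {fun D >-> D} := HB.pack f (isFun.Build _ _ D D f fD).
have Fq : is_contraction F.
  exists (NngNum q0); split => //=.
  by move=> [x y] [/= Dx Dy]; exact: fq.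
by have [p Dp pf] := banach_fixed_point Fq Dc D0; exists p.
Qed.

Lemma contraction_fixpoint (f : V -> V) (q : R) : 0 <= q < 1 ->
  (forall x y, `|f x - f y| <= q * `|x - y|) -> exists p, f p = p.
Proof.
move=> q01 fq.
have [|p _ fp] := @contraction_on_closed setT f q closedT _ q01 (fun _ _ => I)
  (fun x y _ _ => fq x y); last by exists p.
by exists 0.
Qed.

End FixedPoint.

(** * Strongly monotone maps are onto *)

Section StronglyMonotone.
Context (R : realType) (V : realHilbertType R).

Definition strongly_monotone (m : R) (F : V -> V) :=
  forall x y, m * `|x - y| ^+ 2 <= rdot (F x - F y) (x - y).

Lemma strongly_monotone_expands m F x y : strongly_monotone m F ->
  m * `|x - y| <= `|F x - F y|.
Proof.
move=> Fm; have [->|xy] := eqVneq x y; first by rewrite !subrr !normr0 mulr0.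
have xy0 : 0 < `|x - y| by rewrite normr_gt0 subr_eq0.
rewrite -(ler_pM2r xy0) -mulrA -expr2.
by rewrite (le_trans (Fm x y))// rdot_le.
Qed.

(** The map w - tau (F w - g) with tau = m / L^2 shrinks distances by the
    factor sqrt (1 - (m / L)^2), and it maps the ball of radius r about x0
    into itself when F x0 is close enough to g. *)
Lemma strongly_monotone_ball_onto m L r F x0 g :
  0 < m -> m < L -> 0 < r ->
  strongly_monotone m F ->
  (forall x y, `|x - x0| <= r -> `|y - x0| <= r ->
     `|F x - F y| <= L * `|x - y|) ->
  `|F x0 - g| <= m * r / 2 ->
  exists x, F x = g.
Proof.
move=> m0 mL r0 Fm FL gr.
have L0 : 0 < L := lt_trans m0 mL.
pose k := (m / L) ^+ 2.
have k0 : 0 < k by rewrite exprn_gt0// divr_gt0.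
have k1 : k < 1.
  by rewrite exprn_ilt1 ?divr_ge0 ?(ltW m0) ?(ltW L0)// ltr_pdivrMr// mul1r.
(* The factor sqrt (1 - k) is at most 1 - k / 2. *)
pose q := 1 - k / 2; pose tau := m / L ^+ 2.
have tau0 : 0 < tau by rewrite divr_gt0 ?exprn_gt0.
have taum : tau * m = k by rewrite /tau /k; field; rewrite gt_eqF.
have tauL : tau ^+ 2 * L ^+ 2 = k by rewrite /tau /k; field; rewrite gt_eqF.
pose T w := w - tau *: (F w - g).
have q01 : 0 <= q < 1 by rewrite /q; apply/andP; split; lra.
have Tq x y : `|x - x0| <= r -> `|y - x0| <= r -> `|T x - T y| <= q * `|x - y|.
  move=> xr yr; have q0 : 0 <= q by case/andP: q01.
  rewrite -(@ler_pXn2r _ 2)// ?nnegrE ?mulr_ge0//.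
  have -> : T x - T y = (x - y) - tau *: (F x - F y).
    by rewrite /T opprD addrACA -opprD -scalerBr opprB addrA subrK.
  rewrite normB2 rdotZr normrZ gtr0_norm// (rdotC (x - y)).
  rewrite [X in _ + X <= _]exprMn [X in _ <= X]exprMn.
  have H1 := Fm x y; have H2 := FL _ _ xr yr.
  have H3 : `|F x - F y| ^+ 2 <= L ^+ 2 * `|x - y| ^+ 2.
    by rewrite -exprMn ler_pXn2r// nnegrE// mulr_ge0// ltW.
  have H4 : tau ^+ 2 * `|F x - F y| ^+ 2 <= k * `|x - y| ^+ 2.
    by rewrite -tauL -mulrA ler_wpM2l// exprn_ge0// ltW.
  have H5 : k * `|x - y| ^+ 2 <= tau * rdot (F x - F y) (x - y).
    by rewrite -taum -mulrA ler_wpM2l// ltW.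
  have H6 : 0 <= `|x - y| ^+ 2 by [].
  have H7 : 0 <= k ^+ 2 * `|x - y| ^+ 2 by rewrite mulr_ge0// exprn_ge0// ltW.
  by rewrite /q; nra.
have x0r : `|x0 - x0| <= r by rewrite subrr normr0 ltW.
have [x _ Tx] : exists2 p, `|p - x0| <= r & T p = p.
  apply: (@contraction_on_closed _ _ [set x | `|x - x0| <= r] T q) => //.
  - have -> : [set x | `|x - x0| <= r] = closed_ball_ normr x0 r.
      by apply/seteqP; split => x /=; rewrite distrC.
    exact: closed_closed_ball_.
  - by exists x0.
  - move=> x xr; rewrite /= -(subrK (T x0) (T x)) -addrA.
    rewrite (le_trans (ler_normD _ _))//.
    have H1 : `|T x0 - x0| <= k / 2 * r.
      rewrite /T addrAC subrr add0r normrN normrZ gtr0_norm//.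
      have -> : k / 2 * r = tau * (m * r / 2) by rewrite -taum; ring.
      by rewrite ler_pM2l.
    have H2 : q * `|x - x0| <= q * r by apply: ler_wpM2l => //; case/andP: q01.
    by have H3 := Tq _ _ xr x0r; rewrite /q in H2 H3; lra.
exists x; move/eqP: Tx; rewrite /T -subr_eq0 addrAC subrr add0r oppr_eq0.
by rewrite scaler_eq0 gt_eqF//= subr_eq0 => /eqP.
Qed.

Definition locally_lip (F : V -> V) := forall x0, exists r L,
  0 < r /\ forall x y, `|x - x0| <= r -> `|y - x0| <= r ->
     `|F x - F y| <= L * `|x - y|.

(** The range is open by the local statement, and closed because F expands
    distances; hence it contains the segment from F 0 to any g, which is
    connected. *)
Lemma strongly_monotone_onto m F : 0 < m ->
  strongly_monotone m F -> locally_lip F -> forall g, exists x, F x = g.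
Proof.
move=> m0 Fm Fl g.
have Fl' x0 : exists r L, [/\ 0 < r, m < L & forall x y, `|x - x0| <= r ->
     `|y - x0| <= r -> `|F x - F y| <= L * `|x - y|].
  have [r [L [r0 FL]]] := Fl x0; exists r, (Num.max L (m + 1)); split => //.
    by rewrite lt_max ltrDl ltr01 orbT.
  move=> x y xr yr; rewrite (le_trans (FL _ _ xr yr))// ler_wpM2r//.
  by rewrite le_max lexx.
have Rop : open (range F).
  rewrite openE => _ [x0 _ <-]; have [r [L [r0 mL FL]]] := Fl' x0.
  apply/nbhs_normP; exists (m * r / 2); first by rewrite /= divr_gt0// mulr_gt0.
  move=> y /ltW yr; have [x <-] := strongly_monotone_ball_onto m0 mL r0 Fm FL yr.
  by exists x.
have Rcl : closed (range F).
  move=> y yF.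
  have yF' n : exists x, `|F x - y| < n.+1%:R^-1.
    have n0 : 0 < n.+1%:R^-1 :> R by rewrite invr_gt0.
    have [_ [[x _ <-]]] := yF _ (nbhsx_ballx y _ n0).
    by rewrite -ball_normE /= distrC; exists x.
  have [u Fu] := choice yF'.
  have uc : cvgn u.
    apply: cauchy_seq_cvg => e e0.
    have me : 0 < m * e / 2 by rewrite divr_gt0// mulr_gt0.
    have [N _ HN] := near_infty_natSinv_lt (PosNum me).
    exists N => i j Ni Nj.
    rewrite -(ltr_pM2l m0) (le_lt_trans (strongly_monotone_expands _ _ Fm))//.
    have -> : F (u i) - F (u j) = (F (u i) - y) + (y - F (u j)).
      by rewrite addrA subrK.
    rewrite (le_lt_trans (ler_normD _ _))//.
    have Hi := lt_trans (Fu i) (HN _ Ni); have Hj := lt_trans (Fu j) (HN _ Nj).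
    by rewrite distrC in Hj; rewrite /= in Hi Hj; lra.
  have [r [L [r0 mL FL]]] := Fl' (limn u).
  exists (limn u) => //; apply/eqP; rewrite -subr_eq0 -normr_le0.
  apply/ler_addgt0Pr => e e0; rewrite add0r.
  have L0 : 0 < L := lt_trans m0 mL.
  have eL : 0 < Num.min r (e / (2 * L)).
    by rewrite lt_min r0/= divr_gt0// mulr_gt0.
  have e2 : 0 < e / 2 by rewrite divr_gt0.
  near \oo => n.
  have H1 : `|limn u - u n| < Num.min r (e / (2 * L)).
    by near: n; move/cvgrPdist_lt : uc; apply.
  have H2 : `|F (u n) - y| < e / 2.
    apply: lt_trans (Fu n) _; near: n.
    exact: (near_infty_natSinv_lt (PosNum e2)).
  rewrite lt_min ltr_pdivlMr ?mulr_gt0// in H1; case/andP: H1 => H1 H3.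
  have lr : `|limn u - limn u| <= r by rewrite subrr normr0 ltW.
  have ur : `|u n - limn u| <= r by rewrite distrC ltW.
  have H4 := FL _ _ lr ur.
  rewrite -(subrK (F (u n)) (F (limn u))) -addrA (le_trans (ler_normD _ _))//.
  have H5 : L * `|limn u - u n| < e / 2 by nra.
  by lra.
pose p (s : R) := F 0 + s *: (g - F 0).
have pc : continuous p.
  move=> s; apply: cvgD; first exact: cvg_cst.
  by apply: cvgZr_tmp => //; exact: cvg_id.
have E0 : (0 : R) \in `[0, 1] by rewrite in_itv/= lexx ler01.
have E1 : (1 : R) \in `[0, 1] by rewrite in_itv/= lexx ler01.
have H : `[(0 : R), 1] `&` p @^-1` range F = `[0, 1]%classic.
  apply: segment_connected.
  - by exists 0; split => //; exists 0 => //; rewrite /p scale0r addr0.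
  - by exists (p @^-1` range F) => //; apply: open_comp => // x _; exact: pc.
  - by exists (p @^-1` range F) => //; exact: preimage_closed.
have : `[0%R, 1%R]%classic (1 : R) by [].
by rewrite -H => -[_ [x _ Fx]]; exists x; rewrite Fx /p scale1r addrC subrK.
Unshelve. all: by end_near. Qed.

End StronglyMonotone.

(** * Maximal dissipative operators *)

Lemma norm_cvg_le (R : realType) (V : normedModType R) (T : Type)
    (F : set_system T) (FF : ProperFilter F) (f : T -> V) (l : V) (C : R) :
  f t @[t --> F] --> l -> (\forall t \near F, `|f t| <= C) -> `|l| <= C.
Proof. by move=> fl fC; apply: cvgr_to_le fC; exact: cvg_norm. Qed.

Section Dissipative.
Context (R : realType) (V : realHilbertType R) (A : partial_op V V).
Implicit Types (x y z f : V) (h : R).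

Definition dissipative :=
  forall x y, dom A x -> dom A y -> rdot (A x - A y) (x - y) <= 0.

Definition implicit_step_solvable h :=
  forall f, exists x, dom A x /\ x - h *: A x = f.

(** The resolvent (1 - h A)^-1, which performs one step of the implicit
    Euler scheme. *)
Definition implicit_step h f : V := get [set x | dom A x /\ x - h *: A x = f].

Hypothesis Adiss : dissipative.

Lemma implicit_step_expands h x y : 0 <= h -> dom A x -> dom A y ->
  `|x - y| <= `|(x - h *: A x) - (y - h *: A y)|.
Proof.
move=> h0 dx dy; have [->|xy] := eqVneq x y; first by rewrite !subrr.
have xy0 : 0 < `|x - y| by rewrite normr_gt0 subr_eq0.
rewrite -(ler_pM2r xy0) -expr2 (le_trans _ (rdot_le _ _))//.
rewrite opprD addrACA -opprD -scalerBr rdotDl rdotNl rdotZl rdotxx lerDl.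
by rewrite oppr_ge0 mulr_ge0_le0// Adiss.
Qed.

Section Step.
Variable h : R.
Hypotheses (h0 : 0 < h) (Ah : implicit_step_solvable h).

Lemma implicit_stepP f :
  dom A (implicit_step h f) /\
  implicit_step h f - h *: A (implicit_step h f) = f.
Proof. exact: (getPex (Ah f)). Qed.

Lemma implicit_step_dom f : dom A (implicit_step h f).
Proof. by have [] := implicit_stepP f. Qed.

Lemma implicit_step_eq f :
  implicit_step h f = f + h *: A (implicit_step h f).
Proof. by have [_ {2}<-] := implicit_stepP f; rewrite subrK. Qed.

Lemma implicit_step_nonexpansive f g :
  `|implicit_step h f - implicit_step h g| <= `|f - g|.
Proof.
have [df ef] := implicit_stepP f; have [dg eg] := implicit_stepP g.
by rewrite -[in leRHS]ef -[in leRHS]eg; apply: implicit_step_expands => //; exact: ltW.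
Qed.

Lemma implicit_step_unique x : dom A x -> implicit_step h (x - h *: A x) = x.
Proof.
move=> dx; have [df ef] := implicit_stepP (x - h *: A x).
apply/eqP; rewrite -subr_eq0 -normr_le0.
by rewrite (le_trans (implicit_step_expands (ltW h0) df dx))// ef subrr normr0.
Qed.

Lemma implicit_step_cont : continuous (implicit_step h).
Proof.
move=> x; apply/cvgrPdist_lt => e e0; apply/nbhs_normP; exists e => //= y.
by apply: le_lt_trans; exact: implicit_step_nonexpansive.
Qed.

Lemma op_implicit_step f :
  A (implicit_step h f) = h^-1 *: (implicit_step h f - f).
Proof.
by rewrite {2}implicit_step_eq addrC addKr scalerA mulVf ?gt_eqF// scale1r.
Qed.

Lemma op_implicit_step_lip f g :
  `|A (implicit_step h f) - A (implicit_step h g)| <= 2 / h * `|f - g|.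
Proof.
rewrite !op_implicit_step -scalerBr normrZ gtr0_norm ?invr_gt0//.
rewrite [2 / h]mulrC -mulrA ler_pM2l ?invr_gt0// opprD addrACA -opprD.
rewrite (le_trans (ler_normB _ _))// mulr_natl mulr2n lerD2r.
exact: implicit_step_nonexpansive.
Qed.

(** Dissipativity between x and z = J x, whose difference is h A z, says
    that A x - A z makes an acute angle with A z. *)
Lemma implicit_step_pythagoras x : dom A x ->
  `|A (implicit_step h x) - A x| ^+ 2 <=
    `|A x| ^+ 2 - `|A (implicit_step h x)| ^+ 2.
Proof.
move=> dx; have dz := implicit_step_dom x; set z := implicit_step h x in dz *.
have : rdot (A z - A x) (z - x) <= 0 := Adiss dz dx.
have -> : z - x = h *: A z by rewrite {1}/z implicit_step_eq addrC addKr.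
rewrite rdotZr pmulr_rle0// rdotDl rdotNl rdotxx subr_le0 => H.
by rewrite normB2 (rdotC (A z)); lra.
Qed.

Lemma implicit_step_op_le x : dom A x -> `|A (implicit_step h x)| <= `|A x|.
Proof.
move=> dx; rewrite -(@ler_pXn2r _ 2)// ?nnegrE// -subr_ge0.
by rewrite (le_trans _ (implicit_step_pythagoras dx)).
Qed.

Lemma implicit_step_dist x : dom A x -> `|implicit_step h x - x| <= h * `|A x|.
Proof.
move=> dx; rewrite {1}implicit_step_eq addrC addKr normrZ gtr0_norm//.
by rewrite ler_pM2l// implicit_step_op_le.
Qed.

End Step.

(** The equation x - k A x = f is the fixed point equation x = J ((h / k) f
    + (1 - h / k) x) for J = (1 - h A)^-1, and J does not expand distances
    while |1 - h / k| < 1. *)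
Lemma implicit_step_solvable_near h k :
  0 < h -> h / 2 < k -> implicit_step_solvable h -> implicit_step_solvable k.
Proof.
move=> h0 hk Ah f.
have k0 : 0 < k by lra.
pose T x := implicit_step h ((h / k) *: f + (1 - h / k) *: x).
have hk2 : h / k < 2 by rewrite ltr_pdivrMr//; lra.
have hk0 : 0 < h / k by rewrite divr_gt0.
have q01 : 0 <= `|1 - h / k| < 1.
  by rewrite normr_ge0 ltr_norml; apply/andP; split; lra.
have [|x Tx] := contraction_fixpoint (f := T) q01.
  move=> x y; rewrite (le_trans (implicit_step_nonexpansive h0 Ah _ _))//.
  by rewrite opprD addrACA subrr add0r -scalerBr normrZ.
have [dx ex] := implicit_stepP Ah ((h / k) *: f + (1 - h / k) *: x).
rewrite -/(T x) Tx in dx ex; exists x; split => //.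
have hN0 : h / k != 0 by rewrite gt_eqF.
apply: (scalerI hN0); rewrite scalerBr scalerA divfK ?gt_eqF//.
rewrite scalerBl scale1r in ex.
have -> : (h / k) *: x - h *: A x = (x - h *: A x) - (x - (h / k) *: x).
  by rewrite opprB [RHS]addrC addrA subrK.
by rewrite ex addrK.
Qed.

(** The previous lemma lowers the step size by a factor 2 / 3 as often as
    needed, and raises it in one go. *)
Lemma implicit_step_solvable_all h k :
  0 < h -> 0 < k -> implicit_step_solvable h -> implicit_step_solvable k.
Proof.
move=> h0 k0 Ah.
have An n : implicit_step_solvable (h * (2 / 3) ^+ n).
  elim: n => [|n IHn]; first by rewrite expr0 mulr1.
  have p0 : 0 < h * (2 / 3) ^+ n by rewrite mulr_gt0// exprn_gt0.
  by apply: implicit_step_solvable_near IHn => //; rewrite exprSr mulrA; lra.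
have : geometric h (2 / 3) n @[n --> \oo] --> (0 : R).
  by apply: cvg_geometric; rewrite ger0_norm//; lra.
move=> /cvgr_lt /(_ _ k0) [N _ /(_ N (leqnn _)) /= hN].
apply: implicit_step_solvable_near (An N); first by rewrite mulr_gt0// exprn_gt0.
by apply: le_lt_trans hN; rewrite ler_piMr ?mulr_ge0 ?exprn_ge0 ?(ltW h0)//; lra.
Qed.

End Dissipative.

Section MDissipative.
Context (R : realType) (V : realHilbertType R) (A : partial_op V V).
Implicit Types (x y z f : V) (h : R).
Hypothesis Adiss : dissipative A.
Hypothesis Astep : forall h, 0 < h -> implicit_step_solvable A h.

Local Notation J := (implicit_step A).

(** Dissipativity between J mu x and J lam x, whose difference is mu a - lam
    b for the Yosida approximations a and b of A at x, says that a - b makes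
    an acute angle with b. *)
Lemma yosida_mono x mu lam : 0 < mu -> mu <= lam ->
  `|A (J mu x) - A (J lam x)| ^+ 2 <= `|A (J mu x)| ^+ 2 - `|A (J lam x)| ^+ 2.
Proof.
move=> m0 ml; have l0 : 0 < lam := lt_le_trans m0 ml.
have em := implicit_step_eq (Astep m0) x.
have el := implicit_step_eq (Astep l0) x.
have := Adiss (implicit_step_dom (Astep m0) x) (implicit_step_dom (Astep l0) x).
have [->|ml'] := eqVneq mu lam; first by rewrite !subrr normr0 expr0n.
have {ml ml'} ml : 0 < lam - mu by rewrite subr_gt0 lt_def eq_sym ml'.
rewrite {2}em {2}el opprD addrACA subrr add0r.
set a := A (J mu x); set b := A (J lam x).
have -> : mu *: a - lam *: b = mu *: (a - b) - (lam - mu) *: b.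
  by rewrite scalerBr scalerBl opprB addrA subrK.
rewrite rdotDr rdotNr !rdotZr rdotxx => H.
have H1 : 0 <= mu * `|a - b| ^+ 2 by rewrite mulr_ge0// ltW.
have H2 : 0 <= rdot (a - b) b by rewrite -(pmulr_rge0 _ ml); lra.
by have := normD2 (a - b) b; rewrite subrK; lra.
Qed.

(** The Yosida approximations at a point grow as the step shrinks; when they
    stay bounded, the monotone inequality above makes them Cauchy, and the
    limit is the value of A since A is determined by the continuous map J 1. *)
Lemma dom_of_bounded_yosida x (C : R) :
  (forall h, 0 < h -> `|A (J h x)| <= C) ->
  dom A x /\ A (J n.+1%:R^-1 x) @[n --> \oo] --> A x.
Proof.
move=> bC; pose h n : R := n.+1%:R^-1.
have h0 n : 0 < h n by rewrite invr_gt0.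
pose a n := A (J (h n) x); pose s n := `|a n| ^+ 2.
have aC n : `|a n| <= C by exact: bC.
have C0 : 0 <= C := le_trans (normr_ge0 _) (aC 0%N).
have amono i j : (i <= j)%N -> `|a j - a i| ^+ 2 <= s j - s i.
  by move=> ij; apply: yosida_mono => //; rewrite lef_pV2 ?posrE// ler_nat.
have smono : nondecreasing_seq s.
  by move=> i j /amono H; rewrite -subr_ge0 (le_trans _ H).
have sC : cvgn s.
  apply: nondecreasing_is_cvgn => //; exists (C ^+ 2) => _ [n _ <-].
  by rewrite /s ler_pXn2r ?nnegrE.
have acv : cvgn a.
  apply: cauchy_seq_cvg => e e0.
  have e2 : 0 < e ^+ 2 by rewrite exprn_gt0.
  have e4 : limn s - (e / 2) ^+ 2 < limn s by rewrite gtrBl exprn_gt0// divr_gt0.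
  have [N _ HN] := cvgr_gt _ sC _ e4.
  have aN i : (N <= i)%N -> `|a i - a N| < e / 2.
    move=> Ni; rewrite -(@ltr_pXn2r _ 2)// ?nnegrE// ?divr_ge0 ?(ltW e0)//.
    rewrite (le_lt_trans (amono _ _ Ni))//.
    have := nondecreasing_cvgn_le smono sC i.
    by have := HN N (leqnn _) => /= H1 H2; lra.
  exists N => i j /aN Ni /aN Nj.
  have -> : a i - a j = (a i - a N) - (a j - a N) by rewrite opprB addrA subrK.
  by rewrite (le_lt_trans (ler_normB _ _))//; lra.
pose b := limn a.
have ha : h n *: a n @[n --> \oo] --> (0 : V).
  rewrite -[X in _ --> X](scale0r b); apply: cvgZ => //.
  exact: cvg_harmonic.
have Jx : J (h n) x @[n --> \oo] --> x.
  rewrite -[X in _ --> X]addr0.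
  rewrite (_ : (fun n => J (h n) x) = (fun n => x + h n *: a n)); last first.
    by apply/funext => n; exact: implicit_step_eq (Astep (h0 n)) x.
  by apply: cvgD => //; exact: cvg_cst.
have J1 n : J 1 (J (h n) x - a n) = J (h n) x.
  rewrite -[X in _ - X]scale1r.
  by apply: implicit_step_unique => //;
    [exact: Astep | exact: implicit_step_dom (Astep _) _].
have J1cvg : J (h n) x @[n --> \oo] --> J 1 (x - b).
  under eq_cvg do rewrite -J1.
  apply: continuous_cvg; last exact: cvgB.
  exact: implicit_step_cont (Astep _) _.
have xE : x = J 1 (x - b) by exact: cvg_unique Jx J1cvg.
have [dx ex] := implicit_stepP (Astep ltr01) (x - b).
rewrite -xE scale1r in dx ex.
split=> //; suff -> : A x = b by [].
by apply: oppr_inj; apply: (addrI x).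
Qed.

(** A bound on A at points close to x passes to the Yosida approximations A
    (J h x), which are Lipschitz in x. *)
Lemma op_closed x (C : R) :
  (forall e, 0 < e -> exists z, [/\ dom A z, `|z - x| < e & `|A z| <= C]) ->
  dom A x /\ `|A x| <= C.
Proof.
move=> xC.
have bC h : 0 < h -> `|A (J h x)| <= C.
  move=> h0; apply/ler_addgt0Pr => e e0.
  have he : 0 < e * h / 2 by rewrite divr_gt0// mulr_gt0.
  have [z [dz zx Az]] := xC _ he.
  rewrite -(subrK (A (J h z)) (A (J h x))) addrC (le_trans (ler_normD _ _))//.
  apply: lerD; first by apply: le_trans Az; exact: implicit_step_op_le (Astep _) _ dz.
  rewrite (le_trans (op_implicit_step_lip _ h0 (Astep h0) _ _))//.
  rewrite mulrAC ler_pdivrMr// distrC; lra.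
have [dx Ax] := dom_of_bounded_yosida bC; split=> //.
by apply: norm_cvg_le Ax _; near=> n; exact: bC.
Unshelve. all: by end_near. Qed.

(** The Lipschitz map A o J h approximates A at x. It does so at nearby
    points z with |A z| <= |A x| too, because the Pythagorean inequality
    bounds the distance from A z to A (J h z) by the loss of norm, which is
    small. *)
Lemma op_cont x e : dom A x -> 0 < e -> exists2 d, 0 < d &
  forall z, dom A z -> `|z - x| < d -> `|A z| <= `|A x| -> `|A z - A x| < e.
Proof.
move=> dx e0.
have [|_ Ax] := @dom_of_bounded_yosida x `|A x|.
  by move=> h h0; exact: implicit_step_op_le (Astep _) _ dx.
pose eta := e / 4; have eta0 : 0 < eta by rewrite divr_gt0.
have Ax2 : `|A (J n.+1%:R^-1 x)| ^+ 2 @[n --> \oo] --> `|A x| ^+ 2.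
  by apply: cvgM; exact: cvg_norm.
have [n [n1 n2]] : exists n : nat, `|A x - A (J n.+1%:R^-1 x)| < eta /\
     `|A x| ^+ 2 - eta ^+ 2 < `|A (J n.+1%:R^-1 x)| ^+ 2.
  near \oo => n; exists n; split; near: n.
    by move/cvgrPdist_lt : Ax; apply.
  by apply: (cvgr_gt _ Ax2); rewrite gtrBl exprn_gt0.
set h := n.+1%:R^-1 in n1 n2.
have h0 : 0 < h by rewrite invr_gt0.
pose r := Num.min eta (eta ^+ 2 / (`|A x| + 1)).
have r0 : 0 < r by rewrite lt_min eta0 divr_gt0 ?exprn_gt0// ltr_wpDl.
have r1 : r <= eta by rewrite ge_min lexx.
have r2 : r * `|A x| <= eta ^+ 2.
  rewrite (@le_trans _ _ (r * (`|A x| + 1)))//; first by rewrite ler_pM2l// lerDl.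
  by rewrite -ler_pdivlMr ?ltr_wpDl// ge_min lexx orbT.
exists (r * h / 2); first by rewrite divr_gt0// mulr_gt0.
move=> z dz zx Azx.
have H1 : `|A (J h z) - A (J h x)| <= r.
  rewrite (le_trans (op_implicit_step_lip _ h0 (Astep h0) _ _))//.
  rewrite mulrAC ler_pdivrMr//; lra.
have H2 : `|A z - A (J h z)| < 2 * eta.
  have eta2 : 0 <= 2 * eta by lra.
  rewrite distrC -(@ltr_pXn2r _ 2)// ?nnegrE//.
  rewrite (le_lt_trans (implicit_step_pythagoras Adiss h0 (Astep h0) dz))//.
  have H3 := implicit_step_op_le Adiss h0 (Astep h0) dz.
  have H4 := implicit_step_op_le Adiss h0 (Astep h0) dx.
  have H5 : `|A (J h x)| - `|A (J h z)| <= r.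
    by rewrite (le_trans _ H1)// distrC lerB_dist.
  have H6 : `|A z| ^+ 2 <= `|A x| ^+ 2 by rewrite ler_pXn2r ?nnegrE.
  have H7 : `|A (J h x)| ^+ 2 - `|A (J h z)| ^+ 2 <= 2 * (r * `|A x|).
    rewrite subr_sqr; have : 0 <= `|A (J h x)| + `|A (J h z)| by rewrite addr_ge0.
    by move=> H8; nra.
  by rewrite exprMn; nra.
have -> : A z - A x = (A z - A (J h z)) + (A (J h z) - A (J h x)) +
    (A (J h x) - A x).
  by rewrite !subrKA.
rewrite (le_lt_trans (ler_normD _ _))// (distrC _ (A x)).
have := ler_normD (A z - A (J h z)) (A (J h z) - A (J h x)).
by rewrite /eta in n1 H2 r1; lra.
Unshelve. all: by end_near. Qed.

End MDissipative.

(** * The contraction semigroup of a densely defined m-dissipative operator *)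

Lemma geometric_cvg (R : realType) (V : completeNormedModType R)
    (u : nat -> V) (C q : R) : 0 <= q < 1 ->
  (forall n, `|u n - u n.+1| <= C * q ^+ n) -> cvgn u.
Proof.
move=> /andP[q0 q1] uC.
have C0 : 0 <= C by have := uC 0%N; rewrite expr0 mulr1; apply: le_trans.
have q1' : 0 < 1 - q by rewrite subr_gt0.
have uij i d : `|u i - u (i + d)%N| <= C / (1 - q) * (q ^+ i - q ^+ (i + d)).
  elim: d => [|d IHd]; first by rewrite addn0 !subrr normr0 mulr0.
  rewrite addnS -(subrKA (u (i + d)%N)) (le_trans (ler_normD _ _))//.
  rewrite (le_trans (lerD IHd (uC _)))// exprSr le_eqVlt; apply/orP; left.
  by apply/eqP; field; rewrite gt_eqF.
apply: cauchy_seq_cvg => e e0.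
have : geometric (C / (1 - q)) q n @[n --> \oo] --> (0 : R).
  by apply: cvg_geometric; rewrite ger0_norm.
have e2 : 0 < e / 2 by rewrite divr_gt0.
move=> /cvgr_lt /(_ _ e2) [N _ /(_ N (leqnn _)) /= hN].
have uN i : (N <= i)%N -> `|u N - u i| < e / 2.
  move=> Ni; rewrite -(subnKC Ni) (le_lt_trans (uij _ _))//.
  apply: le_lt_trans hN; rewrite ler_wpM2l ?divr_ge0 ?(ltW q1')//.
  by rewrite gerBl exprn_ge0.
exists N => i j /uN Ni /uN Nj.
have -> : u i - u j = (u N - u j) - (u N - u i) by rewrite opprB [RHS]addrC subrKA.
by rewrite (le_lt_trans (ler_normB _ _))//; lra.
Qed.

Section Semigroup.
Context (R : realType) (V : realHilbertType R) (A : partial_op V V).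
Implicit Types (x y z f : V) (h : R).
Hypothesis Adiss : dissipative A.
Hypothesis Astep : forall h, 0 < h -> implicit_step_solvable A h.
Hypothesis Adense : forall x e, 0 < e -> exists z, dom A z /\ `|z - x| < e.

Local Notation J := (implicit_step A).

Section Euler.
Variable h : R.
Hypothesis h0 : 0 < h.

Lemma euler_nonexpansive n x y : `|iter n (J h) x - iter n (J h) y| <= `|x - y|.
Proof.
elim: n => //= n IHn.
exact: le_trans (implicit_step_nonexpansive Adiss h0 (Astep h0) _ _) IHn.
Qed.

Lemma euler_dom n x : dom A x -> dom A (iter n (J h) x).
Proof. by case: n => //= n _; exact: implicit_step_dom (Astep h0) _. Qed.

Lemma euler_op_le n x : dom A x -> `|A (iter n (J h) x)| <= `|A x|.
Proof.
move=> dx; elim: n => //= n IHn; apply: le_trans IHn.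
by apply: (implicit_step_op_le Adiss h0 (Astep h0)); exact: euler_dom.
Qed.

Lemma euler_dist n m x : dom A x ->
  `|iter (n + m) (J h) x - iter m (J h) x| <= n%:R * h * `|A x|.
Proof.
move=> dx; elim: n => [|n IHn]; first by rewrite subrr normr0 !mul0r.
rewrite addSn -(subrKA (iter (n + m) (J h) x)) (le_trans (ler_normD _ _))//.
rewrite -(addn1 n) natrD !mulrDl mul1r [leRHS]addrC lerD//=.
rewrite (le_trans (implicit_step_dist Adiss h0 (Astep h0) (euler_dom _ dx)))//.
by rewrite ler_pM2l// euler_op_le.
Qed.

(** The increment over n steps is the sum of the values of A along them, hence
    close to n h A x as long as these values stay close to A x. *)
Lemma euler_increment n x (e : R) : dom A x ->
  (forall i, (0 < i <= n)%N -> `|A (iter i (J h) x) - A x| <= e) ->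
  `|iter n (J h) x - x - (n%:R * h) *: A x| <= n%:R * h * e.
Proof.
move=> dx; elim: n => [|n IHn] He.
  by rewrite /= subrr !mul0r scale0r subr0 normr0.
have {}IHn := IHn (fun i hi => He i (ltac:(lia))).
have HS := He n.+1 (ltac:(lia)); rewrite /= in HS.
set z := iter n (J h) x in IHn HS *.
have -> : iter n.+1 (J h) x - x - (n.+1%:R * h) *: A x =
   (z - x - (n%:R * h) *: A x) + h *: (A (J h z) - A x).
  by rewrite /= -/z {1}(implicit_step_eq (Astep h0)) -natr1; vector_field.
rewrite (le_trans (ler_normD _ _))// -natr1 !mulrDl mul1r lerD//.
by rewrite normrZ gtr0_norm// ler_pM2l.
Qed.

End Euler.

Definition mesh (k : nat) : R := 2^-1 ^+ k.

Lemma mesh_gt0 k : 0 < mesh k.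
Proof. by rewrite exprn_gt0// invr_gt0. Qed.

Lemma meshS k : mesh k.+1 = mesh k / 2.
Proof. by rewrite /mesh exprSr. Qed.

Lemma mesh_cvg0 : mesh k @[k --> \oo] --> (0 : R).
Proof. by apply: cvg_expr; rewrite ger0_norm//; lra. Qed.

(** If both half steps used the value of A at their common end,
    dissipativity would leave only the initial distance; using it costs the
    increment of A over the second half step. *)
Lemma step_halving h x z : 0 < h ->
  `|J h x - J (h / 2) (J (h / 2) z)| <=
  `|x - z| + h / 2 *
    `|A (J (h / 2) (J (h / 2) z)) - A (J (h / 2) z)|.
Proof.
move=> h0; have h2 : 0 < h / 2 by rewrite divr_gt0.
set z1 := J (h / 2) z; set z2 := J (h / 2) z1; set x1 := J h x.
have dz2 : dom A z2 := implicit_step_dom (Astep h2) _.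
have dx1 : dom A x1 := implicit_step_dom (Astep h0) _.
have e1 : z1 = z + (h / 2) *: A z1 := implicit_step_eq (Astep h2) _.
have e2 : z2 = z1 + (h / 2) *: A z2 := implicit_step_eq (Astep h2) _.
have ex : x1 = x + h *: A x1 := implicit_step_eq (Astep h0) _.
have E : x1 - z2 = (x - z) + h *: (A x1 - A z2) + (h / 2) *: (A z2 - A z1).
  by rewrite {1}ex {1}e2 {1}e1; vector_field.
have [->|xz] := eqVneq x1 z2.
  by rewrite subrr normr0 addr_ge0// mulr_ge0// ltW.
have xz0 : 0 < `|x1 - z2| by rewrite normr_gt0 subr_eq0.
rewrite -(ler_pM2r xz0) -expr2 -rdotxx {1}E 2!rdotDl !rdotZl mulrDl.
have H1 := rdot_le (x - z) (x1 - z2).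
have H2 := rdot_le (A z2 - A z1) (x1 - z2).
have H3 : h * rdot (A x1 - A z2) (x1 - z2) <= 0 by rewrite pmulr_rle0// Adiss.
have H4 : h / 2 * rdot (A z2 - A z1) (x1 - z2) <=
    h / 2 * `|A z2 - A z1| * `|x1 - z2| by rewrite -(mulrA (h / 2)) ler_pM2l.
lra.
Qed.

(** Young's inequality with weight w trades the increments of A for their
    squares, whose sum telescopes by the Pythagorean inequality. *)
Lemma euler_halving h n x (w : R) : 0 < h -> 0 < w -> dom A x ->
  `|iter n (J h) x - iter n.*2 (J (h / 2)) x| <=
  h / 4 * (n%:R * w + (`|A x| ^+ 2 - `|A (iter n.*2 (J (h / 2)) x)| ^+ 2) / w).
Proof.
move=> h0 w0 dx; have h2 : 0 < h / 2 by rewrite divr_gt0.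
elim: n => [|n IHn]; first by rewrite /= !subrr normr0 !mul0r addr0 mulr0.
rewrite doubleS !iterS (le_trans (step_halving _ _ h0))//.
set z := iter n.*2 _ x in IHn *; have dz : dom A z by exact: euler_dom.
set z1 := J (h / 2) z; have dz1 : dom A z1 := implicit_step_dom (Astep h2) _.
have P1 := implicit_step_op_le Adiss h2 (Astep h2) dz.
have P2 := implicit_step_pythagoras Adiss h2 (Astep h2) dz1.
rewrite -/z1 in P1 P2; set z2 := J (h / 2) z1 in P2 *.
set d := `|A z2 - A z1| in P2 *.
rewrite (le_trans (lerD IHn (lexx _)))//.
have P1' : `|A z1| ^+ 2 <= `|A z| ^+ 2 by rewrite ler_pXn2r ?nnegrE.
have dw : d <= (w + d ^+ 2 / w) / 2.
  rewrite ler_pdivlMr// -(ler_pM2r w0) mulrDl divfK ?gt_eqF//.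
  by have := sqr_ge0 (w - d); rewrite !expr2; lra.
have dw2 : d ^+ 2 / w <= (`|A z| ^+ 2 - `|A z2| ^+ 2) / w.
  by rewrite ler_pM2r ?invr_gt0//; lra.
have : h / 2 * d <= h / 4 * (w + (`|A z| ^+ 2 - `|A z2| ^+ 2) / w).
  have -> : h / 4 * (w + (`|A z| ^+ 2 - `|A z2| ^+ 2) / w) =
     h / 2 * ((w + (`|A z| ^+ 2 - `|A z2| ^+ 2) / w) / 2) by lra.
  by rewrite ler_pM2l//; lra.
by rewrite -natr1; lra.
Qed.

Definition euler (k : nat) (t : R) x := iter (truncn (t / mesh k)) (J (mesh k)) x.

Lemma truncn_double (a : R) : 0 <= a ->
  truncn (a * 2) = (truncn a).*2 \/ truncn (a * 2) = (truncn a).*2.+1.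
Proof.
move=> a0; have /andP[H1 H2] := truncn_itv a0; set n := truncn a in H1 H2 *.
have [H|H] := ltP (a * 2) (n.*2.+1)%:R; [left|right]; apply: truncn_def.
  by rewrite H andbT -muln2 natrM ler_pM2r.
by rewrite H/= -doubleS -muln2 natrM ltr_pM2r.
Qed.

Lemma euler_cauchy x t k : dom A x -> 0 <= t ->
  `|euler k t x - euler k.+1 t x| <=
  ((t + `|A x| ^+ 2) / 4 + `|A x|) * (3 / 4) ^+ k.
Proof.
move=> dx t0; have m0 := mesh_gt0 k; have m1 := mesh_gt0 k.+1.
have tm : t / mesh k.+1 = t / mesh k * 2.
  by rewrite meshS; field; rewrite gt_eqF.
have t0' : 0 <= t / mesh k by rewrite divr_ge0// ltW.
rewrite /euler tm; set n := truncn (t / mesh k).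
have n1 : n%:R * mesh k <= t.
  by rewrite -ler_pdivlMr//; have /andP[] := truncn_itv t0'.
have w0 : 0 < (3 / 4) ^+ k :> R by rewrite exprn_gt0//; lra.
have main : `|iter n (J (mesh k)) x - iter n.*2 (J (mesh k.+1)) x| <=
    ((t + `|A x| ^+ 2) / 4) * (3 / 4) ^+ k.
  rewrite meshS (le_trans (euler_halving n m0 w0 dx))//.
  set w := (3 / 4) ^+ k in w0 *; set b := _ - _.
  (* Both terms of the error are of order w: this is 1 / 2 <= (3 / 4)^2. *)
  have hw : mesh k / w <= w.
    rewrite ler_pdivrMr// /mesh /w -expr2 -exprM mulnC exprM.
    by rewrite lerXn2r ?nnegrE//; lra.
  have b1 : b <= `|A x| ^+ 2 by rewrite /b gerBl.
  have b2 : mesh k * (b / w) <= `|A x| ^+ 2 * w.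
    rewrite mulrCA (@le_trans _ _ (`|A x| ^+ 2 * (mesh k / w)))//.
      by rewrite ler_pM2r// divr_gt0.
    by rewrite ler_wpM2l.
  have b3 : mesh k * (n%:R * w) <= t * w.
    by rewrite mulrA (mulrC (mesh k)) ler_pM2r.
  have -> : mesh k / 4 * (n%:R * w + b / w) =
    (mesh k * (n%:R * w) + mesh k * (b / w)) / 4 by ring.
  have -> : (t + `|A x| ^+ 2) / 4 * w = (t * w + `|A x| ^+ 2 * w) / 4 by ring.
  by rewrite ler_pM2r ?invr_gt0// lerD.
have mw : mesh k <= (3 / 4) ^+ k by rewrite lerXn2r ?nnegrE//; lra.
have [->|->] := truncn_double t0'.
  by rewrite (le_trans main)// ler_pM2r// lerDl.
rewrite -/n iterS -(subrKA (iter n.*2 (J (mesh k.+1)) x)).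
rewrite (le_trans (ler_normD _ _))// mulrDl lerD// distrC.
rewrite (le_trans (implicit_step_dist Adiss m1 (Astep m1) (euler_dom m1 _ dx)))//.
rewrite mulrC ler_pM ?normr_ge0 ?(ltW m1)//; first exact: euler_op_le.
by rewrite (le_trans _ mw)// meshS; lra.
Qed.

(** The exponential formula of Crandall and Liggett along dyadic step sizes. *)
Definition nl_semigroup (t : R) x : V := limn (fun k => euler k t x).
Local Notation S := nl_semigroup.

Lemma euler_cvg x t : 0 <= t -> euler k t x @[k --> \oo] --> S t x.
Proof.
move=> t0; rewrite /S /nl_semigroup.
have dcv z : dom A z -> cvgn (fun k => euler k t z).
  move=> dz; apply: (geometric_cvg (q := 3 / 4)).
    by apply/andP; split; lra.
  by move=> n; exact: euler_cauchy.
apply: cauchy_seq_cvg => e e0.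
have e4 : 0 < e / 4 by rewrite divr_gt0.
have [z [dz zx]] := Adense x e4.
have /cvgrPdist_lt/(_ _ e4) [N _ HN] := dcv _ dz.
have xN i : (N <= i)%N -> `|limn (fun k => euler k t z) - euler i t x| < e / 2.
  move=> /HN/= zi; rewrite -(subrKA (euler i t z)) (le_lt_trans (ler_normD _ _))//.
  have := euler_nonexpansive (mesh_gt0 i) (truncn (t / mesh i)) z x.
  by rewrite -/(euler i t z) -/(euler i t x); lra.
exists N => i j /xN iN /xN jN; rewrite -(subrKA (limn (fun k => euler k t z))).
by rewrite (le_lt_trans (ler_normD _ _))// distrC; lra.
Qed.

Lemma nl_semigroup_contraction x y t : 0 <= t -> `|S t x - S t y| <= `|x - y|.
Proof.
move=> t0.
apply: norm_cvg_le (cvgB (@euler_cvg x _ t0) (@euler_cvg y _ t0)) _.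
by apply: nearW => k; exact: euler_nonexpansive (mesh_gt0 _) _ _ _.
Qed.

Lemma nl_semigroup_dom x t : dom A x -> 0 <= t ->
  dom A (S t x) /\ `|A (S t x)| <= `|A x|.
Proof.
move=> dx t0; apply: (op_closed Adiss Astep) => e e0.
have /cvgrPdist_lt/(_ _ e0) [N _ /(_ N (leqnn _)) /= HN] := @euler_cvg x _ t0.
exists (euler N t x); split; first by apply: euler_dom dx; exact: mesh_gt0.
  by rewrite distrC.
by apply: euler_op_le dx; exact: mesh_gt0.
Qed.

Lemma nl_semigroup0 x : S 0 x = x.
Proof.
rewrite /nl_semigroup (_ : (fun k => euler k 0 x) = cst x) ?lim_cst//.
by apply/funext => k; rewrite /euler mul0r truncn0.
Qed.

Lemma truncn_mesh_cvg t : 0 <= t ->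
  (truncn (t / mesh k))%:R * mesh k @[k --> \oo] --> t.
Proof.
move=> t0; apply/cvgrPdist_lt => e e0.
have [N _ HN] := cvgr_lt _ mesh_cvg0 _ e0.
exists N => // k /HN /= ke; have m0 := mesh_gt0 k.
have /andP[H1 H2] := truncn_itv (divr_ge0 t0 (ltW m0)).
rewrite ler_pdivlMr// in H1; rewrite ltr_pdivrMr// -natr1 mulrDl mul1r in H2.
by rewrite ger0_norm; lra.
Qed.

Lemma nl_semigroup_lip_le x s t : dom A x -> 0 <= s -> s <= t ->
  `|S t x - S s x| <= (t - s) * `|A x|.
Proof.
move=> dx s0 st; have t0 := le_trans s0 st.
have Hl : `|euler k t x - euler k s x| @[k --> \oo] --> `|S t x - S s x|.
  by apply: cvg_norm; apply: cvgB; apply: euler_cvg.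
have Hr : ((truncn (t / mesh k))%:R * mesh k - (truncn (s / mesh k))%:R * mesh k)
    * `|A x| @[k --> \oo] --> (t - s) * `|A x|.
  apply: cvgM; last exact: cvg_cst.
  by apply: cvgB; exact: truncn_mesh_cvg.
apply: ler_cvg_to Hl Hr _; apply: nearW => k.
have st' : (truncn (s / mesh k) <= truncn (t / mesh k))%N.
  by apply: le_truncn; rewrite ler_pM2r// invr_gt0 mesh_gt0.
rewrite /euler -{1}(subnK st') -mulrBl -natrB//.
by apply: euler_dist dx; exact: mesh_gt0.
Qed.

Lemma nl_semigroup_lip x s t : dom A x -> 0 <= s -> 0 <= t ->
  `|S t x - S s x| <= `|t - s| * `|A x|.
Proof.
move=> dx s0 t0; have [st|ts] := leP s t.
  by rewrite ger0_norm ?subr_ge0//; exact: nl_semigroup_lip_le.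
rewrite distrC (distrC t) ger0_norm ?subr_ge0 ?(ltW ts)//.
by apply: nl_semigroup_lip_le => //; exact: ltW.
Qed.

(** At dyadic times the Euler schemes satisfy the semigroup law exactly, as
    soon as the mesh is fine enough. *)
Lemma nl_semigroupD_dyadic x (n j : nat) s : dom A x -> 0 <= s ->
  S (n%:R * mesh j + s) x = S s (S (n%:R * mesh j) x).
Proof.
move=> dx s0; set t := n%:R * mesh j.
have t0 : 0 <= t by rewrite mulr_ge0// ltW// mesh_gt0.
have ts0 : 0 <= t + s by rewrite addr_ge0.
have split_euler k : (j <= k)%N ->
    euler k (t + s) x = iter (truncn (s / mesh k)) (J (mesh k)) (euler k t x).
  move=> jk; rewrite /euler -iterD mulrDl.
  have -> : t / mesh k = (n * 2 ^ (k - j))%:R.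
    rewrite natrM natrX /t /mesh -(subnK jk) exprD addnK.
    by rewrite !exprVn; field; rewrite !expf_neq0.
  rewrite natrK; congr (iter _ _ _); apply: truncn_def.
  have /andP[H1 H2] := truncn_itv (divr_ge0 s0 (ltW (mesh_gt0 k))).
  by rewrite natrD -natr1 natrD addrC; rewrite -natr1 in H2; lra.
have e1 := @euler_cvg x _ ts0; have e2 := @euler_cvg (S t x) _ s0.
suff e3 : euler k (t + s) x @[k --> \oo] --> S s (S t x).
  exact: cvg_unique e1 e3.
rewrite -[X in _ --> X]addr0.
have -> : (fun k => euler k (t + s) x) = (fun k => euler k s (S t x) +
    (euler k (t + s) x - euler k s (S t x))).
  by apply/funext => k; rewrite [RHS]addrC subrK.
apply: cvgD => //; apply/cvgrPdist_lt => e e0.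
have /cvgrPdist_lt/(_ _ e0) [N _ HN] := @euler_cvg x _ t0.
exists (maxn j N) => // k /=; rewrite geq_max => /andP[jk /HN /= kN].
rewrite sub0r normrN (split_euler _ jk) (le_lt_trans _ kN)// distrC.
by rewrite -normrN opprB distrC; exact: euler_nonexpansive (mesh_gt0 _) _ _ _.
Qed.

Lemma nl_semigroupD_dom x t s : dom A x -> 0 <= t -> 0 <= s ->
  S (t + s) x = S s (S t x).
Proof.
move=> dx t0 s0; pose d k := (truncn (t / mesh k))%:R * mesh k.
have d0 k : 0 <= d k by rewrite mulr_ge0// ltW// mesh_gt0.
have dt : d k @[k --> \oo] --> t := truncn_mesh_cvg t0.
apply/eqP; rewrite -subr_eq0 -normr_le0; apply/ler_addgt0Pr => e e0.
rewrite add0r; have e1 : 0 < e / (2 * (`|A x| + 1)).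
  by rewrite divr_gt0// mulr_gt0// ltr_wpDl.
have /cvgrPdist_lt/(_ _ e1) [N _ /(_ N (leqnn _)) /= HN] := dt.
rewrite -(subrKA (S (d N + s) x)) (le_trans (ler_normD _ _))//.
rewrite {2}nl_semigroupD_dyadic// -/(d N).
have H1 := nl_semigroup_lip dx (addr_ge0 (d0 N) s0) (addr_ge0 t0 s0).
have tdE : t + s - (d N + s) = t - d N by ring.
rewrite tdE in H1.
have H2 := le_trans (nl_semigroup_contraction (S (d N) x) (S t x) s0)
  (nl_semigroup_lip dx t0 (d0 N)).
rewrite (distrC (d N)) in H2.
rewrite ltr_pdivlMr ?mulr_gt0 ?ltr_wpDl// in HN.
rewrite (le_trans (lerD H1 H2))//.
have := normr_ge0 (t - d N); nra.
Qed.

Lemma nl_semigroupD x t s : 0 <= t -> 0 <= s -> S (t + s) x = S s (S t x).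
Proof.
move=> t0 s0; apply/eqP; rewrite -subr_eq0 -normr_le0.
apply/ler_addgt0Pr => e e0; rewrite add0r.
have e2 : 0 < e / 2 by rewrite divr_gt0.
have [z [dz zx]] := Adense x e2.
rewrite -(subrKA (S (t + s) z)) (le_trans (ler_normD _ _))//.
rewrite [X in _ + `|X - _|]nl_semigroupD_dom//.
have H1 := nl_semigroup_contraction x z (addr_ge0 t0 s0).
have H2 := le_trans (nl_semigroup_contraction (S t z) (S t x) s0)
  (nl_semigroup_contraction z x t0).
by rewrite (distrC x z) in H1; lra.
Qed.

(** The bound on the increments of the Euler schemes is uniform in the mesh:
    close to x, and with |A| not increasing, A stays close to A x. *)
Lemma nl_semigroup_increment0 x (e : R) : dom A x -> 0 < e ->
  \forall h \near 0^'+, `|S h x - x - h *: A x| <= h * e.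
Proof.
move=> dx e0; have [d d0 Hd] := op_cont Adiss Astep dx e0.
pose b := d / (`|A x| + 1).
have b0 : 0 < b by rewrite divr_gt0// ltr_wpDl.
exists b => //= h /=; rewrite sub0r normrN => hb h0.
rewrite gtr0_norm// ltr_pdivlMr ?ltr_wpDl// in hb.
have hc := truncn_mesh_cvg (ltW h0).
have Hl : `|euler k h x - x - ((truncn (h / mesh k))%:R * mesh k) *: A x|
    @[k --> \oo] --> `|S h x - x - h *: A x|.
  apply: cvg_norm; apply: cvgB; last by apply: cvgZ => //; exact: cvg_cst.
  by apply: cvgB; [apply: euler_cvg (ltW h0) | exact: cvg_cst].
have Hr : ((truncn (h / mesh k))%:R * mesh k) * e @[k --> \oo] --> h * e.
  by apply: cvgM => //; exact: cvg_cst.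
apply: ler_cvg_to Hl Hr _; apply: nearW => k.
have m0 := mesh_gt0 k.
apply: (euler_increment m0) => // i /andP[_ ih]; apply/ltW/Hd.
- exact: euler_dom.
- have := euler_dist m0 i 0 dx; rewrite addn0 /= => H; apply: (le_lt_trans H).
  have ih' : i%:R * mesh k <= h.
    have /andP[H1 _] := truncn_itv (divr_ge0 (ltW h0) (ltW m0)).
    rewrite ler_pdivlMr// in H1; apply: le_trans H1.
    by rewrite ler_pM2r// ler_nat.
  have := normr_ge0 (A x); nra.
- exact: euler_op_le.
Qed.

(** A right derivative at every time, continuous from the right, makes the
    fundamental theorem available without differentiability almost
    everywhere. *)
Lemma nl_semigroup_increment x t (e : R) : dom A x -> 0 <= t -> 0 < e ->
  \forall h \near 0^'+,
    `|S (t + h) x - S t x - h *: A (S t x)| <= h * e.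
Proof.
move=> dx t0 e0; have [dt _] := nl_semigroup_dom dx t0.
near=> h; rewrite nl_semigroupD//; near: h.
exact: nl_semigroup_increment0.
Unshelve. all: by end_near. Qed.

(** The norm of A does not increase along the orbit, so that A is continuous
    along it from the right. *)
Lemma nl_semigroup_op_right_cont x t (e : R) : dom A x -> 0 <= t -> 0 < e ->
  exists2 d, 0 < d & forall h, 0 <= h < d ->
    `|A (S (t + h) x) - A (S t x)| < e.
Proof.
move=> dx t0 e0; have [dt _] := nl_semigroup_dom dx t0.
have [d d0 Hd] := op_cont Adiss Astep dt e0.
exists (d / (`|A (S t x)| + 1)); first by rewrite divr_gt0// ltr_wpDl.
move=> h /andP[h0]; rewrite ltr_pdivlMr ?ltr_wpDl// => hd.
rewrite nl_semigroupD//; have [dth Ath] := nl_semigroup_dom dt h0.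
apply: Hd => //; have := nl_semigroup_lip dt (lexx 0) h0.
rewrite nl_semigroup0 subr0 ger0_norm// => H; apply: (le_lt_trans H).
have := normr_ge0 (A (S t x)); nra.
Qed.

End Semigroup.

(** * Bochner integrals and scalar integrals *)

Section AeLe.
Context (R : realType).
Local Notation mu := (@lebesgue_measure R).

(** The difference g - f agrees almost everywhere with its absolute value. *)
Lemma ae_le_Rintegral (D : set (measurableTypeR R)) (f g : R -> R) :
  measurable D ->
  mu.-integrable D (EFin \o f) -> mu.-integrable D (EFin \o g) ->
  {ae mu, forall t, D t -> f t <= g t} ->
  \int[mu]_(t in D) f t <= \int[mu]_(t in D) g t.
Proof.
move=> mD fi gi fg; rewrite -subr_ge0 -RintegralB//.
have gfi : mu.-integrable D (EFin \o (fun t => g t - f t)).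
  exact: (integrableB mD gi fi).
have -> : \int[mu]_(t in D) (g t - f t) = \int[mu]_(t in D) `|g t - f t|.
  rewrite /Rintegral; congr fine; apply: ae_eq_integral => //.
  - exact: measurable_int gfi.
  - exact: measurable_int (integrable_abse gfi).
  - by apply: filterS fg => t fgt Dt /=; rewrite ger0_norm// subr_ge0 fgt.
exact: Rintegral_ge0.
Qed.

End AeLe.

Section SimpleFunctions.
Context (R : realType) (X : hilbertType R).
Local Notation XR := (realify X).
Local Notation mu := (@lebesgue_measure R).
Local Notation T := (measurableTypeR R).
Implicit Types (D : set T) (s g : R -> X).

Lemma simple_fun_preimage s (B : set X) : simple_fun s -> measurable (s @^-1` B : set T).
Proof.
move=> [sf sm].
have -> : s @^-1` B = \bigcup_(v in range s `&` B) s @^-1` [set v].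
  apply/seteqP; split => t /=; first by move=> Bt; exists (s t) => //; split.
  by move=> [v [_ Bv] /= ->].
by apply: fin_bigcup_measurable; [exact: finite_setIl | move=> v _; exact: sm].
Qed.

Lemma simple_fun_comp s (psi : X -> R) : simple_fun s ->
  measurable_fun setT (psi \o s : T -> R).
Proof.
by move=> ss _ B mB; rewrite setTI comp_preimage; exact: simple_fun_preimage.
Qed.

Lemma simple_funB s s' : simple_fun s -> simple_fun s' ->
  simple_fun (fun t => s t - s' t).
Proof.
move=> ss ss'; have [sf sm] := ss; have [sf' sm'] := ss'; split.
  apply: (@sub_finite_set _ _ [set v - w | v in range s & w in range s']).
    by move=> _ [t _ <-]; exists (s t); [exists t | exists (s' t); [exists t|]].
  exact: finite_image2.
move=> u; have -> : (fun t => s t - s' t) @^-1` [set u] =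
    \bigcup_(v in range s) (s @^-1` [set v] `&` s' @^-1` [set v - u]).
  apply/seteqP; split => t /=.
    by move=> <-; exists (s t); [exists t | split=> //=; rewrite subKr].
  by move=> [v _ /= [-> ->]]; rewrite subKr.
by apply: fin_bigcup_measurable => // v _; apply: measurableI.
Qed.

Lemma strongly_measurableB D s g : simple_fun s -> strongly_measurable D g ->
  strongly_measurable D (fun t => s t - g t).
Proof.
move=> ss [s_ s_s s_g]; exists (fun n t => s t - s_ n t) => [n|t Dt].
  exact: simple_funB.
by apply: cvgB; [exact: cvg_cst | exact: s_g].
Qed.

Lemma strongly_measurable_comp D g (psi : XR -> R) : measurable D ->
  continuous psi -> strongly_measurable D g ->
  measurable_fun D (fun t : T => psi (g t)).
Proof.
move=> mD psic [s_ s_s s_g].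
apply: (@measurable_fun_cvg _ _ _ D (fun n t => psi (s_ n t))) => [n|t Dt].
  by apply: measurable_funTS; exact: (simple_fun_comp psi (s_s n)).
have /cvg_realify sg := s_g t Dt.
exact: (cvg_comp _ _ sg (psic (g t))).
Qed.

Lemma measurable_fun_norm D g : measurable D -> strongly_measurable D g ->
  measurable_fun D (fun t : T => `|g t : XR|).
Proof. by move=> mD; apply: strongly_measurable_comp => //; exact: norm_continuous. Qed.

Lemma measurable_fun_rdot D g (v : XR) : measurable D -> strongly_measurable D g ->
  measurable_fun D (fun t : T => rdot (g t : XR) v).
Proof.
move=> mD; apply: (@strongly_measurable_comp D g (fun x => rdot x v)) => //.
exact: rdot_continuous.
Qed.

Lemma bounded_integrable D (f : T -> R) (C : R) : measurable D ->
  (mu D < +oo)%E -> measurable_fun D f -> (forall t, D t -> `|f t| <= C) ->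
  mu.-integrable D (EFin \o f).
Proof.
move=> mD Dfin mf fC; apply: measurable_bounded_integrable => //.
exists C; split; first exact: num_real.
by move=> M CM t Dt; apply: le_trans (fC t Dt) (ltW CM).
Qed.

Lemma simple_fun_bounded s : simple_fun s -> exists C, forall t, `|s t : XR| <= C.
Proof.
move=> [sf _].
have /finite_seqP [r rE] : finite_set ((fun v : XR => `|v|) @` range s).
  exact: finite_image.
exists (\sum_(c <- r) `|c|) => t.
have : [set` r] `|s t : XR| by rewrite -rE; exists (s t).
move=> /= tr; rewrite (big_rem _ tr)/= normr_id lerDl.
by apply: sumr_ge0.
Qed.

(** Both sides are sums over the finitely many values of s. This is how
    Bochner integrals are reduced to real Lebesgue integrals below. *)
Lemma simple_integral_rdot D s (v : XR) : measurable D -> (mu D < +oo)%E ->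
  simple_fun s ->
  rdot (simple_integral D s : XR) v = \int[mu]_(t in D) rdot (s t : XR) v.
Proof.
move=> mD Dfin ss; have [sf sm] := ss.
have [F [uF FE]] : exists F : seq X, uniq F /\ range s = [set` F].
  have /finite_seqP [r rE] := sf; exists (undup r).
  by rewrite undup_uniq rE; split => //; apply/seteqP; split=> x;
    rewrite /= mem_undup.
have mw w : measurable (s @^-1` [set w] : set T) by exact: simple_fun_preimage.
have mDw w : measurable (D `&` s @^-1` [set w] : set T) by exact: measurableI.
have muE w : mu (D `&` s @^-1` [set w]) \is a fin_num.
  rewrite ge0_fin_numE// (le_lt_trans _ Dfin)//.
  by apply: le_measure; rewrite ?inE.
have -> : \int[mu]_(t in D) rdot (s t : XR) v =
    \int[mu]_(t in D) \sum_(w <- F) rdot (w : XR) v * \1_(s @^-1` [set w]) t.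
  apply: eq_Rintegral => t _; have tF : s t \in F.
    by have : [set` F] (s t) by rewrite -FE; exists t.
  rewrite (big_rem _ tF)/= indicE mem_set//= mulr1 big_seq big1 ?addr0// => w.
  rewrite mem_rem_uniq// inE => /andP[wt _].
  by rewrite indicE memNset ?mulr0//= => e; rewrite e eqxx in wt.
have int1 w : mu.-integrable D (EFin \o \1_(s @^-1` [set w])).
  apply: (@bounded_integrable D _ 1) => //.
  by move=> t _; rewrite indicE; case: (_ \in _); rewrite ?normr1 ?normr0.
rewrite /Rintegral.
under eq_integral do rewrite -sumEFin.
rewrite integral_sum//; last first.
  by move=> w; under eq_fun do rewrite EFinM; apply: integrableZl => //; exact: int1.
rewrite (eq_bigr (fun w => (rdot (w : XR) v * fine (mu (D `&` s @^-1` [set w])))%:E)); last first.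
  move=> w _; under eq_integral do rewrite EFinM.
  rewrite integralZl//; last exact: int1.
  by rewrite integral_indic// setIC EFinM fineK.
rewrite sumEFin /= /simple_integral FE -fsbig_seq//.
rewrite (big_morph (fun x : X => rdot (x : XR) v) (id1 := 0) (op1 := +%R)).
- by apply: eq_bigr => w _; rewrite mulrC; exact: (@rdotZl R XR).
- by move=> x y; exact: rdotDl.
- exact: rdot0l.
Qed.

Lemma integrable_rdot D g (v : XR) : measurable D -> strongly_measurable D g ->
  mu.-integrable D (fun t : T => (`|g t : XR|)%:E) ->
  mu.-integrable D (fun t : T => (rdot (g t : XR) v)%:E).
Proof.
move=> mD mg ig.
have ivg := integrableZl mD `|v| ig.
apply: le_integrable ivg => //.
  by apply/measurable_EFinP; exact: measurable_fun_rdot.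
move=> t _ /=; rewrite lee_fin [leRHS]ger0_norm ?mulr_ge0// mulrC.
exact: rdot_norm_le.
Qed.

Lemma simple_integral_rdot_dist D s g (v : XR) :
  measurable D -> (mu D < +oo)%E -> simple_fun s -> strongly_measurable D g ->
  mu.-integrable D (fun t : T => (`|g t : XR|)%:E) ->
  mu.-integrable D (fun t : T => (`|(s t : XR) - g t|)%:E) ->
  `|rdot (simple_integral D s : XR) v - \int[mu]_(t in D) rdot (g t : XR) v| <=
  \int[mu]_(t in D) `|(s t : XR) - g t| * `|v|.
Proof.
move=> mD Dfin ss mg ig isg; rewrite simple_integral_rdot//.
have igv := integrable_rdot v mD mg ig.
have isgv := integrable_rdot v mD (strongly_measurableB ss mg) isg.
have isv : mu.-integrable D (fun t : T => (rdot (s t : XR) v)%:E).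
  have [C sC] := simple_fun_bounded ss.
  apply: (@bounded_integrable D _ (C * `|v|)) => //.
    by apply: measurable_funTS; exact: (simple_fun_comp (fun x => rdot (x : XR) v)).
  by move=> t _; rewrite (le_trans (rdot_norm_le _ _))// ler_wpM2r.
rewrite -RintegralB// (le_trans (le_normr_Rintegral _ _))//.
  exact: (integrableB mD isv igv).
rewrite -RintegralZr//; apply: le_Rintegral => //.
- exact: (integrable_abse (integrableB mD isv igv)).
- exact: (integrableZr mD `|v| isg).
- by move=> t _; rewrite -rdotNl -rdotDl; exact: rdot_norm_le.
Qed.

Lemma cvg0_integral_dist D (s_ : nat -> R -> X) g :
  measurable D -> (mu D < +oo)%E -> (forall n, simple_fun (s_ n)) ->
  strongly_measurable D g ->
  (\int[mu]_(t in D) (hnorm (s_ n t - g t))%:E)%E @[n --> \oo] --> 0%E ->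
  mu.-integrable D (fun t : T => (`|g t : XR|)%:E) /\
  exists N, forall n, (N <= n)%N ->
    mu.-integrable D (fun t : T => (`|(s_ n t : XR) - g t|)%:E).
Proof.
move=> mD Dfin ss mg s0.
have msg n : measurable_fun D (fun t : T => (`|(s_ n t : XR) - g t|)%:E).
  apply/measurable_EFinP; apply: measurable_fun_norm => //.
  exact: strongly_measurableB.
have /fine_cvgP[[N _ HN] _] := s0.
have isg n : (N <= n)%N -> mu.-integrable D (fun t : T => (`|(s_ n t : XR) - g t|)%:E).
  move=> /HN /= nfin; apply/integrableP; split; first exact: msg.
  move: nfin; rewrite fin_numElt => /andP[_]; apply: le_lt_trans.
  rewrite le_eqVlt; apply/orP; left.
  by apply/eqP; apply: eq_integral => t _ /=; rewrite normr_id.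
split; last by exists N.
have [C sC] := simple_fun_bounded (ss N).
have iC : mu.-integrable D (fun t : T => (C + `|(s_ N t : XR) - g t|)%:E).
  have iC : mu.-integrable D (EFin \o cst C).
    exact: (@bounded_integrable D (cst C) `|C|).
  exact: (integrableD mD iC (isg N (leqnn _))).
apply: le_integrable iC => //.
  by apply/measurable_EFinP; exact: measurable_fun_norm.
move=> t _ /=; rewrite lee_fin normr_id.
rewrite (le_trans _ (ler_norm _))// (le_trans _ (lerD (sC t) (lexx _)))//.
by have := ler_normB (s_ N t : XR) ((s_ N t : XR) - g t); rewrite subKr.
Qed.

Lemma Rintegral_dist_cvg0 D (s_ : nat -> R -> X) g :
  measurable D -> (mu D < +oo)%E -> (forall n, simple_fun (s_ n)) ->
  strongly_measurable D g ->
  (\int[mu]_(t in D) (hnorm (s_ n t - g t))%:E)%E @[n --> \oo] --> 0%E ->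
  \int[mu]_(t in D) `|(s_ n t : XR) - g t| @[n --> \oo] --> (0 : R).
Proof. by move=> mD Dfin ss mg /fine_cvg. Qed.

Lemma bochner_integral_rdot D g (I : X) (v : XR) :
  measurable D -> (mu D < +oo)%E -> is_bochner_integral D g I ->
  mu.-integrable D (fun t : T => (`|g t : XR|)%:E) /\
  \int[mu]_(t in D) rdot (g t : XR) v = rdot (I : XR) v.
Proof.
move=> mD Dfin [mg [s_ [ss s0 sI]]].
have [ig [N isg]] := cvg0_integral_dist mD Dfin ss mg s0; split=> //.
have /cvg_realify sI' := sI.
have s1 : rdot (simple_integral D (s_ n) : XR) v @[n --> \oo] --> rdot (I : XR) v.
  exact: rdot_cvg.
have s2 : rdot (simple_integral D (s_ n) : XR) v @[n --> \oo] -->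
    \int[mu]_(t in D) rdot (g t : XR) v.
  apply/cvgrPdist_le => e e0.
  have s3 : \int[mu]_(t in D) `|(s_ n t : XR) - g t| * `|v|
      @[n --> \oo] --> (0 : R).
    rewrite -[X in _ --> X](mul0r `|v|); apply: cvgMr_tmp.
    exact: Rintegral_dist_cvg0.
  have [M _ HM] := cvgr_lt _ s3 _ e0.
  exists (maxn N M) => // n /=; rewrite geq_max => /andP[nN /HM /= nM].
  rewrite distrC (le_trans _ (ltW nM))//.
  by apply: simple_integral_rdot_dist => //; exact: isg.
exact: cvg_unique s2 s1.
Qed.

(** Testing with the error itself turns the weak identity into strong
    convergence of the simple integrals. *)
Lemma is_bochner_of_rdot D (s_ : nat -> R -> X) g (I : X) :
  measurable D -> (mu D < +oo)%E -> (forall n, simple_fun (s_ n)) ->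
  strongly_measurable D g ->
  (\int[mu]_(t in D) (hnorm (s_ n t - g t))%:E)%E @[n --> \oo] --> 0%E ->
  (forall v : XR, \int[mu]_(t in D) rdot (g t : XR) v = rdot (I : XR) v) ->
  is_bochner_integral D g I.
Proof.
move=> mD Dfin ss mg s0 gI.
have [ig [N isg]] := cvg0_integral_dist mD Dfin ss mg s0.
split=> //; exists s_; split => //; apply/cvg_realify; apply/cvgrPdist_lt => e e0.
have [M _ HM] := cvgr_lt _ (Rintegral_dist_cvg0 mD Dfin ss mg s0) _ e0.
exists (maxn N M) => // n /=; rewrite geq_max => /andP[nN /HM /= nM].
rewrite distrC (le_lt_trans _ nM)//; set w : XR := (_ - _).
have [->|w0] := eqVneq w 0; first by rewrite normr0; exact: Rintegral_ge0.
have := simple_integral_rdot_dist w mD Dfin (ss n) mg ig (isg n nN).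
rewrite gI -rdotNl -rdotDl -/w rdotxx ger0_norm// expr2.
by rewrite ler_pM2r// normr_gt0.
Qed.

End SimpleFunctions.

(** * From right derivatives to strong solutions *)

Section RightContinuous.
Context (R : realType) (X : hilbertType R).
Local Notation XR := (realify X).
Local Notation mu := (@lebesgue_measure R).
Local Notation T := (measurableTypeR R).
Local Notation mesh := (@mesh R).

Definition dyadic_index (n : nat) (r : R) : nat :=
  minn (truncn (r / mesh n)) (n * 2 ^ n).

Lemma measurable_truncn_lt (a : R) (j : nat) : 0 < a ->
  measurable ([set r | (j < truncn (r / a))%N] : set T).
Proof.
move=> a0.
have -> : [set r | (j < truncn (r / a))%N] = `[j.+1%:R * a, +oo[%classic.
  by apply/seteqP; split => r /=;
    rewrite truncn_gt_nat ler_pdivlMr// in_itv/= andbT.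
exact: measurable_itv.
Qed.

Lemma measurable_dyadic_index n i :
  measurable (dyadic_index n @^-1` [set i] : set T).
Proof.
have mt j : measurable ([set r | (j <= truncn (r / mesh n))%N] : set T).
  case: j => [|j]; last exact: measurable_truncn_lt (mesh_gt0 _ _).
  rewrite (_ : [set r | _] = setT); first exact: measurableT.
  by apply/seteqP; split.
have mi j : measurable ([set r | (j <= dyadic_index n r)%N] : set T).
  rewrite (_ : [set r | _] = if (j <= n * 2 ^ n)%N then
     [set r | (j <= truncn (r / mesh n))%N] else set0); first by case: ifP.
  case: ifP => jn; apply/seteqP; split=> r //=; rewrite /dyadic_index leq_min jn;
    by rewrite ?andbT ?andbF.
rewrite (_ : _ @^-1` _ = [set r | (i <= dyadic_index n r)%N] `\`
   [set r | (i.+1 <= dyadic_index n r)%N]); first exact: measurableD.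
apply/seteqP; split=> r /=; first by move=> ->; rewrite ltnn.
by move=> [H1 /negP]; rewrite -leqNgt => H2; apply/eqP; rewrite eqn_leq H1 H2.
Qed.

(** The grid point lies to the right of r since the functions to be
    approximated are continuous from the right; the index is capped so that
    only finitely many values are taken. *)
Definition dyadic_right n r : R := (dyadic_index n r).+1%:R * mesh n.

Lemma simple_dyadic (g : R -> X) n : simple_fun (fun r => g (dyadic_right n r)).
Proof.
split.
  apply: (@sub_finite_set _ _
    ((fun i => g (i.+1%:R * mesh n)) @` `I_(n * 2 ^ n).+1)).
    move=> _ [r _ <-]; exists (dyadic_index n r) => //=.
    by rewrite ltnS geq_minr.
  exact/finite_image/finite_II.
move=> v; have -> : (fun r => g (dyadic_right n r)) @^-1` [set v] =
    \bigcup_(i in [set i | g (i.+1%:R * mesh n) = v]) dyadic_index n @^-1` [set i].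
  apply/seteqP; split=> r /=; first by move=> gv; exists (dyadic_index n r).
  by move=> [i /= gi ri]; rewrite /dyadic_right ri.
by apply: bigcup_measurable => i _; exact: measurable_dyadic_index.
Qed.

Lemma dyadic_right_bounds n r : 0 <= r <= n%:R ->
  r < dyadic_right n r <= r + mesh n.
Proof.
move=> /andP[r0 rn]; have m0 := mesh_gt0 R n.
have mE : mesh n = (2 ^ n)%:R^-1 by rewrite /mesh exprVn natrX.
have /andP[H1 H2] := truncn_itv (divr_ge0 r0 (ltW m0)).
have -> : dyadic_right n r = (truncn (r / mesh n)).+1%:R * mesh n.
  rewrite /dyadic_right /dyadic_index (minn_idPl _)//.
  rewrite -(ler_nat R); apply: le_trans H1 _.
  by rewrite natrM mE invrK ler_wpM2r.
rewrite ltr_pdivrMr// in H2; rewrite ler_pdivlMr// in H1.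
by rewrite H2 -natr1 mulrDl mul1r lerD2r.
Qed.

Definition right_cont (g : R -> XR) := forall t e, 0 <= t -> 0 < e ->
  exists2 d, 0 < d & forall h, 0 <= h < d -> `|g (t + h) - g t| < e.

Lemma right_cont_dyadic (g : R -> X) t : right_cont g -> 0 <= t ->
  g (dyadic_right n t) @[n --> \oo] --> g t.
Proof.
move=> gr t0; apply/cvg_realify; apply/cvgrPdist_lt => e e0.
have [d d0 Hd] := gr t e t0 e0.
have [N _ HN] := cvgr_lt _ (@mesh_cvg0 R) _ d0.
exists (maxn N (truncn t).+1) => // n /=; rewrite geq_max => /andP[/HN /= md tn].
have tn' : 0 <= t <= n%:R.
  rewrite t0/=; apply: ltW; apply: lt_le_trans (truncnS_gt t) _.
  by rewrite ler_nat.
have /andP[H1 H2] := dyadic_right_bounds tn'.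
have := Hd (dyadic_right n t - t); rewrite subrKC distrC; apply.
by apply/andP; split; lra.
Qed.

Lemma right_cont_strongly_measurable (g : R -> X) (D : set R) : right_cont g ->
  (forall t, D t -> 0 <= t) -> strongly_measurable D g.
Proof.
move=> gr D0; exists (fun n r => g (dyadic_right n r)); first exact: simple_dyadic.
by move=> t /D0 t0; exact: right_cont_dyadic.
Qed.

Lemma itv_fin (a b : R) : (mu `[a, b]%classic < +oo)%E.
Proof. by rewrite lebesgue_measure_itv/=; case: ifP => _; rewrite -?EFinB ltry. Qed.

Lemma right_cont_dyadic_integral (g : R -> X) (C t : R) : right_cont g ->
  (forall s, 0 <= s -> `|g s : XR| <= C) ->
  (\int[mu]_(r in `[0%R, t]) (hnorm (g (dyadic_right n r) - g r))%:E)%E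
    @[n --> \oo] --> 0%E.
Proof.
move=> gr gC.
have mD : measurable (`[0, t]%classic : set T) by exact: measurable_itv.
have mg : strongly_measurable `[0, t] g.
  by apply: right_cont_strongly_measurable => // s /=; rewrite in_itv/= => /andP[].
pose f n (r : T) := (`|(g (dyadic_right n r) : XR) - g r|)%:E.
have C0 : 0 <= C := le_trans (normr_ge0 _) (gC 0 (lexx _)).
have := @dominated_cvg _ T R mu `[0, t]%classic mD f (fun=> 0%E) (fun=> (2 * C)%:E).
rewrite integral0; apply.
- move=> n; apply/measurable_EFinP; apply: measurable_fun_norm => //.
  by apply: strongly_measurableB => //; exact: simple_dyadic.
- move=> r /=; rewrite in_itv/= => /andP[r0 _].
  apply: cvg_EFin; first by apply: nearW => n.
  apply/norm_cvg0P.
  have /cvg_realify H := right_cont_dyadic gr r0.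
  rewrite -[X in _ --> X](subrr (g r : XR)).
  by apply: cvgB => //; exact: cvg_cst.
- by [].
- apply: (@bounded_integrable R `[0, t]%classic (cst (2 * C)) (2 * C)) => //.
  + exact: itv_fin.
  + by move=> r _ /=; rewrite ger0_norm// mulr_ge0.
- move=> n r /=; rewrite in_itv/= => /andP[r0 _].
  rewrite lee_fin normr_id (le_trans (ler_normB _ _))//.
  have q0 : 0 <= dyadic_right n r by rewrite mulr_ge0// ltW// mesh_gt0.
  by have := gC _ q0; have := gC _ r0; lra.
Qed.

End RightContinuous.

Section ScalarFTC.
Context (R : realType).
Local Notation mu := (@lebesgue_measure R).
Variables (gam : R -> R) (t : R).
Hypothesis gint : mu.-integrable `[0%R, t] (EFin \o gam).

Definition primitive (s : R) : R := \int[mu]_(r in `[0%R, s]) gam r.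

Lemma integrable_sub_itv (i : interval R) : {subset i <= `[0%R, t]} ->
  mu.-integrable [set` i] (EFin \o gam).
Proof.
by move=> it; apply: integrableS gint.
Qed.

Lemma primitive_increment a b : 0 <= a -> a <= b -> b <= t ->
  primitive b - primitive a = \int[mu]_(r in `]a, b]) gam r.
Proof.
move=> a0 ab bt; apply: Rintegral_itvB; rewrite ?bnd_simp//.
apply: integrable_sub_itv => r.
by rewrite !in_itv/= => /andP[-> rb]; rewrite (le_trans rb).
Qed.

Lemma itv_oc_measure (a b : R) : a <= b -> fine (mu `]a, b]%classic) = b - a.
Proof.
move=> ab; rewrite lebesgue_measure_itv/= lte_fin.
case: ltP => //= ba; have -> : a = b by apply/le_anti; rewrite ab ba.
by rewrite subrr.
Qed.

Lemma itv_oc_integrable a b : 0 <= a -> b <= t ->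
  mu.-integrable `]a, b] (EFin \o gam).
Proof.
move=> a0 bt; apply: integrable_sub_itv => r.
rewrite !in_itv/= => /andP[ar rb].
by rewrite (le_trans a0 (ltW ar)) (le_trans rb bt).
Qed.

Lemma itv_oc_cst_integrable a b (c : R) :
  mu.-integrable `]a, b] (EFin \o cst c).
Proof.
apply: (@bounded_integrable R `]a, b]%classic (cst c) `|c|) => //.
by rewrite lebesgue_measure_itv/=; case: ifP => _; rewrite -?EFinB ltry.
Qed.

Lemma primitive_increment_ge a b c : 0 <= a -> a <= b -> b <= t ->
  (forall r, a < r <= b -> c <= gam r) ->
  c * (b - a) <= primitive b - primitive a.
Proof.
move=> a0 ab bt cg; rewrite primitive_increment// -(itv_oc_measure ab).
rewrite -Rintegral_cst//; apply: le_Rintegral => //.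
- exact: itv_oc_cst_integrable.
- exact: itv_oc_integrable.
Qed.

Lemma primitive_increment_le a b c : 0 <= a -> a <= b -> b <= t ->
  (forall r, a < r <= b -> gam r <= c) ->
  primitive b - primitive a <= c * (b - a).
Proof.
move=> a0 ab bt cg; rewrite primitive_increment// -(itv_oc_measure ab).
rewrite -Rintegral_cst//; apply: le_Rintegral => //.
- exact: itv_oc_integrable.
- exact: itv_oc_cst_integrable.
Qed.

Lemma primitive0 : primitive 0 = 0.
Proof. by rewrite /primitive set_itv1 Rintegral_set1. Qed.

Lemma lipschitz_left_cvg (F : R -> R) (K s : R) : 0 < s ->
  (forall a b, 0 <= a -> a <= b -> b <= s -> `|F b - F a| <= K * (b - a)) ->
  F r @[r --> s^'-] --> F s.
Proof.
move=> s0 FK; apply/cvgrPdist_lt => e e0.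
have K1 : 0 < `|K| + 1 by rewrite ltr_wpDl.
near=> r; have rs : r <= s by near: r; exact: nbhs_left_le.
have r0 : 0 <= r by near: r; exact: nbhs_left_ge.
rewrite (le_lt_trans (FK _ _ r0 rs (lexx _)))//.
have H : s - r < e / (`|K| + 1).
  by near: r; apply: nbhs_left_ltBl; rewrite divr_gt0.
rewrite ltr_pdivlMr// in H.
have := ler_norm K; have : 0 <= s - r by rewrite subr_ge0.
by move=> H1 H2; nra.
Unshelve. all: by end_near. Qed.

(** Subtracting from f the primitive and a small linear term leaves a
    function that does not increase immediately after any time. The
    inequality suffices, as it applies to a function and to its opposite. *)
Lemma right_ftc_le (f : R -> R) (K : R) : 0 <= t ->
  (forall s, 0 <= s -> `|gam s| <= K) ->
  (forall s e, 0 <= s -> 0 < e -> exists2 d, 0 < d &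
     forall h, 0 <= h < d -> `|gam (s + h) - gam s| < e) ->
  (forall a b, 0 <= a -> a <= b -> `|f b - f a| <= K * (b - a)) ->
  (forall s e, 0 <= s -> 0 < e ->
     \forall h \near 0^'+, f (s + h) - f s <= h * (gam s + e)) ->
  f t - f 0 <= primitive t.
Proof.
move=> t0 gK gr fK fr; apply/ler_addgt0Pr => e' e'0.
pose e := e' / (2 * (t + 1)).
have t1 : 0 < t + 1 by rewrite ltr_wpDl.
have e0 : 0 < e by rewrite divr_gt0// mulr_gt0.
pose F s := f s - primitive s - 2 * e * s.
have : F t <= F 0.
  apply: right_nonincreasing => // [s /andP[s0 st]|s /andP[s0 st]].
    apply: (@lipschitz_left_cvg F (2 * K + 2 * e)) => // a b a0 ab bs.
    have bt := le_trans bs st.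
    have H1 := fK a b a0 ab.
    have H2 : `|primitive b - primitive a| <= K * (b - a).
      rewrite ler_norml; apply/andP; split.
        rewrite -mulNr; apply: primitive_increment_ge => // r /andP[ar _].
        have := gK r (le_trans a0 (ltW ar)); rewrite ler_norml => /andP[]; lra.
      apply: primitive_increment_le => // r /andP[ar _].
      exact: le_trans (ler_norm _) (gK r (le_trans a0 (ltW ar))).
    have -> : F b - F a = (f b - f a) - (primitive b - primitive a)
        - 2 * e * (b - a) by rewrite /F; ring.
    rewrite (le_trans (ler_normB _ _))//.
    have -> : (2 * K + 2 * e) * (b - a) = K * (b - a) + K * (b - a)
       + 2 * e * (b - a) by ring.
    rewrite lerD//; first by rewrite (le_trans (ler_normB _ _))// lerD.
    rewrite ger0_norm// mulr_ge0 ?subr_ge0//.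
    by rewrite mulr_ge0// ltW.
  have [d d0 Hd] := gr s e s0 e0.
  near=> h.
  have h0 : 0 < h by near: h; exact: nbhs_right_gt.
  have hd : h < d by near: h; exact: nbhs_right_lt.
  have ht : h <= t - s.
    by near: h; apply: nbhs_right_le; rewrite subr_gt0.
  have H1 : f (s + h) - f s <= h * (gam s + e) by near: h; exact: fr.
  have H2 : (gam s - e) * (s + h - s) <= primitive (s + h) - primitive s.
    apply: primitive_increment_ge => //; rewrite ?lerDl ?(ltW h0)//; first by lra.
    move=> r /andP[sr rh]; have := Hd (r - s); rewrite subrKC.
    have -> : 0 <= r - s < d by apply/andP; split; lra.
    by move=> /(_ isT); rewrite ltr_norml => /andP[]; lra.
  rewrite /F; nra.
rewrite /F primitive0 => H.
have : 2 * e * t <= e'.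
  have -> : 2 * e * t = e' * (t / (t + 1)) by rewrite /e; field; rewrite gt_eqF.
  by rewrite ler_piMr ?(ltW e'0)// ler_pdivrMr// mul1r lerDl.
by lra.
Unshelve. all: by end_near. Qed.

End ScalarFTC.

Section RightDerivative.
Context (R : realType) (X : hilbertType R).
Local Notation XR := (realify X).
Local Notation mu := (@lebesgue_measure R).
Local Notation T := (measurableTypeR R).
Variables (x g : R -> XR) (C : R).
Hypothesis gr : right_cont g.
Hypothesis gC : forall s, 0 <= s -> `|g s| <= C.
Hypothesis xC : forall a b, 0 <= a -> a <= b -> `|x b - x a| <= C * (b - a).
Hypothesis xg : forall s e, 0 <= s -> 0 < e ->
  \forall h \near 0^'+, `|x (s + h) - x s - h *: g s| <= h * e.

Lemma right_derivative_integrable t :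
  mu.-integrable `[0%R, t] (fun r : T => (`|g r|)%:E).
Proof.
apply: (@bounded_integrable R `[0, t]%classic _ C) => //.
- exact: itv_fin.
- apply: measurable_fun_norm => //.
  by apply: right_cont_strongly_measurable => // s /=; rewrite in_itv/= => /andP[].
- by move=> r /=; rewrite in_itv/= normr_id => /andP[r0 _]; exact: gC.
Qed.

Lemma right_derivative_rdot_le t (v : XR) : 0 <= t ->
  rdot (x t - x 0) v <= \int[mu]_(r in `[0%R, t]) rdot (g r) v.
Proof.
move=> t0; rewrite rdotDl rdotNl.
have C0 : 0 <= C := le_trans (normr_ge0 _) (gC (lexx _)).
apply: (@right_ftc_le _ (fun r => rdot (g r) v) t _ (fun r => rdot (x r) v)
  (C * `|v|)) => //.
- apply: (@integrable_rdot _ _ `[0%R, t]%classic (g : R -> X)) => //.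
    by apply: right_cont_strongly_measurable => // s /=; rewrite in_itv/= => /andP[].
  exact: right_derivative_integrable.
- by move=> s s0; rewrite (le_trans (rdot_norm_le _ _))// ler_wpM2r// gC.
- move=> s e s0 e0; have v1 : 0 < `|v| + 1 by rewrite ltr_wpDl.
  have [d d0 Hd] := gr s0 (divr_gt0 e0 v1).
  exists d => // h /Hd; rewrite ltr_pdivlMr// -rdotNl -rdotDl => H.
  rewrite (le_lt_trans (rdot_norm_le _ _))// (le_lt_trans _ H)//.
  by rewrite ler_wpM2l// lerDl.
- move=> a b a0 ab; rewrite -rdotNl -rdotDl (le_trans (rdot_norm_le _ _))//.
  by rewrite mulrAC ler_wpM2r// xC.
- move=> s e s0 e0; have v1 : 0 < `|v| + 1 by rewrite ltr_wpDl.
  apply: filterS (xg s0 (divr_gt0 e0 v1)) => h.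
  have -> : rdot (x (s + h)) v - rdot (x s) v =
     rdot (x (s + h) - x s - h *: g s) v + h * rdot (g s) v.
    by rewrite !rdotE; ring.
  rewrite mulrA ler_pdivlMr// => H.
  have := rdot_le (x (s + h) - x s - h *: g s) v.
  by have := normr_ge0 (x (s + h) - x s - h *: g s); nra.
Qed.

Lemma right_derivative_rdot t (v : XR) : 0 <= t ->
  \int[mu]_(r in `[0%R, t]) rdot (g r) v = rdot (x t - x 0) v.
Proof.
move=> t0; apply/le_anti; rewrite right_derivative_rdot_le// andbT.
have := right_derivative_rdot_le (- v) t0; rewrite rdotNr lerNl.
suff -> : \int[mu]_(r in `[0%R, t]) rdot (g r) (- v) =
    - \int[mu]_(r in `[0%R, t]) rdot (g r) v by rewrite opprK.
under eq_Rintegral do rewrite rdotNr -mulN1r.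
rewrite RintegralZl// ?mulN1r//.
apply: (@integrable_rdot _ _ `[0%R, t]%classic (g : R -> X)) => //.
  by apply: right_cont_strongly_measurable => // s /=; rewrite in_itv/= => /andP[].
exact: right_derivative_integrable.
Qed.

(** Scalar pairings satisfy the fundamental theorem, and they determine the
    Bochner integral. *)
Lemma right_derivative_H1loc : H1loc_with_derivative (x : R -> X) (g : R -> X).
Proof.
have mg t : strongly_measurable `[0%R, t] (g : R -> X).
  by apply: right_cont_strongly_measurable => // s /=; rewrite in_itv/= => /andP[].
move=> tau tau0; split.
  split; first exact: mg.
  have : mu.-integrable `[0%R, tau] (fun r : T => (`|g r| ^+ 2)%:E).
    apply: (@bounded_integrable R `[0, tau]%classic _ (C ^+ 2)) => //; first exact: itv_fin.
      apply: measurable_funX; exact: measurable_fun_norm (mg tau).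
    move=> r /=; rewrite in_itv/= => /andP[r0 _].
    by rewrite ger0_norm// lerXn2r ?nnegrE ?gC// (le_trans _ (gC r0)).
  move=> /integrableP[_]; apply: le_lt_trans; rewrite le_eqVlt; apply/orP; left.
  by apply/eqP; apply: eq_integral => r _ /=; rewrite ger0_norm.
move=> t /andP[t0 _].
apply: (@is_bochner_of_rdot _ _ _ (fun n r => g (dyadic_right n r))) => //.
- exact: itv_fin.
- by move=> n; exact: simple_dyadic.
- exact: right_cont_dyadic_integral gr gC.
- by move=> v; exact: right_derivative_rdot.
Qed.

End RightDerivative.

(** * Weak solutions of a dissipative equation do not move apart *)

Section WeakContraction.
Context (R : realType) (X : hilbertType R).
Local Notation XR := (realify X).
Local Notation mu := (@lebesgue_measure R).
Local Notation T := (measurableTypeR R).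
Variables (x y dx dy : R -> XR) (tau : R).
Hypothesis tau0 : 0 < tau.
Hypothesis Hx : H1_with_derivative tau (x : R -> X) (dx : R -> X).
Hypothesis Hy : H1_with_derivative tau (y : R -> X) (dy : R -> X).
Hypothesis Hd : {ae mu, forall t, 0 <= t ->
  rdot (dx t - dy t) (x t - y t) <= 0}.

Let d s := x s - y s.
Let G s := `|dx s| + `|dy s|.
Let gam (v : XR) s := rdot (dx s - dy s) v.

Let tau_itv : 0 <= tau <= tau. Proof. by rewrite lexx ltW. Qed.

Let Gint : mu.-integrable `[0%R, tau] (EFin \o G).
Proof.
have mD : measurable (`[0, tau]%classic : set T) by exact: measurable_itv.
have [ix _] := bochner_integral_rdot 0 mD (itv_fin _ _) (Hx.2 _ tau_itv).
have [iy _] := bochner_integral_rdot 0 mD (itv_fin _ _) (Hy.2 _ tau_itv).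
exact: (integrableD mD ix iy).
Qed.

(* Phi dominates the variation of x - y. *)
Let Phi := primitive G.

Let gamE v s : gam v s = rdot (dx s) v - rdot (dy s) v.
Proof. by rewrite /gam rdotDl rdotNl. Qed.

Let weak_derivative (z dz : R -> XR) v s :
  H1_with_derivative tau (z : R -> X) (dz : R -> X) -> 0 <= s <= tau ->
  mu.-integrable `[0%R, s] (EFin \o (fun r => rdot (dz r) v)) /\
  \int[mu]_(r in `[0%R, s]) rdot (dz r) v = rdot (z s - z 0) v.
Proof.
move=> [_ Hz] s0; have mD : measurable (`[0, s]%classic : set T).
  exact: measurable_itv.
have [iz ez] := bochner_integral_rdot v mD (itv_fin _ _) (Hz _ s0).
split=> //; apply: (@integrable_rdot _ _ `[0%R, s]%classic (dz : R -> X)) => //.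
exact: (Hz _ s0).1.
Qed.

Let gam_int v : mu.-integrable `[0%R, tau] (EFin \o gam v).
Proof.
have [ix _] := weak_derivative v Hx tau_itv.
have [iy _] := weak_derivative v Hy tau_itv.
have mD : measurable (`[0, tau]%classic : set T) by exact: measurable_itv.
have -> : gam v = fun s => rdot (dx s) v - rdot (dy s) v.
  by apply/funext => s; exact: gamE.
exact: (integrableB mD ix iy).
Qed.

Let gam_prim v s : 0 <= s <= tau -> primitive (gam v) s = rdot (d s - d 0) v.
Proof.
move=> st; have [ix ex] := weak_derivative v Hx st.
have [iy ey] := weak_derivative v Hy st.
rewrite /primitive; under eq_Rintegral do rewrite gamE.
by rewrite RintegralB ?ex ?ey// /d !rdotE; ring.
Qed.

Let increment_rdot v a b : 0 <= a -> a <= b -> b <= tau ->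
  rdot (d b - d a) v = \int[mu]_(r in `]a, b]) gam v r.
Proof.
move=> a0 ab bt; rewrite -(primitive_increment (gam_int v))//.
rewrite !gam_prim ?a0 ?(le_trans a0 ab) ?(le_trans ab bt)//.
by rewrite !rdotE; ring.
Qed.

Let G0 s : 0 <= G s. Proof. by rewrite addr_ge0. Qed.

Let gamG v s : gam v s <= G s * `|v|.
Proof.
rewrite (le_trans (rdot_le _ _))// ler_wpM2r//.
exact: ler_normB.
Qed.

Let Phi_mono a b : 0 <= a -> a <= b -> b <= tau -> Phi a <= Phi b.
Proof.
move=> a0 ab bt; rewrite -subr_ge0 (primitive_increment Gint)//.
by apply: Rintegral_ge0 => r _.
Qed.

Let oc_int f a b : mu.-integrable `[0%R, tau] (EFin \o f) -> 0 <= a ->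
  b <= tau -> mu.-integrable `]a, b] (EFin \o f).
Proof. by move=> fi a0 bt; exact: (itv_oc_integrable fi). Qed.

Let Gscale_int a b c : 0 <= a -> b <= tau ->
  mu.-integrable `]a, b] (EFin \o (fun r => G r * c)).
Proof.
move=> a0 bt; have mD : measurable (`]a, b]%classic : set T).
  exact: measurable_itv.
exact: (integrableZr mD c (oc_int Gint a0 bt)).
Qed.

Let Gscale a b c : 0 <= a -> a <= b -> b <= tau ->
  \int[mu]_(r in `]a, b]) (G r * c) = (Phi b - Phi a) * c.
Proof.
move=> a0 ab bt; rewrite RintegralZr//; last exact: oc_int.
by rewrite (primitive_increment Gint).
Qed.

Let d_increment a b : 0 <= a -> a <= b -> b <= tau ->
  `|d b - d a| <= Phi b - Phi a.
Proof.
move=> a0 ab bt; have [->|ne] := eqVneq (d b - d a) 0.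
  by rewrite normr0 subr_ge0 Phi_mono.
have n0 : 0 < `|d b - d a| by rewrite normr_gt0.
rewrite -(ler_pM2r n0) -expr2 -rdotxx increment_rdot// -Gscale//.
apply: le_Rintegral => //; first exact: oc_int.
exact: Gscale_int.
Qed.

(** At the endpoint b the pairing of the derivative with d b differs from
    the pairing with d r, which is nonpositive, by at most the variation of
    d over ]a, b]; hence the increment is of second order in the increment
    of Phi. *)
Let sqr_increment a b : 0 <= a -> a <= b -> b <= tau ->
  `|d b| ^+ 2 - `|d a| ^+ 2 <= 2 * (Phi b - Phi a) ^+ 2.
Proof.
move=> a0 ab bt.
have H1 : rdot (d b - d a) (d b) <= (Phi b - Phi a) * (Phi b - Phi a).
  rewrite increment_rdot// -Gscale//; apply: ae_le_Rintegral => //.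
  - exact: oc_int.
  - exact: Gscale_int.
  - apply: (@filterS _ _ (ae_filter_ringOfSetsType mu) _ _ _ Hd) => r Hr /=.
    rewrite in_itv/= => /andP[ar rb].
    have r0 : 0 <= r := le_trans a0 (ltW ar).
    have -> : gam (d b) r = rdot (dx r - dy r) (d r) + gam (d b - d r) r.
      by rewrite /gam !rdotE; ring.
    have H2 : gam (d b - d r) r <= G r * (Phi b - Phi a).
      rewrite (le_trans (gamG _ _))// ler_wpM2l//.
      rewrite (le_trans (d_increment r0 rb bt))// lerD2l lerN2.
      by rewrite Phi_mono ?(ltW ar) ?(le_trans rb bt).
    by have := Hr r0; rewrite -/(d r); lra.
have := normB2 (d b) (d b - d a); rewrite subKr => ->.
have := sqr_ge0 `|d b - d a|; rewrite (rdotC (d b)) expr2 in H1 *; nra.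
Qed.

Let Phi_cont : {within `[0, tau], continuous Phi}.
Proof. exact: (parameterized_integral_continuous (ltW tau0) Gint). Qed.

Let Phi_left s : 0 < s <= tau -> Phi r @[r --> s^'-] --> Phi s.
Proof.
move=> /andP[s0]; have [H1 H2 H3] := (continuous_within_itvP _ tau0).1 Phi_cont.
rewrite le_eqVlt => /predU1P[->//|st].
by apply: cvg_at_left_filter; apply: H1; rewrite in_itv/= s0.
Qed.

Let Phi_right s : 0 <= s < tau -> Phi r @[r --> s^'+] --> Phi s.
Proof.
have [H1 H2 H3] := (continuous_within_itvP _ tau0).1 Phi_cont.
rewrite le_eqVlt => /andP[/predU1P[<-//|s0] st].
by apply: cvg_at_right_filter; apply: H1; rewrite in_itv/= s0.
Qed.

Let d_left s : 0 < s <= tau -> d r @[r --> s^'-] --> d s.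
Proof.
move=> /[dup] sP /andP[s0 st]; apply/cvgrPdist_lt => e e0.
have /cvgrPdist_lt/(_ _ e0) HP := Phi_left sP.
near=> r; have rs : r <= s by near: r; exact: nbhs_left_le.
have r0 : 0 <= r by near: r; exact: nbhs_left_ge.
rewrite (le_lt_trans (d_increment r0 rs st))// (le_lt_trans (ler_norm _))//.
by near: r; exact: HP.
Unshelve. all: by end_near. Qed.

(** Since the increments of |x - y|^2 are of second order in those of the
    continuous function Phi, the function |x - y|^2 - 2 e Phi does not
    increase immediately after any time, for every e > 0. Derivatives are
    thus only used under integrals. *)
Lemma weak_contraction : `|x tau - y tau| <= `|x 0 - y 0|.
Proof.
rewrite -/(d tau) -/(d 0) -(@ler_pXn2r _ 2)// ?nnegrE//.
apply/ler_addgt0Pr => e' e'0.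
have P0 : 0 <= Phi tau.
  have := Phi_mono (lexx 0) (ltW tau0) (lexx _).
  by rewrite {1}/Phi primitive0.
pose e := e' / (2 * (Phi tau + 1)).
have P1 : 0 < Phi tau + 1 by rewrite ltr_wpDl.
have e0 : 0 < e by rewrite divr_gt0// mulr_gt0.
pose F s := `|d s| ^+ 2 - 2 * e * Phi s.
have : F tau <= F 0.
  apply: right_nonincreasing => [|s sP|s /[dup] sP /andP[s0 st]].
  - exact: ltW.
  - apply: cvgB; last by apply: cvgMl_tmp; exact: Phi_left.
    by apply: cvgM; apply: cvg_norm; exact: d_left.
  - have /cvgr_lt/(_ (Phi s + e)) := Phi_right sP.
    rewrite ltrDl => /(_ e0)/nbhs_right0P H.
    near=> h; have h0 : 0 < h by near: h; exact: nbhs_right_gt.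
    have ht : h <= tau - s by near: h; apply: nbhs_right_le; rewrite subr_gt0.
    have sh : s <= s + h by rewrite lerDl ltW.
    have sht : s + h <= tau by lra.
    have H1 : Phi (s + h) < Phi s + e by near: h.
    have H2 := sqr_increment s0 sh sht.
    have H3 := Phi_mono s0 sh sht.
    rewrite /F expr2 in H2 *; nra.
rewrite /F {2}/Phi primitive0 => H.
have : 2 * e * Phi tau <= e'.
  have -> : 2 * e * Phi tau = e' * (Phi tau / (Phi tau + 1)).
    by rewrite /e; field; rewrite gt_eqF.
  by rewrite ler_piMr ?(ltW e'0)// ler_pdivrMr// mul1r lerDl.
by lra.
Unshelve. all: by end_near. Qed.

End WeakContraction.

(** * Consequences of uniform boundedness *)

Section UniformBoundedness.
Context (R : realType) (V : realHilbertType R).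

(** The functionals rdot (P u) with |u| <= 1 are bounded by |Q w| at each w,
    hence uniformly bounded. *)
Lemma adjointable_bounded (W : realHilbertType R) (P : V -> W) (Q : W -> V) :
  (forall a u, P (a *: u) = a *: P u) ->
  (forall u w, rdot (P u) w = rdot u (Q w)) ->
  exists2 M, 0 < M & forall u, `|P u| <= M * `|u|.
Proof.
move=> Pa PQ.
pose F : set (W -> R^o) :=
  [set (fun w => rdot (P u) w : R^o) | u in [set u : V | `|u| <= 1]].
have [f [u u1 <-]|w|M HM] := @Banach_Steinhauss R W R^o F _ _ 1.
- split.
    move=> r; exists (`|P u| * r) => w wr.
    rewrite (_ : `|_| = Num.norm (rdot (P u) w))// ler_norml.
    by rewrite lerNl -rdotNl !(le_trans (rdot_le _ _))// ?normrN ler_wpM2l.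
  by move=> a w w'; rewrite rdotDr rdotZr.
- exists `|Q w| => f [u /= u1 <-]; rewrite PQ.
  rewrite (_ : `|_| = Num.norm (rdot u (Q w)))// ler_norml.
  rewrite lerNl -rdotNl !(le_trans (rdot_le _ _))// ?normrN;
    by rewrite ler_piMl.
have M0 : 0 < `|M| + 1 by rewrite ltr_wpDl.
have P1 u : `|u| <= 1 -> `|P u| <= `|M| + 1.
  move=> u1; have [->|Pu0] := eqVneq (P u) 0; first by rewrite normr0 ltW.
  have n0 : 0 < `|P u| by rewrite normr_gt0.
  have /(_ (`|P u|^-1 *: P u)) := HM _ (ex_intro2 _ _ u u1 erefl).
  rewrite normrZ ger0_norm ?invr_ge0// mulVf ?gt_eqF// => /(_ (lexx _)).
  rewrite rdotZr rdotxx expr2 mulKf ?gt_eqF// => H.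
  rewrite (le_trans (ler_norm _))// (le_trans H)// (le_trans (ler_norm _))//.
  by rewrite lerDl.
exists (`|M| + 1) => // u; have [->|u0] := eqVneq u 0.
  have -> : P 0 = 0 by rewrite -(scale0r (0 : V)) Pa scale0r.
  by rewrite !normr0 mulr0.
have n0 : 0 < `|u| by rewrite normr_gt0.
have := P1 (`|u|^-1 *: u).
rewrite Pa !normrZ ger0_norm ?invr_ge0// mulVf ?gt_eqF// => /(_ (lexx _)).
by rewrite mulrC ler_pdivrMr.
Qed.

End UniformBoundedness.

(** * Impedance passive system nodes *)

Section NodeAlgebra.
Context (R : realType) (U X : hilbertType R) (S : system_node U X U).
Implicit Types (x : X) (u v : U).

Lemma node_lin (a : R[i]) x u x' u' : dom S (x, u) -> dom S (x', u') ->
  dom S (a *: x + x', a *: u + u') /\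
  S (a *: x + x', a *: u + u') = a *: S (x, u) + S (x', u').
Proof. by move=> d d'; exact: ((node_linear S).2 a (x, u) (x', u') d d'). Qed.

Lemma nodeB x u x' u' : dom S (x, u) -> dom S (x', u') ->
  dom S (x - x', u - u') /\ S (x - x', u - u') = S (x, u) - S (x', u').
Proof.
move=> d d'; have := node_lin (- 1) d' d.
by rewrite !scaleN1r ![- _ + _]addrC.
Qed.

Lemma res0_inj x : res0 S x = 0 -> x = 0.
Proof.
have [_ H _] := res0P S; have [d e] := H x => r0.
have := nodeB d d; rewrite -e r0 /main_op /= !subrr => -[_ ->].
by rewrite scaler0; exact: subrr.
Qed.

Lemma emb_inj : injective (emb S).
Proof.
move=> x y e; apply/eqP; rewrite -subr_eq0; apply/eqP/res0_inj/normr0_eq0.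
by rewrite -emb_norm linearB e subrr normr0.
Qed.

Lemma unemb_emb x : unemb (emb S x) = x.
Proof. apply: emb_inj; apply: (@getPex _ [set y | emb S y = emb S x]).
by exists x. Qed.

Lemma emb_continuous : continuous (emb S).
Proof.
move=> x; apply/cvgrPdist_lt => e e0.
have [rc _ _] := res0P S; have /cvgrPdist_lt/(_ e e0) := rc x.
by apply: filterS => y; rewrite -!linearB emb_norm.
Qed.

(** On its domain, lam0 - A is an isometry onto the dense subspace X of the
    extrapolation space; by completeness of X its extension is onto. *)
Lemma res_lam0_onto (z : Xm1 S) : exists x, lam0 S *: emb S x - Aext S x = z.
Proof.
have [rc rd _] := res0P S.
have zn (n : nat) : exists x, `|emb S x - z| < n.+1%:R^-1.
  have n0 : 0 < n.+1%:R^-1 :> R[i] by rewrite invr_gt0.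
  have [y [zb [x _ xy]]] := emb_dense (O := ball z n.+1%:R^-1)
    (ex_intro _ z (ballxx _ n0)) (ball_open _ _).
  by exists x; move: zb; rewrite -xy -ball_normE /= distrC.
have [x xz] := choice zn; pose p n := res0 S (x n).
have small (e : R[i]) : 0 < e -> exists N, forall n, (N <= n)%N -> n.+1%:R^-1 < e.
  move=> e0; have eR : e = (complex.Re e)%:C by rewrite RRe_real// gtr0_real.
  have e1 : 0 < complex.Re e by rewrite -ltcR -eR.
  have [N _ HN] := near_infty_natSinv_lt (PosNum e1); exists N => n /HN /= H.
  rewrite eR (_ : n.+1%:R^-1 = (n.+1%:R^-1)%:C) ?ltcR//.
  by rewrite fmorphV rmorph_nat.
have xz0 : emb S (x n) @[n --> \oo] --> z.
  apply/cvgrPdist_lt => e /small [N HN]; exists N => // n /HN H.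
  by rewrite distrC (lt_trans (xz n)).
have pc : cvgn p.
  apply/cauchy_cvgP/cauchy_exP => e e0; have e2 : 0 < e / 2 by rewrite divr_gt0.
  have [N HN] := small _ e2; exists (p N); exists N => // n Nn.
  rewrite -ball_normE /= /p -linearB -emb_norm linearB.
  rewrite -(subrKA z) (le_lt_trans (ler_normD _ _))// (splitr e) ltrD//.
    by rewrite (lt_trans (xz N))// HN.
  by rewrite distrC (lt_trans (xz n))// HN.
exists (limn p).
have e1 : lam0 S *: emb S (p n) - Aext S (p n) @[n --> \oo] -->
    lam0 S *: emb S (limn p) - Aext S (limn p).
  apply: cvgB; last by apply: continuous_cvg => //; exact: Aext_continuous.
  apply: cvgZ; first exact: cvg_cst.
  by apply: continuous_cvg => //; exact: emb_continuous.
suff e2 : lam0 S *: emb S (p n) - Aext S (p n) @[n --> \oo] --> z.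
  exact: cvg_unique e1 e2.
rewrite (_ : (fun n => _) = (fun n => emb S (x n)))//.
apply/funext => n; have [d e] := rd (x n).
by rewrite (AextE d) -linearZ -linearB /= e.
Qed.

Section Resolvent.
Variables (lam : R) (Rl : {linear X -> X}).
Hypothesis RlP : is_resolvent (main_op S) lam%:C Rl.

Local Notation e u := (res_ext lam%:C (Bop S u)).
Local Notation P := (transfer S lam%:C).

(** The resolvent identity transports surjectivity from lam0 to lam. *)
Lemma res_extP (z : Xm1 S) :
  lam%:C *: emb S (res_ext lam%:C z) - Aext S (res_ext lam%:C z) = z.
Proof.
suff : exists x, lam%:C *: emb S x - Aext S x = z by move/getPex.
have [_ rd _] := RlP; have [p ep] := res_lam0_onto z.
have [d ed] := rd p.
exists (p + (lam0 S - lam%:C) *: Rl p).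
set c := lam0 S - lam%:C.
have -> : emb S (p + c *: Rl p) = emb S p + c *: emb S (Rl p).
  by rewrite linearD linearZ.
have -> : Aext S (p + c *: Rl p) = Aext S p + c *: Aext S (Rl p).
  by rewrite linearD linearZ.
have edE : lam%:C *: emb S (Rl p) - Aext S (Rl p) = emb S p.
  by rewrite -[in RHS]ed linearB linearZ (AextE d).
rewrite scalerDr opprD addrACA scalerA mulrC -scalerA -scalerBr edE.
by rewrite -ep /c scalerBl addrC subrKA.
Qed.

Lemma node_res_ext u : dom S (e u, u) /\ (S (e u, u)).1 = lam%:C *: (e u).
Proof.
have H : Aext S (e u) + Bop S u = emb S (lam%:C *: e u).
  by rewrite -[X in _ + X](res_extP (Bop S u)) addrC subrK linearZ.
have d : dom S (e u, u) by apply/node_domE; rewrite H; eexists.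
by split=> //; apply: emb_inj; rewrite -H; exact: ABE.
Qed.

Lemma node_transfer u : (S (e u, u)).2 = P u. Proof. by []. Qed.

Lemma node_res f : dom S (Rl f, 0) /\ (S (Rl f, 0)).1 = lam%:C *: Rl f - f.
Proof.
have [_ rd _] := RlP; have [d ed] := rd f; split=> //.
by rewrite -[X in _ - X]ed /= subKr.
Qed.

Lemma node_eigen0 x : dom S (x, 0) -> (S (x, 0)).1 = lam%:C *: x -> x = 0.
Proof.
move=> d ex; have [_ _ ri] := RlP.
by rewrite -(ri x d) /main_op /= ex subrr linear0.
Qed.

(** The operator C (lam - A)^-1. *)
Definition res_output f : U := (S (Rl f, 0)).2.

(** The point splits into a free part, which carries f, and a part driven by
    the input u. *)
Lemma node_resolve f u :
  dom S (Rl f + e u, u) /\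
  S (Rl f + e u, u) = (lam%:C *: (Rl f + e u) - f, res_output f + P u).
Proof.
have [d1 e1] := node_res f; have [d2 e2] := node_res_ext u.
have [d3 e3] := node_lin 1 d1 d2; rewrite !scale1r add0r in d3 e3.
split=> //; rewrite e3 [LHS]surjective_pairing /= e1 e2 node_transfer.
by rewrite scalerDr addrAC.
Qed.

(** The difference with the point built from f and u has input 0, and lam is
    not an eigenvalue of A. *)
Lemma node_decompose x u : dom S (x, u) ->
  x = Rl (lam%:C *: x - (S (x, u)).1) + e u /\
  (S (x, u)).2 = res_output (lam%:C *: x - (S (x, u)).1) + P u.
Proof.
move=> d; set f := _ - _.
have [d1 e1] := node_resolve f u; have [d2 e2] := nodeB d d1.
rewrite subrr in d2 e2.
have x0 : x - (Rl f + e u) = 0.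
  apply: node_eigen0 d2 _; rewrite e2 e1 /= /f.
  by rewrite opprB addrA subrKC scalerBr.
have xE : x = Rl f + e u by apply/eqP; rewrite -subr_eq0 x0.
by split=> //; rewrite {1}xE e1.
Qed.

Lemma res_ext_lin (a : R[i]) u v : e (a *: u + v) = a *: e u + e v.
Proof.
have [d1 e1] := node_res_ext u; have [d2 e2] := node_res_ext v.
have [d3 e3] := node_res_ext (a *: u + v); have [d4 e4] := node_lin a d1 d2.
have [d5 e5] := nodeB d3 d4; rewrite subrr in d5 e5.
apply/eqP; rewrite -subr_eq0; apply/eqP/node_eigen0 => //.
by rewrite e5 e4 /= e3 e1 e2 scalerBr scalerDr !scalerA mulrC.
Qed.

Lemma transfer_lin (a : R[i]) u v : P (a *: u + v) = a *: P u + P v.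
Proof.
have [d1 _] := node_res_ext u; have [d2 _] := node_res_ext v.
have [_ e4] := node_lin a d1 d2.
by rewrite -node_transfer res_ext_lin e4.
Qed.

End Resolvent.
End NodeAlgebra.

Section PassiveNode.
Context (R : realType) (U X : hilbertType R) (S : system_node U X U).
Local Notation XR := (realify X).
Local Notation UR := (realify U).
Implicit Types (x : X) (u v : U).
Hypothesis S_passive : impedance_passive S.

Lemma passive_rdot x u : dom S (x, u) ->
  rdot ((S (x, u)).1 : XR) x <= rdot ((S (x, u)).2 : UR) u.
Proof. exact: S_passive. Qed.

Section Transfer.
Variables (lam c_lam : R) (Rl : {linear X -> X}) (Padj : U -> U).
Hypotheses (lam_gt0 : 0 < lam) (c_lam_gt0 : 0 < c_lam).
Hypothesis RlP : is_resolvent (main_op S) lam%:C Rl.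
Hypothesis PadjP : adjoint_of (transfer S lam%:C) Padj.
Hypothesis P_coercive : forall u,
  c_lam%:C * inner u u <= inner (transfer S lam%:C u + Padj u) u.

Local Notation e u := (res_ext lam%:C (Bop S u)).
Local Notation P := (transfer S lam%:C : UR -> UR).

Lemma transfer_adjoint (u v : UR) : rdot (P u) v = rdot u (Padj v : UR).
Proof. by rewrite !realify_rdotE PadjP. Qed.

Lemma transfer_coercive (u : UR) : c_lam / 2 * `|u| ^+ 2 <= rdot (P u) u.
Proof.
have := P_coercive u; rewrite lecE => /andP[_].
have -> : complex.Re (c_lam%:C * inner u u) = c_lam * `|u| ^+ 2.
  by rewrite -rdotxx realify_rdotE; case: (inner u u) => a b /=; rewrite mul0r subr0.
have -> : complex.Re (inner (transfer S lam%:C u + Padj u) u) = 2 * rdot (P u) u.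
  rewrite -[LHS]/(rdot ((P u : UR) + (Padj u : UR)) u) rdotDl.
  by rewrite (rdotC (Padj u : UR)) -transfer_adjoint; ring.
by lra.
Qed.

Lemma transferZ (a : R) (u : UR) : P (a *: u) = a *: P u.
Proof.
have := transfer_lin RlP a%:C u 0; rewrite addr0 => ->.
suff -> : transfer S lam%:C 0 = 0 by rewrite addr0.
by have := transfer_lin RlP 1 0 0; rewrite scale1r addr0 scale1r => /eqP;
  rewrite -subr_eq0 opprD addrA subrr sub0r oppr_eq0 => /eqP.
Qed.

Lemma transferB (u v : UR) : P (u - v) = P u - P v.
Proof.
have := transfer_lin RlP (- 1) v u; rewrite !scaleN1r => E.
by rewrite -[LHS]/(transfer S lam%:C (u - v : U)) addrC E addrC.
Qed.

Lemma transferD (u v : UR) : P (u + v) = P u + P v.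
Proof. by have := transfer_lin RlP 1 u v; rewrite !scale1r. Qed.

Lemma transfer_bounded : exists2 M, 0 < M & forall u, `|P u| <= M * `|u : UR|.
Proof.
by apply: (@adjointable_bounded R UR UR P Padj); [exact: transferZ |
  exact: transfer_adjoint].
Qed.

Lemma transfer_strongly_monotone : strongly_monotone (c_lam / 2) P.
Proof. by move=> u v; rewrite -transferB; exact: transfer_coercive. Qed.

Lemma transfer_locally_lip : locally_lip P.
Proof.
have [M M0 PM] := transfer_bounded; move=> u0; exists 1, M; split=> // u v _ _.
by rewrite -transferB; exact: PM.
Qed.

(** Passivity at (e u, u), where A&B takes the value lam e u, says that lam
    |e u|^2 is at most the real part of the pairing of P u with u. *)
Lemma res_ext_bounded (M : R) : 0 < M ->
  (forall u, `|P u| <= M * `|u : UR|) ->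
  forall u, `|e u : XR| ^+ 2 <= M / lam * `|u : UR| ^+ 2.
Proof.
move=> M0 PM u; have [d eq] := node_res_ext RlP u.
have := passive_rdot d; rewrite eq.
rewrite -[(lam%:C *: e u : XR)]/(lam *: (e u : XR)) rdotZl rdotxx => H.
rewrite -(ler_pM2l lam_gt0) (le_trans H)// (le_trans (rdot_le _ _))//.
rewrite mulrA [lam * _]mulrC divfK ?gt_eqF// expr2 mulrA ler_wpM2r//.
exact: PM.
Qed.

(** Testing passivity on the sum of a free state and a driven one bounds the
    output of the free state. *)
Lemma res_output_bounded (F : R) : exists K, forall f : X,
  `|f : XR| <= F -> `|res_output S Rl f : UR| <= K.
Proof.
have [M M0 PM] := transfer_bounded.
pose E := 1 + M / lam.
have E0 : 0 < E by rewrite addr_gt0// divr_gt0.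
exists (M + (2 * `|F| + lam * E) * (`|F| / lam + E)) => f fF.
have F0 : `|f : XR| <= `|F| := le_trans fF (ler_norm F).
have K0 : 0 <= M + (2 * `|F| + lam * E) * (`|F| / lam + E).
  by rewrite addr_ge0 ?(ltW M0)// mulr_ge0// addr_ge0 ?divr_ge0 ?mulr_ge0 ?(ltW E0)// ltW.
set c := res_output S Rl f.
have [->|c0] := eqVneq (c : UR) 0; first by rewrite normr0.
have n0 : 0 < `|c : UR| by rewrite normr_gt0.
pose u : UR := - (`|c : UR|^-1 *: (c : UR)).
have u1 : `|u| = 1.
  by rewrite normrN normrZ ger0_norm ?invr_ge0// mulVf ?gt_eqF.
have eE : `|e u : XR| <= E.
  have := res_ext_bounded M0 PM u; rewrite u1 expr1n mulr1 => H.
  have : 0 <= M / lam by rewrite divr_ge0// ltW.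
  rewrite /E; have := normr_ge0 (e u : XR); set a := `|e u : XR| in H *; nra.
have [d1 e1] := node_res RlP f.
have RF : `|Rl f : XR| <= `|F| / lam.
  have := passive_rdot d1; rewrite e1 rdot0r.
  rewrite -[(lam%:C *: Rl f - f : XR)]/(lam *: (Rl f : XR) - (f : XR)).
  rewrite rdotDl rdotNl rdotZl rdotxx => H.
  have H2 := rdot_le (f : XR) (Rl f : XR).
  rewrite ler_pdivlMr//; have [->|r0] := eqVneq (Rl f : XR) 0.
    by rewrite normr0 mul0r.
  have r1 : 0 < `|Rl f : XR| by rewrite normr_gt0.
  by rewrite -(ler_pM2r r1) (le_trans _ (ler_wpM2r (ltW r1) F0))//; lra.
have [d2 e2] := node_resolve RlP f u.
have := passive_rdot d2; rewrite e2 /= -/c.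
rewrite -[(lam%:C *: (Rl f + e u) - f : XR)]/(lam *: ((Rl f : XR) + (e u : XR)) - (f : XR)).
rewrite -[(Rl f + e u : XR)]/((Rl f : XR) + (e u : XR)).
rewrite -[(c + transfer S lam%:C u : UR)]/((c : UR) + P u).
set z := _ - (f : XR); set x := _ + _.
have cu : rdot (c : UR) u = - `|c : UR|.
  by rewrite rdotNr rdotZr rdotxx expr2 mulKf ?gt_eqF.
rewrite [leRHS]rdotDl cu => H.
have Pu : rdot (P u) u <= M.
  by rewrite (le_trans (rdot_le _ _))// u1 mulr1 (le_trans (PM u))// u1 mulr1.
have xE : `|x| <= `|F| / lam + E.
  by rewrite (le_trans (ler_normD _ _))// lerD.
have zE : `|z| <= 2 * `|F| + lam * E.
  have -> : z = lam *: (Rl f : XR) - (f : XR) + lam *: (e u : XR).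
    by rewrite /z scalerDr addrAC.
  rewrite (le_trans (ler_normD _ _))// normrZ gtr0_norm//.
  rewrite lerD// ?ler_pM2l// (le_trans (ler_normB _ _))// normrZ gtr0_norm//.
  by rewrite ler_pdivlMr// mulrC in RF; lra.
have zx : `|z| * `|x| <= (2 * `|F| + lam * E) * (`|F| / lam + E).
  by rewrite ler_pM.
by have := rdot_ge z x; lra.
Qed.

(** The output is c + P u for the free output c. If its pairing with u is
    nonpositive, coercivity of P bounds u in terms of c, and then the output
    is bounded too. *)
Lemma node_input_output_bounded (F : R) : exists K, forall x u,
  dom S (x, u) -> rdot ((S (x, u)).2 : UR) u <= 0 ->
  `|lam *: (x : XR) - ((S (x, u)).1 : XR)| <= F ->
  `|u : UR| <= K /\ `|(S (x, u)).2 : UR| <= K.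
Proof.
have [K1 HK] := res_output_bounded F.
have [M M0 PM] := transfer_bounded.
pose B := 2 * `|K1| / c_lam.
have B0 : 0 <= B by rewrite divr_ge0 ?mulr_ge0// ltW.
exists (Num.max B (`|K1| + M * B)) => x u d yu fF.
have [xE yE] := node_decompose RlP d.
have cK := le_trans (HK _ fF) (ler_norm K1).
set y := (S (x, u)).2 in yu yE *; set c := res_output _ _ _ in cK yE.
have yE' : (y : UR) = (c : UR) + P u by exact: yE.
have uB : `|u : UR| <= B.
  have := transfer_coercive u; have := yu; rewrite yE' rdotDl => H1 H2.
  have H3 := rdot_ge (c : UR) u.
  have [->|u0] := eqVneq (u : UR) 0; first by rewrite normr0.
  have n0 : 0 < `|u : UR| by rewrite normr_gt0.
  rewrite ler_pdivlMr// -(ler_pM2r n0).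
  have : `|c : UR| * `|u : UR| <= `|K1| * `|u : UR| by rewrite ler_pM2r.
  by rewrite expr2 in H2; lra.
split; first by rewrite le_max uB.
rewrite le_max; apply/orP; right; rewrite yE' (le_trans (ler_normD _ _))// lerD//.
by rewrite (le_trans (PM u))// ler_pM2l.
Qed.

Section Range.
Variable phi : U -> U.
Hypothesis phi_lip : locally_lip (phi : UR -> UR).
Hypothesis phi_mono : monotone_fun phi.

(** Applying the inverse Q of P turns the equation into Q w + phi w = Q g.
    Its left-hand side is strongly monotone since Q is, and locally
    Lipschitz. *)
Lemma output_equation (g : UR) : exists w : UR, w + P (phi w) = g.
Proof.
have c2 : 0 < c_lam / 2 by rewrite divr_gt0.
have Ponto := strongly_monotone_onto c2 transfer_strongly_monotone
  transfer_locally_lip.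
have [Q PQ] := choice Ponto.
have [M M0 PM] := transfer_bounded.
have QQ w w' : c_lam / 2 * `|Q w - Q w'| ^+ 2 <= rdot (Q w - Q w') (w - w').
  by have := transfer_strongly_monotone (Q w) (Q w'); rewrite !PQ rdotC.
have Qlip w w' : `|Q w - Q w'| <= 2 / c_lam * `|w - w'|.
  have := strongly_monotone_expands (Q w) (Q w') transfer_strongly_monotone.
  rewrite !PQ => H; rewrite mulrAC ler_pdivlMr//; lra.
pose m := c_lam / 2 / M ^+ 2.
have m0 : 0 < m by rewrite divr_gt0// exprn_gt0.
pose G w := Q w + (phi w : UR).
have Gm : strongly_monotone m G.
  move=> w w'; have H1 := phi_mono w' w.
  have -> : rdot (G w - G w') (w - w') =
     rdot (Q w - Q w') (w - w') + rdot ((phi w : UR) - phi w') (w - w').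
    by rewrite /G !rdotE; ring.
  have H2 : 0 <= rdot ((phi w : UR) - phi w') (w - w') := H1.
  rewrite (le_trans _ (lerD (QQ w w') H2))// addr0 /m mulrAC ler_pdivrMr ?exprn_gt0//.
  rewrite -[leRHS]mulrA ler_pM2l// -exprMn ler_pXn2r ?nnegrE ?mulr_ge0 ?(ltW M0)//.
  by have := PM (Q w - Q w'); rewrite transferB !PQ mulrC.
have Gl : locally_lip G.
  move=> w0; have [r [L [r0 HL]]] := phi_lip w0.
  exists r, (2 / c_lam + L); split => // w w' wr w'r.
  have -> : G w - G w' = (Q w - Q w') + ((phi w : UR) - phi w').
    by rewrite /G opprD addrACA.
  rewrite (le_trans (ler_normD _ _))// mulrDl lerD//; last exact: HL.
have [w Gw] := strongly_monotone_onto m0 Gm Gl (Q g).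
by exists w; rewrite -[RHS]PQ -Gw /G transferD PQ.
Qed.

End Range.
End Transfer.

(** * The closed loop *)

Section Feedback.
Variable phi : U -> U.
Hypothesis phi_mono : monotone_fun phi.
Hypothesis phi_strict : forall u1 u2, phi u1 <> phi u2 ->
   0 < complex.Re (inner (phi u2 - phi u1) (u2 - u1)).

Local Notation Aphi := (feedback_op S phi : partial_op XR XR).

Lemma feedback_outputE x v : feedback_output S phi x v <->
  dom S (x, phi (- v)) /\ v = (S (x, phi (- v))).2.
Proof. by split=> -[d e]; split => //; apply/node_domE. Qed.

Lemma passive_incremental x u x' u' : dom S (x, u) -> dom S (x', u') ->
  rdot (((S (x, u)).1 : XR) - ((S (x', u')).1 : XR)) ((x : XR) - (x' : XR)) <=
  rdot (((S (x, u)).2 : UR) - ((S (x', u')).2 : UR)) ((u : UR) - (u' : UR)).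
Proof.
by move=> d d'; have [d1 e1] := nodeB d d'; have := passive_rdot d1; rewrite e1.
Qed.

(** For two outputs v and v' at x, passivity makes the pairing of v - v'
    with phi (- v) - phi (- v') nonnegative; strictness then leaves only phi
    (- v) = phi (- v'), and equal inputs have equal outputs. *)
Lemma feedback_output_unique x v v' :
  feedback_output S phi x v -> feedback_output S phi x v' -> v = v'.
Proof.
move=> /feedback_outputE[d e] /feedback_outputE[d' e'].
have H := passive_incremental d d'; rewrite -e -e' subrr rdot0r in H.
have [E|/phi_strict N] := pselect (phi (- v') = phi (- v)).
  by rewrite e e' E.
have {}N : 0 < rdot ((phi (- v) : UR) - phi (- v')) (- (v : UR) - - (v' : UR)) := N.
suff : rdot ((phi (- v) : UR) - phi (- v')) (- (v : UR) - - (v' : UR)) =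
  - rdot ((v : UR) - (v' : UR)) ((phi (- v) : UR) - phi (- v')).
  by move=> E; move: N; rewrite E oppr_gt0 ltNge H.
by rewrite rdotC !rdotE; ring.
Qed.

Lemma feedback_opE x v : feedback_output S phi x v ->
  feedback_op S phi x = (S (x, phi (- v))).1.
Proof.
move=> xv; have /feedback_output_unique/(_ xv) E : feedback_output S phi x
  (get (feedback_output S phi x)) by apply: getPex; exists v.
rewrite /feedback_op /= E; have /feedback_outputE[d _] := xv.
by rewrite -(ABE d) unemb_emb.
Qed.

Lemma feedback_domP x : dom (feedback_op S phi) x -> exists v,
  [/\ dom S (x, phi (- v)), (S (x, phi (- v))).2 = v &
      (S (x, phi (- v))).1 = feedback_op S phi x].
Proof.
move=> [v xv]; exists v; have /feedback_outputE[d e] := xv.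
by rewrite (feedback_opE xv).
Qed.

Lemma feedback_dissipative : dissipative Aphi.
Proof.
move=> x x' /feedback_domP[v [d e <-]] /feedback_domP[v' [d' e' <-]].
rewrite (le_trans (passive_incremental d d'))// e e'.
have H : 0 <= rdot ((phi (- v) : UR) - phi (- v')) (- (v : UR) - - (v' : UR)).
  exact: phi_mono.
suff : rdot ((phi (- v) : UR) - phi (- v')) (- (v : UR) - - (v' : UR)) =
  - rdot ((v : UR) - (v' : UR)) ((phi (- v) : UR) - phi (- v')).
  by lra.
by rewrite rdotC !rdotE; ring.
Qed.

Hypothesis phi0 : phi 0 = 0.

Lemma feedback_dom_kerC x : kerC S x -> dom (feedback_op S phi) x.
Proof.
move=> [d e]; exists 0; apply/feedback_outputE; rewrite oppr0 phi0.
by split=> //; rewrite -[RHS]e.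
Qed.

Lemma feedback_op0 : dom Aphi 0 /\ Aphi 0 = 0.
Proof.
have [d0 e0] := node_linear S.
have [_ E] := nodeB d0 d0; rewrite !subrr in E.
have o : feedback_output S phi 0 0.
  by apply/feedback_outputE; rewrite oppr0 phi0 E.
split; first by exists 0.
by have := feedback_opE o; rewrite oppr0 phi0 E.
Qed.

Lemma feedback_dense : dense (kerC S) ->
  forall (x : XR) e, 0 < e -> exists z, dom Aphi z /\ `|z - x| < e.
Proof.
move=> kd x e e0; have eC : 0 < e%:C :> R[i] by rewrite ltcR.
have [z [zb zk]] := kd (ball (x : X) e%:C)
  (ex_intro _ (x : X) (ballxx _ eC)) (ball_open _ _).
exists z; split; first exact: feedback_dom_kerC.
by move: zb; rewrite -ball_normE /= distrC -ltcR realify_normE hnormC.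
Qed.

(** For the step size 1 / lam, the splitting of the node into a free and a
    driven part leaves exactly the output equation; all other step sizes
    follow by continuation. *)
Lemma feedback_solvable (lam c_lam : R) (Rl : {linear X -> X}) (Padj : U -> U) :
  0 < lam -> 0 < c_lam -> is_resolvent (main_op S) lam%:C Rl ->
  adjoint_of (transfer S lam%:C) Padj ->
  (forall u, c_lam%:C * inner u u <= inner (transfer S lam%:C u + Padj u) u) ->
  locally_lip (phi : UR -> UR) ->
  forall h, 0 < h -> implicit_step_solvable Aphi h.
Proof.
move=> l0 c0 RlP PadjP Pc phil.
have li0 : 0 < lam^-1 by rewrite invr_gt0.
suff H : implicit_step_solvable Aphi lam^-1.
  move=> h h0; exact: (@implicit_step_solvable_all R XR Aphi
    feedback_dissipative lam^-1 h li0 h0 H).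
move=> f; pose lf : X := lam *: f.
have [w ew] := output_equation c0 RlP PadjP Pc phil phi_mono
  (- (res_output S Rl lf : UR)).
have [d e] := node_resolve RlP lf (phi w); set x := _ + _ in d e.
have o : feedback_output S phi x (- (w : U)).
  apply/feedback_outputE; rewrite opprK e; split => //=.
  have -> : transfer S lam%:C (phi w) = - res_output S Rl lf - w :> U.
    have := ew; rewrite addrC => /eqP; rewrite -[X in X == _]/((_ : UR) + w) => H.
    by apply/eqP; rewrite eq_sym subr_eq eq_sym.
  by rewrite addrA subrr sub0r.
exists x; split; first by exists (- (w : U)).
have -> : Aphi x = lam *: (x : XR) - (lam *: f) by
  rewrite [LHS](feedback_opE o) opprK e.
by rewrite scalerBr !scalerA mulVf ?gt_eqF// !scale1r subKr.
Qed.

End Feedback.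
End PassiveNode.

(** * Orbits and their energy *)

Lemma right_dini (R : realType) (F : R -> R) (t : R) : 0 <= t ->
  (forall s, 0 < s <= t -> F r @[r --> s^'-] --> F s) ->
  (forall s e, 0 <= s < t -> 0 < e ->
     \forall h \near 0^'+, F (s + h) - F s <= h * e) ->
  F t <= F 0.
Proof.
move=> t0 Fl Fr; apply/ler_addgt0Pr => e' e'0.
have t1 : 0 < t + 1 by rewrite ltr_wpDl.
pose e := e' / (t + 1); have e0 : 0 < e by rewrite divr_gt0.
have : F t - e * t <= F 0 - e * 0.
  apply: (@right_nonincreasing R (fun s => F s - e * s)) => // s sP.
    by apply: cvgB; [exact: Fl | apply: cvgMl_tmp; exact: cvg_at_left_filter].
  by apply: filterS (Fr s e sP e0) => h; lra.
have : e * t <= e'.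
  have -> : e * t = e' * (t / (t + 1)) by rewrite /e; field; rewrite gt_eqF.
  by rewrite ler_piMr ?(ltW e'0)// ler_pdivrMr// mul1r lerDl.
by lra.
Qed.

Section RightDifferentiable.
Context (R : realType) (V : realHilbertType R).
Implicit Types (f g : R -> V) (a b : V) (s : R).

Definition right_diff f s a := forall e, 0 < e ->
  \forall h \near 0^'+, `|f (s + h) - f s - h *: a| <= h * e.

Lemma right_diffB f g s a b : right_diff f s a -> right_diff g s b ->
  right_diff (fun t => f t - g t) s (a - b).
Proof.
move=> fa gb e e0; have e2 : 0 < e / 2 by rewrite divr_gt0.
apply: filterS2 (fa _ e2) (gb _ e2) => h H1 H2.
have -> : f (s + h) - g (s + h) - (f s - g s) - h *: (a - b) =
   (f (s + h) - f s - h *: a) - (g (s + h) - g s - h *: b) by vector_field.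
by rewrite (le_trans (ler_normB _ _))//; lra.
Qed.

Lemma right_diff_shift f s r a : right_diff f (s + r) a ->
  right_diff (fun t => f (s + t)) r a.
Proof.
by move=> fa e /fa; apply: filterS => h; rewrite addrA.
Qed.

Lemma right_diff_sqr f s a e : right_diff f s a -> 0 < e ->
  \forall h \near 0^'+,
    `|f (s + h)| ^+ 2 - `|f s| ^+ 2 <= h * (2 * rdot a (f s) + e).
Proof.
move=> fa e0.
pose eta := Num.min 1 (e / (4 * (`|f s| + 1))).
have n1 : 0 < `|f s| + 1 by rewrite ltr_wpDl.
have eta0 : 0 < eta by rewrite lt_min ltr01 divr_gt0// mulr_gt0.
have eta1 : eta <= 1 by rewrite ge_min lexx.
have etae : 4 * (eta * `|f s|) <= e.
  have : eta * (4 * (`|f s| + 1)) <= e.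
    by rewrite -ler_pdivlMr ?mulr_gt0// ge_min lexx orbT.
  lra.
have a1 : 0 < (`|a| + 1) ^+ 2 by rewrite exprn_gt0// ltr_wpDl.
near=> h.
have h0 : 0 < h by near: h; exact: nbhs_right_gt.
have ha : h * (2 * (`|a| + 1) ^+ 2) <= e.
  rewrite -ler_pdivlMr ?mulr_gt0//; near: h; apply: nbhs_right_le.
  by rewrite divr_gt0// mulr_gt0.
have H : `|f (s + h) - f s - h *: a| <= h * eta by near: h; exact: fa.
set r := f (s + h) - f s - h *: a in H.
have -> : f (s + h) = f s + (h *: a + r) by rewrite /r; vector_field.
rewrite normD2 rdotDr rdotZr.
have H1 : `|h *: a + r| <= h * (`|a| + 1).
  rewrite (le_trans (ler_normD _ _))// normrZ gtr0_norm// mulrDr lerD// mulr1.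
  by rewrite (le_trans H)// ler_piMr// ltW.
have H2 : `|h *: a + r| ^+ 2 <= (h * (`|a| + 1)) ^+ 2.
  by rewrite ler_pXn2r ?nnegrE ?mulr_ge0 ?addr_ge0 ?(ltW h0).
have H3 : rdot (f s) r <= `|f s| * (h * eta).
  by rewrite (le_trans (rdot_le _ _))// ler_wpM2l.
rewrite exprMn in H2; rewrite (rdotC a).
have H4 : h * (h * (2 * (`|a| + 1) ^+ 2)) <= h * e by rewrite ler_pM2l.
have H5 : h * (4 * (eta * `|f s|)) <= h * e by rewrite ler_pM2l.
rewrite expr2 in H2; lra.
Unshelve. all: by end_near. Qed.

End RightDifferentiable.

Section LinearSemigroup.
Context (R : realType) (X : hilbertType R).
Local Notation XR := (realify X).
Variables (T : R -> {linear X -> X}) (A : partial_op X X).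
Hypothesis TC0 : C0_semigroup T.

Lemma C0_pointwise_bounded t : 0 <= t ->
  exists M, forall x : XR, `|T t x : XR| <= M * `|x|.
Proof.
move=> t0; have /linear_bounded_continuous := C0_bounded TC0 t0.
move=> /linear_boundedP/pinfty_ex_gt0[M M0 HM].
exists (complex.Re M) => x.
have MR : M = (complex.Re M)%:C by rewrite RRe_real// gtr0_real.
by rewrite -lecR real_complexM !realify_normE !hnormC -MR.
Qed.

(** Otherwise the operators T h_n would be unbounded along some times h_n that
    tend to 0, against the uniform boundedness principle. *)
Lemma C0_bounded_near0 : exists M d, [/\ 0 <= M, 0 < d &
  forall h, 0 <= h <= d -> forall x : XR, `|T h x : XR| <= M * `|x|].
Proof.
apply: contrapT => H.
have Hn (n : nat) : exists h, 0 <= h <= n.+1%:R^-1 /\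
    exists x : XR, n%:R * `|x| < `|T h x : XR|.
  apply: contrapT => Hn; apply: H; exists n%:R, n.+1%:R^-1; split => //.
  move=> h hP x; rewrite leNgt; apply/negP => xh; apply: Hn.
  by exists h; split => //; exists x.
have [h hP] := choice Hn.
pose F : set (XR -> XR) := range (fun n => (T (h n) : XR -> XR)).
have [f [n _ <-]|x|M HM] := @Banach_Steinhauss R XR XR F _ _ 1.
- have [[h0 _] _] := (andP (hP n).1, I).
  split; last by move=> a x y; exact: (linearP (T (h n)) a%:C x y).
  have [M HM] := C0_pointwise_bounded h0; move=> r; exists (`|M| * `|r|) => x xr.
  rewrite (le_trans (HM x))// (le_trans (ler_norm _))// normrM normr_id.
  by rewrite ler_wpM2l// (le_trans xr)// ler_norm.
- have /cvg_realify/cvgrPdist_lt/(_ 1 ltr01)[d d0 Hd] := C0_strong TC0 (x := x).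
  have [N _ HN] := near_infty_natSinv_lt (PosNum d0).
  exists (`|x| + 1 + \sum_(n < N) `|T (h n) x : XR|) => f [n _ <-].
  have [/andP[h0 h1] _] := hP n.
  have [nN|Nn] := ltnP n N.
    rewrite (bigD1 (Ordinal nN))//= addrCA lerDl addr_ge0//; last exact: sumr_ge0.
  rewrite (@le_trans _ _ (`|x| + 1))//; last by rewrite lerDl sumr_ge0.
  have [->|hn0] := eqVneq (h n) 0; first by rewrite (C0_id TC0) lerDl.
  have hn : 0 < h n by rewrite lt_def hn0.
  have : `|(x : XR) - T (h n) x| < 1.
    apply: Hd => //=; rewrite sub0r normrN gtr0_norm//.
    exact: le_lt_trans h1 (HN n Nn).
  have := ler_normB (x : XR) ((x : XR) - (T (h n) x : XR)); rewrite subKr => H1 H2.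
  by apply: (le_trans H1); rewrite lerD2l ltW.
pose n := truncn `|M|; have [_ [x Hx]] := hP n.+1.
have x0 : 0 < `|x|.
  rewrite normr_gt0; apply: contraTneq Hx => ->.
  by rewrite linear0 normr0 mulr0 ltxx.
have := HM _ (ex_intro2 _ _ n.+1 Logic.I erefl) (`|x|^-1 *: x).
rewrite normrZ ger0_norm ?invr_ge0// mulVf ?gt_eqF// => /(_ (lexx _)).
have -> : T (h n.+1) (`|x|^-1 *: x) = `|x|^-1 *: (T (h n.+1) x : XR) :> XR.
  exact: (linearZ_LR (T (h n.+1)) (`|x|^-1)%:C x).
rewrite normrZ ger0_norm ?invr_ge0// mulrC ler_pdivrMr// leNgt => /negP; apply.
apply: le_lt_trans Hx; rewrite ler_pM2r// (le_trans (ler_norm M))//.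
exact: ltW (truncnS_gt _).
Qed.

Lemma C0_locally_bounded t : exists2 M, 0 <= M &
  forall s, 0 <= s <= t -> forall x : XR, `|T s x : XR| <= M * `|x|.
Proof.
have [M [d [M0 d0 HM]]] := C0_bounded_near0.
have Mn n : forall s, 0 <= s <= n%:R * d -> forall x : XR,
    `|T s x : XR| <= (M + 1) ^+ n.+1 * `|x|.
  elim: n => [|n IHn] s /andP[s0 sd] x.
    have -> : s = 0 by apply/le_anti; rewrite s0 andbT mul0r in sd *.
    rewrite (le_trans (HM 0 _ x)) ?lexx ?(ltW d0)// expr1 ler_wpM2r//.
    by rewrite lerDl.
  have [sd'|sd'] := leP s d.
    rewrite (le_trans (HM s _ x)) ?s0// ler_wpM2r//.
    rewrite (@le_trans _ _ (M + 1)) ?lerDl//; apply: ler_eXnr => //.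
    by rewrite lerDr.
  have sE : s = d + (s - d) by rewrite subrKC.
  have sd0 : 0 <= s - d by rewrite subr_ge0 ltW.
  rewrite sE (C0_add TC0 (ltW d0) sd0) (le_trans (HM d _ _)) ?lexx ?(ltW d0)//.
  rewrite exprS -mulrA ler_pM//; first by rewrite lerDl.
  apply: IHn; rewrite sd0/=; rewrite -natr1 mulrDl mul1r in sd; lra.
pose n := (truncn (`|t| / d)).+1; exists ((M + 1) ^+ n.+1).
  by rewrite exprn_ge0// addr_ge0.
move=> s /andP[s0 st] x; apply: Mn; rewrite s0/= -ler_pdivrMr//.
apply: le_trans (ltW (truncnS_gt _)); rewrite ler_pM2r ?invr_gt0//.
exact: le_trans st (ler_norm _).
Qed.

Lemma C0_orbit_left_cvg (x : XR) t : 0 < t ->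
  (T s x : XR) @[s --> t^'-] --> (T t x : XR).
Proof.
move=> t0; have [M M0 HM] := C0_locally_bounded t.
have M1 : 0 < M + 1 by rewrite ltr_wpDl.
apply/cvgrPdist_lt => e e0; have e1 : 0 < e / (M + 1) by rewrite divr_gt0.
have /cvg_realify/cvgrPdist_lt/(_ _ e1) H := C0_strong TC0 (x := x).
apply/nbhs_left0P; near=> h.
have h0 : 0 < h by near: h; exact: nbhs_right_gt.
have ht : h <= t by near: h; exact: nbhs_right_le.
have th0 : 0 <= t - h by rewrite subr_ge0.
have -> : (T t x : XR) - T (t - h) x = T (t - h) ((T h x : X) - x).
  by rewrite linearB -(C0_add TC0 th0 (ltW h0)) subrK.
have thP : 0 <= t - h <= t by rewrite th0/= gerBl ltW.
rewrite (le_lt_trans (HM _ thP _))//.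
have : `|(x : XR) - T h x| < e / (M + 1) by near: h; exact: H.
rewrite ltr_pdivlMr// distrC => H1; apply: le_lt_trans H1.
by rewrite mulrC ler_wpM2l// lerDl.
Unshelve. all: by end_near. Qed.

Hypothesis TA : generates A T.

Lemma C0_orbit_right_diff x t : dom A x -> 0 <= t ->
  dom A (T t x) /\
  right_diff (fun s => T s x : XR) t (A (T t x)).
Proof.
move=> dx t0.
have H1 : (h^-1)%:C *: (T h x - x) @[h --> 0^'+] --> A x.
  exact: (TA x (A x)).1 (conj dx erefl).
have H2 : (h^-1)%:C *: (T h (T t x) - T t x) @[h --> 0^'+] --> T t (A x).
  have H3 : T t ((h^-1)%:C *: (T h x - x)) @[h --> 0^'+] --> T t (A x).
    by apply: continuous_cvg => //; exact: (C0_bounded TC0 t0).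
  apply: cvg_trans H3; apply: near_eq_cvg; near=> h.
  have h0 : 0 <= h by near: h; exact: nbhs_right_ge.
  by rewrite linearZ linearB /= -(C0_add TC0 t0 h0) -(C0_add TC0 h0 t0) (addrC t).
have [dT eT] := (TA (T t x) (T t (A x))).2 H2.
split=> // e e0; rewrite eT.
have /cvg_realify/cvgrPdist_lt/(_ _ e0) H3 := H2.
near=> h; have h0 : 0 < h by near: h; exact: nbhs_right_gt.
have : `|(T t (A x) : XR) - h^-1 *: ((T h (T t x) : XR) - T t x)| < e.
  by near: h; exact: H3.
rewrite -(ltr_pM2l h0) -{1}(gtr0_norm h0) -normrZ scalerBr scalerA divff ?gt_eqF//.
by rewrite scale1r distrC -(C0_add TC0 (ltW h0) t0) (addrC h) => /ltW.
Unshelve. all: by end_near. Qed.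

End LinearSemigroup.

Lemma rdot_sub_self_le (R : realType) (V : realHilbertType R) (q w : V) :
  rdot q (w - q) <= `|w| ^+ 2 / 4.
Proof.
have := sqr_ge0 (normr (w - (2 : R) *: q)); rewrite normB2 rdotZr normrZ.
by rewrite exprMn ger0_norm// rdotDr rdotNr rdotxx (rdotC q); lra.
Qed.

(** * Decay of the orbits of the closed loop *)

Section Damping.
Context (R : realType) (U : hilbertType R).
Local Notation UR := (realify U).
Variable phi : U -> U.

Lemma locally_lipschitz_realify : locally_lipschitz phi ->
  locally_lip (phi : UR -> UR).
Proof.
move=> pl x0; have [N Nx0 /pinfty_ex_gt0 [M M0 HM]] := pl x0.
have MR : M = (complex.Re M)%:C by rewrite RRe_real// gtr0_real.
have /nbhs_normP [r /= r0 Hr] := Nx0.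
have rR : r = (complex.Re r)%:C by rewrite RRe_real// gtr0_real.
have r1 : 0 < complex.Re r by rewrite -ltcR -rR.
exists (complex.Re r / 2), (complex.Re M); split; first by rewrite divr_gt0.
have NB (x : UR) : `|x - (x0 : UR)| <= complex.Re r / 2 -> N x.
  move=> xr; apply: Hr => /=; rewrite rR -hnormC ltcR -realify_normE.
  rewrite -[X in `|X|]/((x0 : UR) - x) distrC; lra.
move=> x y /NB Nx /NB Ny; have := HM (x, y) (conj Nx Ny) => /=.
by rewrite -!hnormC MR -real_complexM lecR.
Qed.

Hypothesis phi_lip : locally_lip (phi : UR -> UR).
Hypothesis phi0 : phi 0 = 0.
Variables (alpha beta delta : R).
Hypotheses (alpha_gt0 : 0 < alpha) (beta_gt0 : 0 < beta).
Hypothesis phi_small : forall u : UR, `|u| < delta ->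
  alpha * `|u| ^+ 2 <= rdot (phi u : UR) u.
Hypothesis phi_large : forall u : UR, delta <= `|u| ->
  beta <= rdot (phi u : UR) u.

(** On bounded sets of inputs and outputs, the deviation of phi from the
    identity is controlled by the power that phi dissipates: near the origin by
    the Lipschitz bound, and away from it because the power is bounded below. *)
Lemma deviation_le_power (B : R) : exists2 K, 0 < K & forall u : UR,
  `|u| <= B -> `|phi u : UR| <= B ->
  `|(phi u : UR) - u| ^+ 2 <= K * rdot (phi u : UR) u.
Proof.
have [r [L [r0 HL]]] := phi_lip 0.
pose e0 := Num.min beta (alpha * r ^+ 2).
have e00 : 0 < e0 by rewrite lt_min beta_gt0/= mulr_gt0// exprn_gt0.
pose K1 := (`|L| + 1) ^+ 2 / alpha; pose K2 := (2 * B) ^+ 2 / e0.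
have K10 : 0 < K1 by rewrite divr_gt0// exprn_gt0// ltr_wpDl.
have K20 : 0 <= K2 by rewrite divr_ge0 ?exprn_even_ge0// ltW.
exists (K1 + K2); first by rewrite ltr_pwDl.
move=> u uB pB; have B0 : 0 <= B := le_trans (normr_ge0 _) uB.
have far : e0 <= rdot (phi u : UR) u ->
    `|(phi u : UR) - u| ^+ 2 <= K2 * rdot (phi u : UR) u.
  move=> He; rewrite (@le_trans _ _ ((2 * B) ^+ 2))//.
    rewrite ler_pXn2r ?nnegrE ?mulr_ge0// (le_trans (ler_normB _ _))//; lra.
  by rewrite /K2 mulrAC ler_pdivlMr// ler_wpM2l// exprn_even_ge0.
have K1f x : 0 <= x -> 0 <= K1 * x by move=> x0; rewrite mulr_ge0// ltW.
have K2f x : 0 <= x -> 0 <= K2 * x by move=> x0; rewrite mulr_ge0.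
rewrite mulrDl; have [ud|du] := ltP `|u| delta; last first.
  have He : e0 <= rdot (phi u : UR) u.
    by rewrite (le_trans _ (phi_large du))// ge_min lexx.
  by rewrite (le_trans (far He))// lerDr K1f// (le_trans (ltW e00)).
have Hs := phi_small ud.
have [ur|ru] := leP `|u| r; last first.
  have He : e0 <= rdot (phi u : UR) u.
    rewrite (le_trans _ Hs)// (@le_trans _ _ (alpha * r ^+ 2))//.
      by rewrite ge_min lexx orbT.
    by rewrite ler_pM2l// ler_pXn2r ?nnegrE ?(ltW ru)// ltW.
  by rewrite (le_trans (far He))// lerDr K1f// (le_trans (ltW e00)).
have p0 : 0 <= rdot (phi u : UR) u.
  by rewrite (le_trans _ Hs)// mulr_ge0 ?exprn_ge0// ltW.
have pL : `|phi u : UR| <= `|L| * `|u|.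
  have := HL u 0; rewrite phi0 !subr0 normr0 => /(_ ur (ltW r0)) H.
  by rewrite (le_trans H)// ler_wpM2r// ler_norm.
have H1 : `|(phi u : UR) - u| <= (`|L| + 1) * `|u|.
  by rewrite (le_trans (ler_normB _ _))// mulrDl mul1r lerD2r.
have H2 : `|(phi u : UR) - u| ^+ 2 <= (`|L| + 1) ^+ 2 * `|u| ^+ 2.
  by rewrite -exprMn ler_pXn2r ?nnegrE// mulr_ge0// addr_ge0.
rewrite (le_trans H2)// (@le_trans _ _ (K1 * rdot (phi u : UR) u))//.
  rewrite /K1 [leRHS]mulrAC ler_pdivlMr// -[leLHS]mulrA ler_wpM2l// ?exprn_even_ge0//.
  by rewrite mulrC.
by rewrite lerDl K2f.
Qed.

Lemma phi_power_ge0 (u : UR) : 0 <= rdot (phi u : UR) u.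
Proof.
have [ud|du] := ltP `|u| delta; last by rewrite (le_trans _ (phi_large du))// ltW.
by rewrite (le_trans _ (phi_small ud))// mulr_ge0 ?exprn_ge0// ltW.
Qed.

End Damping.

Section Decay.
Context (R : realType) (U X : hilbertType R) (S : system_node U X U).
Local Notation XR := (realify X).
Local Notation UR := (realify U).
Hypothesis S_passive : impedance_passive S.
Variable phi : U -> U.
Hypothesis phi_mono : monotone_fun phi.
Hypothesis phi_strict : forall u1 u2, phi u1 <> phi u2 ->
   0 < complex.Re (inner (phi u2 - phi u1) (u2 - u1)).
Hypothesis phi0 : phi 0 = 0.

Lemma id_strict (u1 u2 : U) : id u1 <> id u2 ->
  0 < complex.Re (inner (id u2 - id u1) (u2 - u1)).
Proof.
move=> ne; rewrite -[X in _ < X]/(rdot ((u2 : UR) - u1) ((u2 : UR) - u1)).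
rewrite rdotxx exprn_gt0// normr_gt0 subr_eq0; apply/eqP => e.
by apply: ne; rewrite e.
Qed.

Local Notation A := (feedback_op S phi : partial_op XR XR).
Local Notation AK := (feedback_K S : partial_op XR XR).

(** With w = phi (- v) + v and q = v - v', incremental passivity bounds the
    growth of |x - z|^2 by 2 <q, w - q> <= |w|^2 / 2, which the energy
    dissipated along x pays for. *)
Lemma energy_comparison (x z : X) (K : R) (v : U) :
  0 <= K -> dom S (x, phi (- v)) -> (S (x, phi (- v))).2 = v ->
  `|(phi (- v) : UR) - - (v : UR)| ^+ 2 <= K * rdot (phi (- v) : UR) (- (v : UR)) ->
  dom AK z ->
  2 * rdot (A x - AK z) ((x : XR) - z) + K / 4 * (2 * rdot (A x) (x : XR)) <= 0.
Proof.
move=> K0 d e Kv dz.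
have Ax : A x = (S (x, phi (- v))).1.
  by apply: feedback_opE => //; apply/feedback_outputE.
have [v' [d' e' eA]] := feedback_domP S_passive id_strict dz.
have H1 := passive_incremental S_passive d d'; rewrite e e' eA -Ax in H1.
have H2 := passive_rdot S_passive d; rewrite e -Ax in H2.
set p : UR := phi (- v) in Kv H1 H2 *.
set w := p - - (v : UR) in Kv.
have E : rdot ((v : UR) - v') (p - (id (- v') : UR)) =
    rdot ((v : UR) - v') (w - ((v : UR) - v')).
  congr rdot; rewrite /w opprK -[(id (- v') : UR)]/(- (v' : UR)).
  by vector_field.
rewrite E in H1; set q := (v : UR) - v' in H1.
have H3 : rdot q (w - q) <= `|w| ^+ 2 / 4.
  exact: rdot_sub_self_le.
have Kv' : rdot (A x) (x : XR) <= - rdot p (- (v : UR)).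
  by rewrite (le_trans H2)// rdotNr opprK rdotC.
have H5 : K * rdot (A x) (x : XR) <= K * - rdot p (- (v : UR)).
  by rewrite ler_wpM2l.
by rewrite mulrN in H5; lra.
Qed.

Variables (lam c_lam : R) (Rl : {linear X -> X}) (Padj : U -> U).
Hypotheses (lam_gt0 : 0 < lam) (c_lam_gt0 : 0 < c_lam).
Hypothesis RlP : is_resolvent (main_op S) lam%:C Rl.
Hypothesis PadjP : adjoint_of (transfer S lam%:C) Padj.
Hypothesis P_coercive : forall u,
  c_lam%:C * inner u u <= inner (transfer S lam%:C u + Padj u) u.
Hypothesis kerC_dense : dense (kerC S).
Hypothesis phi_lip : locally_lip (phi : UR -> UR).
Variables (alpha beta delta : R).
Hypotheses (alpha_gt0 : 0 < alpha) (beta_gt0 : 0 < beta).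
Hypothesis phi_small : forall u : UR, `|u| < delta ->
  alpha * `|u| ^+ 2 <= rdot (phi u : UR) u.
Hypothesis phi_large : forall u : UR, delta <= `|u| ->
  beta <= rdot (phi u : UR) u.
Variable TK : R -> {linear X -> X}.
Hypothesis TK_C0 : C0_semigroup TK.
Hypothesis TK_gen : generates (feedback_K S) TK.
Hypothesis TK_stable : strongly_stable TK.

Lemma closed_loop_dissipative : dissipative A.
Proof. exact: feedback_dissipative. Qed.

Lemma closed_loop_solvable h : 0 < h -> implicit_step_solvable A h.
Proof.
exact: (feedback_solvable S_passive phi_mono phi_strict lam_gt0 c_lam_gt0 RlP
  PadjP P_coercive phi_lip).
Qed.

Lemma closed_loop_dense (x : XR) e : 0 < e -> exists z, dom A z /\ `|z - x| < e.
Proof. exact: feedback_dense. Qed.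

Local Notation SG := (nl_semigroup A).
Local Notation Adiss := closed_loop_dissipative.
Local Notation Astep := closed_loop_solvable.
Local Notation Adense := closed_loop_dense.

Lemma closed_loop_semigroup0 t : 0 <= t -> SG t 0 = 0.
Proof.
move=> t0; have [d0 A0] := feedback_op0 S_passive phi_strict phi0.
have := nl_semigroup_lip Adiss Astep Adense d0 (lexx 0) t0.
rewrite (nl_semigroup0 A) A0 normr0 mulr0 subr0 normr_le0.
by move=> /eqP.
Qed.

Lemma closed_loop_norm_le (x : XR) t : 0 <= t -> `|SG t x| <= `|x|.
Proof.
move=> t0; have := nl_semigroup_contraction Adiss Astep Adense x 0 t0.
by rewrite closed_loop_semigroup0// !subr0.
Qed.

Lemma closed_loop_right_diff (x : XR) t : dom A x -> 0 <= t ->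
  right_diff (fun s => SG s x) t (A (SG t x)).
Proof.
move=> dx t0 e e0; exact: (nl_semigroup_increment Adiss Astep Adense dx t0 e0).
Qed.

Lemma closed_loop_left_cvg (x : XR) t : dom A x -> 0 < t ->
  SG s x @[s --> t^'-] --> SG t x.
Proof.
move=> dx t0; apply/cvgrPdist_lt => e e0.
have A1 : 0 < `|A x| + 1 by rewrite ltr_wpDl.
near=> s; have s0 : 0 <= s by near: s; exact: nbhs_left_ge.
have st : s <= t by near: s; exact: nbhs_left_le.
have H : t - s < e / (`|A x| + 1).
  by near: s; apply: nbhs_left_ltBl; rewrite divr_gt0.
rewrite ltr_pdivlMr// in H.
rewrite (le_lt_trans (nl_semigroup_lip_le Adiss Astep Adense dx s0 st))//.
by apply: le_lt_trans H; rewrite ler_wpM2l ?subr_ge0// lerDl.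
Unshelve. all: by end_near. Qed.

(** Along an orbit starting in the domain x and A x stay bounded, hence so
    do the output and the input, and on bounded sets the deviation from
    linear feedback is controlled by the dissipated power. *)
Lemma closed_loop_deviation (x : XR) : dom A x -> exists2 K, 0 < K &
  forall t, 0 <= t -> exists v : U,
    [/\ dom S (SG t x, phi (- v)), (S (SG t x, phi (- v))).2 = v &
     `|(phi (- v) : UR) - - (v : UR)| ^+ 2 <=
       K * rdot (phi (- v) : UR) (- (v : UR))].
Proof.
move=> dx.
have [B HB] := node_input_output_bounded S_passive lam_gt0 c_lam_gt0 RlP PadjP
  P_coercive (lam * `|x| + `|A x|).
have [K K0 HK] := deviation_le_power phi_lip phi0 alpha_gt0 beta_gt0
  phi_small phi_large B.
exists K => // t t0.
have [dt At] := nl_semigroup_dom Adiss Astep Adense dx t0.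
have [v [d e eA]] := feedback_domP S_passive phi_strict dt.
exists v; split => //.
have pw : rdot (v : UR) (phi (- v) : UR) <= 0.
  have := phi_power_ge0 alpha_gt0 beta_gt0 phi_small phi_large (- (v : UR)).
  by rewrite rdotNr rdotC oppr_ge0.
have [] := HB _ _ d.
- by rewrite e.
- rewrite eA (le_trans (ler_normB _ _))// normrZ gtr0_norm//.
  by rewrite lerD// ler_pM2l// closed_loop_norm_le.
by rewrite e => pB vB; apply: HK => //; rewrite normrN.
Qed.

Lemma closed_loop_comparison (x z : XR) (K : R) s t :
  dom A x -> dom AK z -> 0 <= K -> 0 <= s -> 0 <= t ->
  (forall t, 0 <= t -> exists v : U,
    [/\ dom S (SG t x, phi (- v)), (S (SG t x, phi (- v))).2 = v &
     `|(phi (- v) : UR) - - (v : UR)| ^+ 2 <=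
       K * rdot (phi (- v) : UR) (- (v : UR))]) ->
  `|SG (s + t) x - TK t z| ^+ 2 + K / 4 * `|SG (s + t) x| ^+ 2 <=
  `|SG s x - z| ^+ 2 + K / 4 * `|SG s x| ^+ 2.
Proof.
move=> dx dz K0 s0 t0 HK.
pose u r := SG (s + r) x; pose y r : XR := TK r z.
pose E r := `|u r - y r| ^+ 2 + K / 4 * `|u r| ^+ 2.
have : E t <= E 0.
  apply: right_dini => // [r /andP[r0 rt]|r e /andP[r0 rt] e0].
    have sr0 : 0 < s + r by rewrite ltr_wpDl.
    have ul : u q @[q --> r^'-] --> u r.
      have := closed_loop_left_cvg dx sr0.
      move=> /cvgrPdist_lt H; apply/cvgrPdist_lt => e e0.
      apply/nbhs_left0P; have /nbhs_left0P := H e e0.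
      by apply: filterS => h; rewrite /u addrA.
    have yl : y q @[q --> r^'-] --> y r := C0_orbit_left_cvg TK_C0 (x := z) r0.
    apply: cvgD; first by apply: cvgM; apply: cvg_norm; apply: cvgB.
    by apply: cvgMl_tmp; apply: cvgM; exact: cvg_norm.
  have sr0 : 0 <= s + r by rewrite addr_ge0.
  have [dxr _] := nl_semigroup_dom Adiss Astep Adense dx sr0.
  have [dzr yr] := C0_orbit_right_diff TK_C0 TK_gen dz r0.
  have ur : right_diff u r (A (u r)).
    exact: right_diff_shift (closed_loop_right_diff dx sr0).
  have [v [d ev Kv]] := HK _ sr0.
  have Hc := energy_comparison K0 d ev Kv dzr.
  have e2 : 0 < e / 2 by rewrite divr_gt0.
  have e3 : 0 < e / (2 * (K + 1)).
    by rewrite divr_gt0// mulr_gt0// ltr_wpDl.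
  near=> h; have h0 : 0 < h by near: h; exact: nbhs_right_gt.
  have H1 : `|u (r + h) - y (r + h)| ^+ 2 - `|u r - y r| ^+ 2 <=
     h * (2 * rdot (A (u r) - feedback_K S (y r)) (u r - y r) + e / 2).
    by near: h; apply: (right_diff_sqr (right_diffB ur yr)).
  have H2 : `|u (r + h)| ^+ 2 - `|u r| ^+ 2 <=
     h * (2 * rdot (A (u r)) (u r) + e / (2 * (K + 1))).
    by near: h; exact: right_diff_sqr.
  have H3 : K / 4 * (`|u (r + h)| ^+ 2 - `|u r| ^+ 2) <=
     K / 4 * (h * (2 * rdot (A (u r)) (u r) + e / (2 * (K + 1)))).
    by rewrite ler_wpM2l// divr_ge0.
  have H4 : K / 4 * (e / (2 * (K + 1))) <= e / 2.
    have -> : K / 4 * (e / (2 * (K + 1))) = e / 2 * (K / (K + 1) / 4).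
      by field; rewrite gt_eqF// ltr_wpDl.
    rewrite ler_piMr ?(ltW e2)// ler_pdivrMr// mul1r.
    have : K / (K + 1) <= 1 by rewrite ler_pdivrMr ?ltr_wpDl// mul1r lerDl.
    by lra.
  have H5 : h * (2 * rdot (A (u r) - feedback_K S (y r)) (u r - y r) +
     K / 4 * (2 * rdot (A (u r)) (u r))) <= 0.
    by rewrite pmulr_rle0.
  have H6 : h * (K / 4 * (e / (2 * (K + 1)))) <= h * (e / 2) by rewrite ler_pM2l.
  rewrite /E; lra.
by rewrite /E /u /y addr0 (C0_id TK_C0).
Unshelve. all: by end_near. Qed.

(** From a late time s on, the orbit loses almost no energy, so it follows the
    stable orbit of the linear loop that starts close to its value at s. *)
Lemma closed_loop_decay_dom (x : XR) (e : R) : dom A x -> 0 < e ->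
  \forall t \near +oo, `|SG t x| < e.
Proof.
move=> dx e0; have [K K0 HK] := closed_loop_deviation dx.
pose D := [set `|SG t x| ^+ 2 | t in [set t | 0 <= t]].
have Dinf : has_inf D.
  split; first by exists (`|SG 0 x| ^+ 2); exists 0 => //=.
  by exists 0 => _ [t _ <-]; rewrite exprn_ge0.
pose eps := (e / 2) ^+ 2 / 2.
have eps0 : 0 < eps by rewrite divr_gt0// exprn_gt0// divr_gt0.
have [_ [s /= s0 <-] Hs] := inf_adherent (divr_gt0 eps0 K0) Dinf.
have eta0 : 0 < e / 4 by rewrite divr_gt0.
have [z [dz zs]] := feedback_dense (phi := id) erefl kerC_dense
  (SG s x : XR) eta0.
have /cvg_realify/cvgrPdist_lt/(_ (e / 4) eta0) Hz := TK_stable z.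
have [M [_ HM]] := Hz.
exists (s + `|M| + 1); split; first exact: num_real.
move=> t tM; have st : s <= t by have := normr_ge0 M; lra.
have ts0 : 0 <= t - s by rewrite subr_ge0.
have := closed_loop_comparison dx dz (ltW K0) s0 ts0 HK.
rewrite subrKC => Hc.
have Ht : inf D <= `|SG t x| ^+ 2.
  apply: ge_inf; first by case: Dinf.
  by exists t => //=; apply: le_trans st.
have H1 : `|SG s x - z| ^+ 2 <= (e / 4) ^+ 2.
  by rewrite ler_pXn2r ?nnegrE ?(ltW eta0)// distrC ltW.
have H2 : K / 4 * `|SG s x| ^+ 2 <= K / 4 * `|SG t x| ^+ 2 + eps / 4.
  have -> : K / 4 * `|SG t x| ^+ 2 + eps / 4 =
      K / 4 * (`|SG t x| ^+ 2 + eps / K) by field; rewrite gt_eqF.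
  by rewrite ler_wpM2l ?divr_ge0 ?(ltW K0)//; lra.
have H3 : `|SG t x - TK (t - s) z| < 3 * e / 4.
  rewrite -(@ltr_pXn2r _ 2) ?nnegrE ?divr_ge0 ?mulr_ge0 ?(ltW e0)//.
  have : 0 < e ^+ 2 by rewrite exprn_gt0.
  by rewrite /eps in H2; rewrite !exprMn in H1 H2 *; rewrite !expr2 in H1 H2 *; lra.
have H4 : `|TK (t - s) z : XR| < e / 4.
  have := HM (t - s); rewrite sub0r normrN; apply.
  by have := ler_norm M; lra.
rewrite -[X in `|X|](subrK (TK (t - s) z : XR)).
by rewrite (le_lt_trans (ler_normD _ _))//; lra.
Qed.

Lemma closed_loop_decay (x : XR) (e : R) : 0 < e ->
  \forall t \near +oo, `|SG t x| < e.
Proof.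
move=> e0; have e2 : 0 < e / 2 by rewrite divr_gt0.
have [z [dz zx]] := Adense x e2.
have [M [Mr HM]] := closed_loop_decay_dom dz e2.
exists (Num.max 0 M); split; first exact: num_real.
move=> t; rewrite gt_max => /andP[t0 /HM Hz].
have := nl_semigroup_contraction Adiss Astep Adense x z (ltW t0).
rewrite -[X in `|X| < _](subrK (SG t z)) => Hc.
rewrite distrC in zx.
by rewrite (le_lt_trans (ler_normD _ _))//; lra.
Qed.

End Decay.

(** * Generalised solutions *)

Section UniformLimits.
Context (R : realType) (X : hilbertType R).
Local Notation XR := (realify X).

Lemma uniform_pointwise (x_ : nat -> R -> X) (x : R -> X) (D : set R) t : D t ->
  {uniform D, x_ @ \oo --> x} -> x_ k t @[k --> \oo] --> x t.
Proof.
move=> Dt xx; have : {uniform [set t], x_ @ \oo --> x}.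
  by apply: uniform_subset_cvg xx => _ ->.
by rewrite uniform_set1.
Qed.

Lemma uniform_of_dist (x_ : nat -> R -> X) (x : R -> X) (D : set R) (r : nat -> R) :
  r k @[k --> \oo] --> (0 : R) ->
  (forall k t, D t -> `|(x_ k t : XR) - x t| <= r k) ->
  {uniform D, x_ @ \oo --> x}.
Proof.
move=> r0 xr P /= /uniform_nbhs [E [entE EP]].
move: entE; rewrite -entourage_ballE => -[e /= e0 eE].
have eR : e = (complex.Re e)%:C by rewrite RRe_real// gtr0_real.
have e1 : 0 < complex.Re e by rewrite -ltcR -eR.
have [N _ HN] := cvgr_lt _ r0 _ e1.
exists N => // k /HN /= rk; apply: EP => t Dt; apply: eE => /=.
rewrite -ball_normE /= eR -hnormC ltcR.
by rewrite -[X in X < _]/(`|(x t : XR) - x_ k t|) distrC (le_lt_trans (xr k t Dt)).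
Qed.

End UniformLimits.

Lemma dist_max0_le (R : realFieldType) (s t : R) :
  `|Num.max s 0 - Num.max t 0| <= `|s - t|.
Proof.
rewrite /Num.max; case: ltP => sP; case: ltP => tP; rewrite ?subrr ?normr0//.
  by rewrite sub0r normrN ger0_norm// distrC ger0_norm; lra.
by rewrite subr0 ger0_norm// ger0_norm; lra.
Qed.

Section ClosedLoopSolutions.
Context (R : realType) (U X : hilbertType R) (S : system_node U X U).
Local Notation XR := (realify X).
Variable phi : U -> U.
Local Notation A := (feedback_op S phi : partial_op XR XR).
Hypothesis Adiss : dissipative A.

Lemma strong_solution_contraction (x y : R -> X) t : 0 <= t ->
  strong_solution S phi x -> strong_solution S phi y ->
  `|(x t : XR) - y t| <= `|(x 0 : XR) - y 0|.
Proof.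
move=> t0 [dx [gx Hx ax]] [dy [gy Hy ay]].
have [->//|tN0] := eqVneq t 0.
have {}t0 : 0 < t by rewrite lt_def tN0.
apply: (@weak_contraction R X x y gx gy t t0 (Hx t t0) (Hy t t0)).
apply: (@filterS2 _ _ (ae_filter_ringOfSetsType (@lebesgue_measure R)) _ _ _ _ ax ay).
by move=> s Hxs Hys s0; rewrite Hxs// Hys//; apply: Adiss; [exact: dx|exact: dy].
Qed.

Lemma generalised_solution_contraction (x y : R -> X) t : 0 <= t ->
  generalised_solution S phi x -> generalised_solution S phi y ->
  `|(x t : XR) - y t| <= `|(x 0 : XR) - y 0|.
Proof.
move=> t0 [_ [x_ xs xx]] [_ [y_ ys yy]].
have t1 : 0 < t + 1 by rewrite ltr_wpDl.
have cv s (z_ : nat -> R -> X) z : 0 <= s <= t ->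
    {uniform `[0, t + 1], z_ @ \oo --> z} ->
    (z_ k s : XR) @[k --> \oo] --> (z s : XR).
  move=> /andP[s0 st] zz; apply/cvg_realify; apply: uniform_pointwise zz.
  by rewrite /= in_itv/= s0 (le_trans st)// lerDl.
have d s : 0 <= s <= t ->
    `|(x_ k s : XR) - y_ k s| @[k --> \oo] --> `|(x s : XR) - y s|.
  by move=> st; apply: cvg_norm; apply: cvgB; apply: cv => //; [exact: xx|exact: yy].
have H1 : 0 <= t <= t by rewrite t0 lexx.
have H2 : 0 <= (0 : R) <= t by rewrite lexx.
apply: ler_cvg_to (d t H1) (d 0 H2) _; apply: nearW => k.
exact: strong_solution_contraction.
Qed.

Hypothesis Astep : forall h, 0 < h -> implicit_step_solvable A h.
Hypothesis Adense : forall (x : XR) e, 0 < e ->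
  exists z, dom A z /\ `|z - x| < e.
Local Notation SG := (nl_semigroup A).

Lemma nl_semigroup_strong_solution (z : XR) : dom A z ->
  strong_solution S phi (fun t => SG t z : X).
Proof.
move=> dz; split=> [t t0|]; first by have [] := nl_semigroup_dom Adiss Astep Adense dz t0.
exists (fun t => feedback_op S phi (SG t z)).
  apply: (@right_derivative_H1loc R X (fun t => SG t z) (fun t => A (SG t z)) `|A z|).
  - move=> t e t0 e0.
    exact: (nl_semigroup_op_right_cont Adiss Astep Adense dz t0 e0).
  - by move=> s s0; have [] := nl_semigroup_dom Adiss Astep Adense dz s0.
  - move=> a b a0 ab; rewrite mulrC.
    exact: (nl_semigroup_lip_le Adiss Astep Adense dz a0 ab).
  - move=> s e s0 e0.
    exact: (nl_semigroup_increment Adiss Astep Adense dz s0 e0).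
by apply: aeW.
Qed.

(** The semigroup is only meaningful for nonnegative times; freezing it before
    the time 0 makes the orbit continuous on the whole line. *)
Definition closed_loop_orbit (x0 : X) (t : R) : X := SG (Num.max t 0) (x0 : XR).

Lemma closed_loop_orbit_continuous (x0 : X) : continuous (closed_loop_orbit x0).
Proof.
move=> t; apply/cvg_realify; apply/cvgrPdist_lt => e e0.
have e4 : 0 < e / 4 by rewrite divr_gt0.
have [z [dz zx]] := Adense (x0 : XR) e4.
have A1 : 0 < `|A z| + 1 by rewrite ltr_wpDl.
have e2 : 0 < e / 2 / (`|A z| + 1) by rewrite !divr_gt0.
have max0 (s : R) : 0 <= Num.max s 0 by rewrite le_max lexx orbT.
near=> s.
have ts : `|t - s| < e / 2 / (`|A z| + 1).
  by near: s; apply/nbhs_normP; exists (e / 2 / (`|A z| + 1)).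
rewrite ltr_pdivlMr// in ts.
have H1 := nl_semigroup_contraction Adiss Astep Adense (x0 : XR) z (max0 t).
have H2 := nl_semigroup_contraction Adiss Astep Adense z (x0 : XR) (max0 s).
have H3 := nl_semigroup_lip Adiss Astep Adense dz (max0 s) (max0 t).
have H4 : `|Num.max t 0 - Num.max s 0| <= `|t - s| := dist_max0_le t s.
have H5 : `|Num.max t 0 - Num.max s 0| * `|A z| < e / 2.
  by apply: le_lt_trans ts; rewrite ler_pM// lerDl.
rewrite (distrC (x0 : XR) z) in H1.
have H6 := ler_distD (SG (Num.max t 0) z : XR) (SG (Num.max t 0) x0 : XR)
  (SG (Num.max s 0) x0 : XR).
have H7 := ler_distD (SG (Num.max s 0) z : XR) (SG (Num.max t 0) z : XR)
  (SG (Num.max s 0) x0 : XR).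
rewrite /closed_loop_orbit; lra.
Unshelve. all: by end_near. Qed.

Lemma closed_loop_orbit_solution (x0 : X) :
  generalised_solution S phi (closed_loop_orbit x0).
Proof.
split; first by apply: continuous_subspaceT; exact: closed_loop_orbit_continuous.
have Hz (k : nat) : exists z : XR, dom A z /\ `|z - (x0 : XR)| < k.+1%:R^-1.
  by apply: Adense; rewrite invr_gt0.
have [z zP] := choice Hz.
exists (fun k t => SG t (z k) : X).
  by move=> k; apply: nl_semigroup_strong_solution; have [] := zP k.
move=> tau tau0; apply: (@uniform_of_dist _ _ _ _ _ (fun k => k.+1%:R^-1)).
  exact: cvg_harmonic.
move=> k t /=; rewrite in_itv/= => /andP[t0 _].
rewrite /closed_loop_orbit max_l// ltW//; have [_ zk] := zP k.
apply: le_lt_trans zk.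
exact: (nl_semigroup_contraction Adiss Astep Adense (z k) (x0 : XR) t0).
Qed.

End ClosedLoopSolutions.

Theorem theorem1p2 (R : realType) (U X : hilbertType R)
    (S : system_node U X U)
    (S_passive : impedance_passive S)
    (lam c_lam : R) (lam_gt0 : 0 < lam) (c_lam_gt0 : 0 < c_lam)
    (lam_res : resolvent_set (main_op S) lam%:C)
    (Padj : U -> U) (PadjP : adjoint_of (transfer S lam%:C) Padj)
    (P_coercive : forall u,
       c_lam%:C * inner u u <= inner (transfer S lam%:C u + Padj u) u)
    (kerC_dense : dense (kerC S))
    (phi : U -> U)
    (phi_lip : locally_lipschitz phi)
    (phi_mono : monotone_fun phi)
    (phi0 : phi 0 = 0)
    (phi_strict : forall u1 u2, phi u1 <> phi u2 ->
       0 < complex.Re (inner (phi u2 - phi u1) (u2 - u1)))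
    (alpha beta delta : R)
    (alpha_gt0 : 0 < alpha) (beta_gt0 : 0 < beta) (delta_gt0 : 0 < delta)
    (phi_small : forall u, hnorm u < delta ->
       alpha * hnorm u ^+ 2 <= complex.Re (inner (phi u) u))
    (phi_large : forall u, delta <= hnorm u ->
       beta <= complex.Re (inner (phi u) u))
    (TK : R -> {linear X -> X})
    (TK_C0 : C0_semigroup TK)
    (TK_gen : generates (feedback_K S) TK)
    (TK_stable : strongly_stable TK) :
  forall x0 : X, exists x : R -> X,
    [/\ generalised_solution S phi x,
        x 0 = x0,
        forall x', generalised_solution S phi x' -> x' 0 = x0 ->
          forall t, 0 <= t -> x' t = x t &
        hnorm (x t) @[t --> +oo] --> (0 : R)].
Proof.
move=> x0; have [Rl RlP] := lam_res.
have phil := locally_lipschitz_realify phi_lip.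
have small (u : realify U) : `|u| < delta ->
    alpha * `|u| ^+ 2 <= rdot (phi u : realify U) u by exact: phi_small.
have large (u : realify U) : delta <= `|u| -> beta <= rdot (phi u : realify U) u.
  exact: phi_large.
pose A : partial_op (realify X) (realify X) := feedback_op S phi.
have Adiss : dissipative A by exact: feedback_dissipative.
have Astep h : 0 < h -> implicit_step_solvable A h.
  exact: (feedback_solvable S_passive phi_mono phi_strict lam_gt0 c_lam_gt0 RlP
    PadjP P_coercive phil).
have Adense (x : realify X) e : 0 < e -> exists z, dom A z /\ `|z - x| < e.
  exact: feedback_dense.
exists (closed_loop_orbit S phi x0).
have sol := closed_loop_orbit_solution Adiss Astep Adense x0.
have orbit0 : closed_loop_orbit S phi x0 0 = x0.
  by rewrite /closed_loop_orbit maxxx (nl_semigroup0 A).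
split => //.
- move=> x' sol' x'0 t t0; apply/eqP; rewrite -subr_eq0.
  have := generalised_solution_contraction Adiss t0 sol' sol.
  by rewrite x'0 orbit0 subrr normr0 normr_le0.
- apply/cvgrPdist_lt => e e0.
  have decay := closed_loop_decay S_passive phi_mono phi_strict phi0 lam_gt0
    c_lam_gt0 RlP PadjP P_coercive kerC_dense phil alpha_gt0 beta_gt0
    small large TK_C0 TK_gen TK_stable (x0 : realify X) e0.
  near=> t; have t0 : 0 <= t by near: t; apply: nbhs_pinfty_ge; exact: num_real.
  rewrite sub0r normrN /closed_loop_orbit max_l//.
  rewrite ger0_norm; last exact: (@normr_ge0 _ (realify X)).
  by near: t; exact: decay.
Unshelve. all: by end_near. Qed.
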